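(* Let $f:\mathbb{C}\to\mathbb{C}$ be a transcendental entire function, let $R>0$ be such that $M(r,f)>r$ for all $r\ge R$, and let $L\in\mathbb{Z}$. If $U$ is a Fatou component of $f$ that meets $A_R^L(f)$, then (a) $\overline{U}\subset A_R^{L-1}(f)$; (b) if, in addition, $U$ is simply connected, then $\overline{U}\subset A_R^L(f)$.
   Context: $\mathbb{N}=\{1,2,\dots\}$; $f^n$ denotes the $n$th iterate of $f$. The Fatou set $F(f)$ is the set of $z\in\mathbb{C}$ having a neighbourhood in which $(f^n)_{n\in\mathbb{N}}$ is a normal family; a Fatou component is a connected component of $F(f)$. $M(r,f)=\max_{|z|=r}|f(z)|$ for $r>0$, and $M^n(r,f)$ denotes the $n$th iterate of $r\mapsto M(r,f)$ (so $M^0(r,f)=r$). For $L\in\mathbb{Z}$, $A_R^L(f)=\{z: |f^n(z)|\ge M^{n+L}(R,f)\text{ for all } n\in\mathbb{N}\text{ with } n+L\ge 0\}$. Closures are taken in $\mathbb{C}$. *)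

(* Defs.v *)
From HB Require Import structures.
From mathcomp Require Import all_boot all_order all_algebra.
From mathcomp Require Import all_classical all_reals all_analysis.
From mathcomp Require Import complex.

Set Implicit Arguments.
Unset Strict Implicit.
Unset Printing Implicit Defensive.

Import Order.TTheory GRing.Theory Num.Theory.
Import numFieldNormedType.Exports.

Local Open Scope classical_set_scope.
Local Open Scope complex_scope.
Local Open Scope ring_scope.

(* R[i] inherits the usual topology from its structure of numFieldType: the
   library provides it on the alias R[i]^o only. R[i] is thereby a normed module
   over itself, so that [derivable f z 1] means complex differentiability. *)
HB.instance Definition _ (R : realType) := NormedModule.copy R[i] (R[i]^o).

(* The modulus as an element of R; the generic norm `|z| takes values in R[i]. *)
Definition cmod (R : realType) (z : R[i]) : R := Normc.normc z.

Definition entire (R : realType) (f : R[i] -> R[i]) : Prop :=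
  forall z, derivable f z 1.

Definition transcendental_entire (R : realType) (f : R[i] -> R[i]) : Prop :=
  entire f /\ ~ (exists p : {poly R[i]}, forall z, f z = p.[z]).

(* For r >= 0 and f continuous the set is nonempty and compact, so this
   supremum is a maximum. *)
Definition max_modulus (R : realType) (f : R[i] -> R[i]) (r : R) : R :=
  sup [set cmod (f z) | z in [set z | cmod z = r]].

(* The Riemann sphere is option R[i], with None the point at infinity. *)
Definition chordal (R : realType) (a b : option R[i]) : R :=
  match a, b with
  | Some z, Some w =>
      2 * cmod (z - w)
        / (Num.sqrt (1 + cmod z ^+ 2) * Num.sqrt (1 + cmod w ^+ 2))
  | Some z, None => 2 / Num.sqrt (1 + cmod z ^+ 2)
  | None, Some w => 2 / Num.sqrt (1 + cmod w ^+ 2)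
  | None, None => 0
  end.

Definition locally_uniformly_cvg (R : realType) (D : set R[i])
    (g : nat -> R[i] -> option R[i]) (h : R[i] -> option R[i]) : Prop :=
  forall z, D z -> exists2 V : set R[i], nbhs z V &
    forall e : R, 0 < e -> exists N : nat, forall n : nat, (N <= n)%N ->
      forall w, D w -> V w -> chordal (g n w) (h w) < e.

(* Convergence is in the spherical metric, so the limit may be infinite. *)
Definition normal_family (R : realType) (D : set R[i])
    (F : set (R[i] -> R[i])) : Prop :=
  forall g : nat -> R[i] -> R[i], (forall k, F (g k)) ->
    exists2 phi : nat -> nat, {homo phi : m n / (m < n)%N} &
      exists h : R[i] -> option R[i],
        locally_uniformly_cvg D (fun k z => Some (g (phi k) z)) h.

Definition fatou_set (R : realType) (f : R[i] -> R[i]) : set R[i] :=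
  [set z | exists2 V : set R[i], open_nbhs z V &
    normal_family V [set iter n f | n in [set n | (0 < n)%N]]].

Definition fatou_component (R : realType) (f : R[i] -> R[i])
    (U : set R[i]) : Prop :=
  exists2 z, fatou_set f z & U = connected_component (fatou_set f) z.

Definition path_in (R : realType) (U : set R[i]) (x y : R[i])
    (g : R -> R[i]) : Prop :=
  [/\ {within `[0, 1], continuous g}, g @` `[0, 1] `<=` U, g 0 = x & g 1 = y].

(* Homotopy with fixed endpoints; [H (s, t)] is at time [s] the point of
   parameter [t]. *)
Definition null_homotopic (R : realType) (U : set R[i]) (x : R[i])
    (g : R -> R[i]) : Prop :=
  exists H : R * R -> R[i],
    [/\ {within `[0, 1] `*` `[0, 1], continuous H},
        H @` (`[0, 1] `*` `[0, 1]) `<=` U,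
        forall t : R, 0 <= t <= 1 -> H (0, t) = g t /\ H (1, t) = x &
        forall s : R, 0 <= s <= 1 -> H (s, 0) = x /\ H (s, 1) = x].

Definition simply_connected (R : realType) (U : set R[i]) : Prop :=
  (forall x y, U x -> U y -> exists g, path_in U x y g) /\
  (forall x g, path_in U x x g -> null_homotopic U x g).

(* The set A_r^L(f); the index n + L is a natural number m. *)
Definition fast_escaping (R : realType) (f : R[i] -> R[i]) (r : R) (L : int) :
    set R[i] :=
  [set z | forall n m : nat, (0 < n)%N -> n%:Z + L = m%:Z ->
    iter m (max_modulus f) r <= cmod (iter n f z)].

(* Main.v *)
(** Write [a_n z = ln |f^n z|]. Near a Fatou point that is a limit of escaping
    points, [|f^n| >= 1] for large [n] by normality, so [a_n] is there a
    nonnegative harmonic function; Harnack's inequality and the connectedness of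
    [U] give [a_n z <= K a_n z'] for large [n], for all [z], [z'] in [U]. If [z] is in
    the fast escaping set and [|f^n z'| < M^(n+L-1)(r0)] for some [n], then
    [T_k = M^(n+k+L-1)(r0)] satisfies [|f^(n+k) z'| <= T_k] and [|f^(n+k) z| >= M(T_k) >= T_k^(K+1)], a contradiction
    since [f] is transcendental: this is (a). The same growth shows that distinct
    iterates of [U] are disjoint.

    For (b), the quotients [|f^n z| / |f^n z'|] are bounded when [U] is simply
    connected: otherwise, by Bloch's theorem for [log f^n], some [f^n(U)] covers an
    annulus about 0, which as [U] wanders contradicts the maximum principle applied to
    [exp (exp (- i pi (log f^n - c)))] on the compact part of [U] lying over a
    thinner annulus. But if [v_k = |f^(n+k) z'|] is less than [S_k = M^(n+k+L)(r0)] for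
    [k = 0], it remains so, and [M(S) / M(v) >= (S / v)^2] makes [S_k / v_k] unbounded. *)

Require Import Defs.
From HB Require Import structures.
From mathcomp Require Import all_boot all_order all_algebra.
From mathcomp Require Import all_classical all_reals all_analysis.
From mathcomp Require Import complex.
From mathcomp Require Import ring lra zify.

Set Implicit Arguments.
Unset Strict Implicit.
Unset Printing Implicit Defensive.

Import Order.TTheory GRing.Theory Num.Theory.
Import numFieldNormedType.Exports.

Local Open Scope classical_set_scope.
Local Open Scope complex_scope.
Local Open Scope ring_scope.

(** Part (a) compares logarithms of moduli up to a factor independent of [n]; one spare application
    of [M] absorbs any such factor, and it costs one index. Part (b) has no index to spare and
    compares the moduli themselves, so the derivative of a local branch of [log f^n] has to be
    bounded uniformly in [n]. A large derivative makes this branch cover a disc of radius 6, more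
    than a full period high, which is why its exponential fills a whole annulus. Simple
    connectedness is homotopical and provides a branch of [log f^n] on all of [U], by lifting paths
    and homotopies; the function in the maximum principle is built from it.

    The function theory rests on primitives: an integral along a curve is the increment of a
    function whose derivative is the integrand, and it is estimated by the mean value inequality.
    The substitution [w = z + exp x] turns circles about [z] into vertical segments, so that
    Goursat's theorem for rectangles suffices for Cauchy's estimates. *)

Local Arguments cmod : simpl never.

(** * Complex derivatives *)

Section Modulus.
Context {R : realType}.
Local Notation C := R[i].
Implicit Types (z w : C) (x y e : R).

Lemma cmod0 : cmod (0 : C) = 0. Proof. exact: Normc.normc0. Qed.
Lemma cmod1 : cmod (1 : C) = 1. Proof. exact: Normc.normc1. Qed.
Lemma cmod_ge0 z : 0 <= cmod z. Proof. by case: z => a b; exact: sqrtr_ge0. Qed.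
Lemma cmodM z w : cmod (z * w) = cmod z * cmod w. Proof. exact: Normc.normcM. Qed.
Lemma cmodV z : cmod z^-1 = (cmod z)^-1. Proof. exact: Normc.normcV. Qed.
Lemma cmodN z : cmod (- z) = cmod z. Proof. exact: normcN. Qed.
Lemma cmodD z w : cmod (z + w) <= cmod z + cmod w. Proof. exact: le_normcD. Qed.
Lemma cmodBC z w : cmod (z - w) = cmod (w - z). Proof. by rewrite -cmodN opprB. Qed.
Lemma cmod_eq0 z : (cmod z == 0) = (z == 0).
Proof. by apply/eqP/eqP => [/Normc.eq0_normc|->] //; exact: cmod0. Qed.
Lemma cmod_gt0 z : (0 < cmod z) = (z != 0).
Proof. by rewrite lt_def cmod_ge0 cmod_eq0 andbT. Qed.
Lemma cmodX z n : cmod (z ^+ n) = cmod z ^+ n.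
Proof. by elim: n => [|n IH]; rewrite ?expr0 ?cmod1 // !exprS cmodM IH. Qed.
Lemma cmod_real x : cmod x%:C = `|x|.
Proof. by rewrite /cmod /= expr0n /= addr0 sqrtr_sqr. Qed.
Lemma cmodi : cmod ('i : C) = 1.
Proof. by rewrite /cmod /= expr0n /= expr1n add0r sqrtr1. Qed.
Lemma cmod_sqr z : cmod z ^+ 2 = complex.Re z ^+ 2 + complex.Im z ^+ 2.
Proof. by case: z => a b; rewrite /cmod /= sqr_sqrtr // addr_ge0 ?sqr_ge0. Qed.
Lemma cmod_Re z : `|complex.Re z| <= cmod z.
Proof.
rewrite -(@ler_pXn2r _ 2) ?nnegrE ?cmod_ge0 // cmod_sqr real_normK ?num_real //.
by rewrite lerDl sqr_ge0.
Qed.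
Lemma cmod_Im z : `|complex.Im z| <= cmod z.
Proof.
rewrite -(@ler_pXn2r _ 2) ?nnegrE ?cmod_ge0 // cmod_sqr real_normK ?num_real //.
by rewrite lerDr sqr_ge0.
Qed.
Lemma complexEi z : z = (complex.Re z)%:C + 'i * (complex.Im z)%:C.
Proof. exact: complexE. Qed.
Lemma cmod_ReIm z : cmod z <= `|complex.Re z| + `|complex.Im z|.
Proof.
rewrite {1}[z]complexEi; apply: le_trans (cmodD _ _) _.
by rewrite cmodM cmodi mul1r !cmod_real.
Qed.
Lemma cmod_tri z w v : cmod (z - v) <= cmod (z - w) + cmod (w - v).
Proof. by apply: le_trans (cmodD _ _); rewrite addrA subrK. Qed.
Lemma cmodB_ge z w : cmod z - cmod w <= cmod (z - w).
Proof. by rewrite lerBlDr -{1}(subrK w z); exact: cmodD. Qed.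
Lemma cmodB_le z w : cmod (z - w) <= cmod z + cmod w.
Proof. by rewrite -(cmodN w); exact: cmodD. Qed.
Lemma cmod_dist z w : `|cmod z - cmod w| <= cmod (z - w).
Proof. by rewrite ler_norml cmodB_ge andbT lerNl opprB cmodBC cmodB_ge. Qed.

Lemma normc_cmod z : `|z| = (cmod z)%:C.
Proof. by rewrite normc_def; congr (_ %:C); case: z. Qed.

(** Balls of [R[i]] have radii in [R[i]]; positivity there forces the imaginary part to vanish, so
    the real part can serve as radius. *)
Lemma nbhs_cmodP z (V : set C) :
  nbhs z V <-> exists2 e : R, 0 < e & forall w, cmod (w - z) < e -> V w.
Proof.
split=> [/nbhs_ballP[e /= e0 h]|[e e0 h]].
  have := e0; rewrite ltcE /= => /andP[/eqP ime ree].
  exists (complex.Re e) => // w hw; apply: h.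
  by rewrite -ball_normE /= normc_cmod cmodBC ltcE /= ime eqxx.
apply/nbhs_ballP; exists e%:C; first by rewrite /= ltcR.
move=> w; rewrite -ball_normE /= normc_cmod ltcR cmodBC; exact: h.
Qed.

End Modulus.

Section GeneralDerivative.
Context {R : realType}.
Local Notation C := R[i].

(* Taking [i] the identity of C, or the embedding of R in C, gives the
   complex derivative and the derivative of a curve. *)
Definition gder (X : Type) (i : X -> C) (f : X -> C) (x : X) (d : C) :=
  forall e : R, 0 < e -> exists2 del : R, 0 < del &
    forall y, cmod (i y - i x) < del ->
      cmod (f y - f x - d * (i y - i x)) <= e * cmod (i y - i x).

Definition cder := @gder C id.
Definition pder := @gder R (real_complex R).

Definition ccont (f : C -> C) (z : C) := forall e : R, 0 < e ->
  exists2 del : R, 0 < del & forall w, cmod (w - z) < del -> cmod (f w - f z) < e.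

Section Rules.
Context {X : Type} {i : X -> C}.
Local Notation gder := (@gder X i).
Implicit Types (f g : X -> C) (x : X) (d : C) (a : C).

Lemma gder_cont f x d : gder f x d -> forall e : R, 0 < e ->
  exists2 del : R, 0 < del & forall y, cmod (i y - i x) < del -> cmod (f y - f x) < e.
Proof.
move=> h e e0; have [del del0 hd] := h 1 ltr01.
pose k := 1 + cmod d.
have k0 : 0 < k by rewrite ltr_pwDl ?cmod_ge0.
exists (Num.min del (e / k)) => [|y]; first by rewrite lt_min del0 divr_gt0.
rewrite lt_min => /andP[/hd h1 h2].
have -> : f y - f x = (f y - f x - d * (i y - i x)) + d * (i y - i x) by ring.
apply: le_lt_trans (cmodD _ _) _; rewrite cmodM.
apply: le_lt_trans (_ : k * cmod (i y - i x) < e).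
  by rewrite /k mulrDl lerD2r.
by rewrite mulrC -ltr_pdivlMr.
Qed.

Lemma gder_const a x : gder (fun=> a) x 0.
Proof.
by move=> e e0; exists 1 => // y _; rewrite subrr mul0r subr0 cmod0 mulr_ge0 ?cmod_ge0 ?ltW.
Qed.

Lemma gder_i x : gder i x 1.
Proof.
by move=> e e0; exists 1 => // y _; rewrite mul1r subrr cmod0 mulr_ge0 ?cmod_ge0 ?ltW.
Qed.

Lemma gderD f g x d d' : gder f x d -> gder g x d' ->
  gder (fun y => f y + g y) x (d + d').
Proof.
move=> hf hg e e0; have e20 : 0 < e / 2 by lra.
have [d1 d10 h1] := hf _ e20; have [d2 d20 h2] := hg _ e20.
exists (Num.min d1 d2) => [|y]; first by rewrite lt_min d10.
rewrite lt_min => /andP[/h1 k1 /h2 k2].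
have -> : f y + g y - (f x + g x) - (d + d') * (i y - i x) =
  (f y - f x - d * (i y - i x)) + (g y - g x - d' * (i y - i x)) by ring.
apply: le_trans (cmodD _ _) _; lra.
Qed.

Lemma gderMl f x d a : gder f x d -> gder (fun y => a * f y) x (a * d).
Proof.
move=> hf e e0; pose k := 1 + cmod a.
have k0 : 0 < k by rewrite ltr_pwDl ?cmod_ge0.
have [del del0 h] := hf (e / k) (divr_gt0 e0 k0).
exists del => // y /h {}h.
have -> : a * f y - a * f x - a * d * (i y - i x) = a * (f y - f x - d * (i y - i x)) by ring.
rewrite cmodM; apply: le_trans (_ : k * (e / k * cmod (i y - i x)) <= _).
  by rewrite ler_pM ?cmod_ge0 // /k lerDr.
by rewrite mulrA mulrCA divff ?gt_eqF // mulr1.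
Qed.

Lemma gderN f x d : gder f x d -> gder (fun y => - f y) x (- d).
Proof.
move=> /(gderMl (-1)); rewrite mulN1r; congr (gder _ _ _).
by apply/funext => y; rewrite mulN1r.
Qed.

Lemma gderB f g x d d' : gder f x d -> gder g x d' ->
  gder (fun y => f y - g y) x (d - d').
Proof. by move=> hf hg; exact: gderD hf (gderN hg). Qed.

Lemma gder_comp (F : C -> C) f x d D : gder f x d -> cder F (f x) D ->
  gder (fun y => F (f y)) x (D * d).
Proof.
move=> hf hF e e0.
pose k := 1 + cmod d; have k0 : 0 < k by rewrite ltr_pwDl ?cmod_ge0.
pose K := 1 + cmod D; have K0 : 0 < K by rewrite ltr_pwDl ?cmod_ge0.
have e1 : 0 < e / 2 / k by rewrite !divr_gt0.
have [r1 r10 h1] := hF _ e1.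
have [r2 r20 h2] := gder_cont hf r10.
have [r3 r30 h3] := hf 1 ltr01.
have e4 : 0 < e / 2 / K by rewrite !divr_gt0.
have [r4 r40 h4] := hf _ e4.
exists (Num.min r2 (Num.min r3 r4)) => [|y]; first by rewrite !lt_min r20 r30.
rewrite !lt_min => /and3P[/h2/h1 k1 /h3 k3 /h4 k4].
have k3' : cmod (f y - f x) <= k * cmod (i y - i x).
  rewrite -(subrK (d * (i y - i x)) (f y - f x)).
  by apply: le_trans (cmodD _ _) _; rewrite cmodM /k mulrDl lerD2r.
have -> : F (f y) - F (f x) - D * d * (i y - i x) =
  (F (f y) - F (f x) - D * (f y - f x)) + D * (f y - f x - d * (i y - i x)) by ring.
apply: le_trans (cmodD _ _) _; rewrite cmodM (_ : e = e / 2 + e / 2); last by lra.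
rewrite mulrDl lerD //.
  apply: le_trans k1 _; apply: le_trans (_ : e / 2 / k * (k * cmod (i y - i x)) <= _).
    by rewrite ler_pM2l.
  by rewrite mulrA divfK ?gt_eqF.
apply: le_trans (_ : K * (e / 2 / K * cmod (i y - i x)) <= _).
  by rewrite ler_pM ?cmod_ge0 // /K lerDr.
by rewrite mulrA mulrCA divff ?gt_eqF // mulr1.
Qed.

Lemma gder_local f g x d (r : R) : 0 < r ->
  (forall y, cmod (i y - i x) < r -> f y = g y) -> gder f x d -> gder g x d.
Proof.
move=> r0 fg hf e e0; have [del del0 h] := hf e e0.
exists (Num.min r del) => [|y]; first by rewrite lt_min r0.
rewrite lt_min => /andP[/fg yr /h]; rewrite -yr -fg // subrr cmod0 //.
Qed.

Lemma gder_ext f g x d : (forall y, f y = g y) -> gder f x d -> gder g x d.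
Proof. by move=> fg; apply: (@gder_local _ _ _ _ 1). Qed.

Lemma gder_eqd f x d d' : d = d' -> gder f x d -> gder f x d'.
Proof. by move=> ->. Qed.
End Rules.

Lemma cder_cont (f : C -> C) z d : cder f z d -> ccont f z.
Proof. exact: gder_cont. Qed.

Lemma cder_sqr z : cder (fun w => w ^+ 2) z (2 * z).
Proof.
move=> e e0; exists e => // y hy.
have -> : y ^+ 2 - z ^+ 2 - 2 * z * (y - z) = (y - z) * (y - z) by ring.
by rewrite cmodM ler_wpM2r ?cmod_ge0 // ltW.
Qed.

Lemma cder_inv z : z != 0 -> cder (fun w => w^-1) z (- z^-1 ^+ 2).
Proof.
move=> z0 e e0; have cz : 0 < cmod z by rewrite cmod_gt0.
(* For [cmod y > cmod z / 2] the denominator [z ^+ 2 * y] has modulus above [cmod z ^+ 3 / 2], which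
   is [k]. *)
pose k := cmod z ^+ 3 / 2; have k0 : 0 < k by rewrite divr_gt0 // exprn_gt0.
exists (Num.min (cmod z / 2) (e * k)) => [|y]; first by rewrite lt_min; apply/andP; split; [lra|exact: mulr_gt0].
rewrite lt_min => /andP[h1 h2].
have cy : cmod z / 2 < cmod y.
  by have := cmodB_ge z y; rewrite cmodBC; lra.
have y0 : y != 0 by rewrite -cmod_gt0; lra.
have -> : y^-1 - z^-1 - - z^-1 ^+ 2 * (y - z) = (y - z) * ((y - z) / (z ^+ 2 * y)) by field; rewrite ?z0 ?y0.
rewrite cmodM mulrC ler_wpM2r ?cmod_ge0 //.
rewrite cmodM cmodV cmodM cmodX ler_pdivrMr ?mulr_gt0 ?exprn_gt0 ?cmod_gt0 //.
apply: le_trans (ltW h2) _; rewrite ler_pM2l // /k exprS [_ ^+ 2 * _]mulrC mulrAC.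
by rewrite ler_wpM2r ?sqr_ge0 // ltW.
Qed.

Section Product.
Context {X : Type} {i : X -> C}.
Implicit Types (f g : X -> C) (x : X) (d : C) (a : C).

Lemma gderM f g x d d' : gder i f x d -> gder i g x d' ->
  gder i (fun y => f y * g y) x (d * g x + f x * d').
Proof.
move=> hf hg.
(* [f * g = ((f + g)^2 - (f - g)^2) / 4] *)
have hs := gder_comp (gderD hf hg) (cder_sqr _).
have hd := gder_comp (gderB hf hg) (cder_sqr _).
apply: (gder_ext _ (gder_eqd _ (gderMl (4^-1) (gderB hs hd)))) => [y|]; by field.
Qed.

Lemma gder_div f g x d d' : g x != 0 -> gder i f x d -> gder i g x d' ->
  gder i (fun y => f y / g y) x ((d * g x - f x * d') / g x ^+ 2).
Proof.
move=> g0 hf hg; apply: (gder_eqd _ (gderM hf (gder_comp hg (cder_inv g0)))).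
by field.
Qed.

Lemma gder_exp f x d n : gder i f x d ->
  gder i (fun y => f y ^+ n) x (n%:R * f x ^+ n.-1 * d).
Proof.
move=> hf; elim: n => [|n IH].
  by rewrite !mul0r; apply: gder_const.
apply: (gder_ext _ (gder_eqd _ (gderM hf IH))) => [y|]; first by rewrite exprS.
case: n {IH} => [|n] /=; first by rewrite expr0; ring.
by rewrite exprS -[in RHS]natr1; ring.
Qed.
End Product.

Lemma derivable_cder (f : C -> C) z : derivable f z 1 -> exists d, cder f z d.
Proof.
rewrite /derivable => /cvg_ex[/= d hd].
exists d => e e0.
have /hd : nbhs d [set w | cmod (w - d) < e] by apply/nbhs_cmodP; exists e.
rewrite /= => /nbhs_cmodP [del del0 h]; exists del => // w hw.
have [->|wz] := eqVneq w z; first by rewrite !subrr mulr0 subr0 cmod0 mulr0.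
have wz0 : w - z != 0 by rewrite subr_eq0.
have := h (w - z); rewrite subr0 => /(_ hw wz0) /=.
rewrite /GRing.scale /= mulr1 subrK => hh.
have -> : f w - f z - d * (w - z) = ((w - z)^-1 * (f w - f z) - d) * (w - z) by field.
rewrite cmodM ler_wpM2r ?cmod_ge0 //; exact: ltW.
Qed.
End GeneralDerivative.
Arguments cder {R}.
Arguments pder {R}.

Section MeanValue.
Context {R : realType}.
Local Notation C := R[i].

Lemma is_derive_Re (p : R -> C) x d : pder p x d ->
  is_derive x 1 (fun t => complex.Re (p t)) (complex.Re d).
Proof.
move=> hp; have h : (fun h : R => h^-1 *: (((fun t => complex.Re (p t)) \o shift x) (h *: 1) - complex.Re (p x))) @ 0^' --> complex.Re d.
  apply/cvgrPdist_le => /= e e0; have [del del0 hd] := hp e e0.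
  near=> h.
  have h0 : h != 0 by near: h; exact: nbhs_dnbhs_neq.
  have hdel : `|h| < del by near: h; apply: dnbhs0_lt.
  have := hd (h + x); rewrite -rmorphB addrK cmod_real => /(_ hdel) k.
  rewrite [_%:A]mulr1 distrC -(@ler_pM2r _ `|h|) ?normr_gt0 // -normrM mulrBl.
  apply: le_trans k; apply: le_trans (cmod_Re _).
  rewrite /GRing.scale /= mulrAC mulVf // mul1r.
  by case: (p (h + x)) (p x) (d) => [? ?] [? ?] [a b] /=; rewrite mulr0 subr0.
apply: DeriveDef; [by apply/cvg_ex; exists (complex.Re d)|exact: cvg_lim].
Unshelve. all: by end_near. Qed.

Lemma pder_real (g : R -> R) (x d : R) : is_derive x 1 g d -> pder (fun t => (g t)%:C) x d%:C.
Proof.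
move=> [] /cvg_ex[/= l hl] gd; have {gd} ld : d = l by rewrite -gd; exact: cvg_lim.
rewrite {}ld {d} => e e0; move/cvgrPdist_le: hl => /(_ e e0).
move=> /nbhs_ballP[/= del del0 hd]; exists del => // y.
rewrite -!rmorphB -rmorphM -rmorphB !cmod_real => hy.
have [->|yx] := eqVneq y x; first by rewrite !subrr mulr0 subrr normr0 mulr0.
have yx0 : y - x != 0 by rewrite subr_eq0.
have := hd (y - x); rewrite -ball_normE /= sub0r normrN => /(_ hy yx0).
rewrite [_%:A]mulr1 subrK /GRing.scale /= => k.
have -> : g y - g x - l * (y - x) = - (l - (y - x)^-1 * (g y - g x)) * (y - x) by field.
by rewrite normrM normrN ler_wpM2r.
Qed.

Lemma pder_ge0_le (g g' : R -> R) (a b : R) : a <= b ->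
  (forall t, a <= t <= b -> is_derive t 1 g (g' t)) ->
  (forall t, a <= t <= b -> 0 <= g' t) -> g a <= g b.
Proof.
rewrite le_eqVlt => /orP[/eqP-> //|ab] hg hg'.
have [c||c cab h] := @MVT R g g' a b ab.
- by rewrite in_itv /= => /andP[h1 h2]; apply: hg; rewrite !ltW.
- apply: derivable_within_continuous => c; rewrite in_itv /= => h.
  by case: (hg c h).
rewrite -subr_ge0 h; apply: mulr_ge0; last by rewrite subr_ge0 ltW.
apply: hg'; by move: cab; rewrite in_itv /= => /andP[h1 h2]; rewrite !ltW.
Qed.

Lemma pder_cmod_le (p : R -> C) (phi : R -> R) p' phi' (a b : R) : a <= b ->
  (forall t, a <= t <= b -> pder p t (p' t)) ->
  (forall t, a <= t <= b -> is_derive t 1 phi (phi' t)) ->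
  (forall t, a <= t <= b -> cmod (p' t) <= phi' t) ->
  cmod (p b - p a) <= phi b - phi a.
Proof.
move=> ab hp hphi hle; set v := p b - p a.
have [v0|v0] := eqVneq v 0.
  rewrite v0 cmod0 subr_ge0; apply: (pder_ge0_le ab hphi) => t /hle; apply: le_trans.
  exact: cmod_ge0.
have cv : 0 < cmod v by rewrite cmod_gt0.
(* Project on the direction of [v]. *)
pose u : C := (complex.Re v +i* - complex.Im v) * (cmod v)^-1%:C.
have cu : cmod u = 1.
  rewrite cmodM cmod_real ger0_norm ?invr_ge0 ?cmod_ge0 //.
  have -> : cmod (complex.Re v +i* - complex.Im v) = cmod v.
    by case: (v) => x y; rewrite /cmod /= sqrrN.
  by rewrite divff ?gt_eqF.
have uv : complex.Re (u * v) = cmod v.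
  have -> : u * v = (cmod v)%:C.
    rewrite /u mulrAC -[RHS](mulfK (_ : (cmod v)%:C != 0)); last by rewrite fmorph_eq0 gt_eqF.
    rewrite fmorphV; congr (_ / _); rewrite -rmorphM -expr2 cmod_sqr.
    case: (v) => x y; apply/eqP; rewrite eq_complex /=; apply/andP; split; apply/eqP; ring.
  by [].
pose g t := phi t - complex.Re (u * p t).
have := @pder_ge0_le g (fun t => phi' t - complex.Re (u * p' t)) a b ab.
have hd t : a <= t <= b -> is_derive t 1 g (phi' t - complex.Re (u * p' t)).
  move=> ht; apply: is_deriveB; [exact: hphi|].
  by apply: is_derive_Re; apply: gder_eqd (gderMl u (hp t ht)).
have h0 t : a <= t <= b -> 0 <= phi' t - complex.Re (u * p' t).
  move=> ht; rewrite subr_ge0; apply: le_trans (hle t ht).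
  apply: le_trans (ler_norm _) _; apply: le_trans (cmod_Re _) _.
  by rewrite cmodM cu mul1r.
move=> /(_ hd h0); rewrite /g => h; move: uv; rewrite /v mulrBr raddfB /=; lra.
Qed.

Lemma pder_cmod_le_const (p p' : R -> C) (B a b : R) : a <= b ->
  (forall t, a <= t <= b -> pder p t (p' t)) ->
  (forall t, a <= t <= b -> cmod (p' t) <= B) ->
  cmod (p b - p a) <= B * (b - a).
Proof.
move=> ab hp hB; rewrite mulrBr.
apply: (@pder_cmod_le p (fun t => B * t) p' (fun=> B)) => // t _.
by apply: is_derive_eq; rewrite /GRing.scale /= mulr1.
Qed.

Lemma pder_line (f : C -> C) z v t d : cder f (z + t%:C * v) d ->
  pder (fun s => f (z + s%:C * v)) t (d * v).
Proof.
move=> h; apply: (@gder_comp _ _ _ f (fun s : R => z + s%:C * v) t v d _ h).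
apply: (gder_ext _ (gder_eqd _ (gderD (gder_const z t) (gderMl v (gder_i t))))) => [y|].
  by rewrite mulrC.
by rewrite add0r mulr1.
Qed.

Lemma cder_lipschitz (f f' : C -> C) (z w : C) (B : R) :
  (forall t : R, 0 <= t <= 1 -> cder f (z + t%:C * (w - z)) (f' (z + t%:C * (w - z)))) ->
  (forall t : R, 0 <= t <= 1 -> cmod (f' (z + t%:C * (w - z))) <= B) ->
  cmod (f w - f z) <= B * cmod (w - z).
Proof.
move=> hf hB.
have := @pder_cmod_le_const (fun s : R => f (z + s%:C * (w - z)))
  (fun s => f' (z + s%:C * (w - z)) * (w - z)) (B * cmod (w - z)) 0 1 ler01.
rewrite mul1r mul0r addr0 subrKC subr0 mulr1; apply=> t ht; first exact/pder_line/hf.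
by rewrite cmodM ler_wpM2r ?cmod_ge0 // hB.
Qed.

Lemma ball_segment (p z w : C) (t r : R) : 0 <= t <= 1 ->
  cmod (z - p) < r -> cmod (w - p) < r -> cmod (z + t%:C * (w - z) - p) < r.
Proof.
move=> /andP[t0 t1] hz hw.
have -> : z + t%:C * (w - z) - p = (1 - t)%:C * (z - p) + t%:C * (w - p).
  by rewrite rmorphB rmorph1; ring.
apply: le_lt_trans (cmodD _ _) _; rewrite !cmodM !cmod_real !ger0_norm ?subr_ge0 //.
have [->|tn0] := eqVneq t 0; first by rewrite subr0 mul1r mul0r addr0.
have tp : 0 < t by rewrite lt_def tn0.
apply: le_lt_trans (_ : (1 - t) * r + t * cmod (w - p) < r).
  by rewrite lerD2r ler_wpM2l ?subr_ge0 // ltW.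
by rewrite [X in _ < X](_ : r = (1 - t) * r + t * r) ?ltrD2l ?ltr_pM2l //; ring.
Qed.

End MeanValue.

(** * The complex exponential and the principal logarithm *)

Section ComplexExponential.
Context {R : realType}.
Local Notation C := R[i].
Implicit Types (z w : C).

Definition cexp z : C :=
  (expR (complex.Re z))%:C * (cos (complex.Im z) +i* sin (complex.Im z)).

Lemma cexpE (x y : R) : cexp (x +i* y) = (expR x * cos y) +i* (expR x * sin y).
Proof. by rewrite /cexp /=; apply/eqP; rewrite eq_complex /= !mul0r subr0 addr0 !eqxx. Qed.

Lemma cexpD z w : cexp (z + w) = cexp z * cexp w.
Proof.
case: z w => [a b] [c d]; rewrite -[_ + _]/((a + c) +i* (b + d)) !cexpE expRD cosD sinD.
by apply/eqP; rewrite eq_complex /=; apply/andP; split; apply/eqP; ring.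
Qed.

Lemma cexp0 : cexp 0 = 1.
Proof. by rewrite cexpE expR0 cos0 sin0 mulr1 mulr0. Qed.

Lemma cmod_cexp z : cmod (cexp z) = expR (complex.Re z).
Proof.
rewrite cmodM cmod_real ger0_norm ?expR_ge0 //.
by rewrite [X in _ * X](_ : _ = 1) ?mulr1 // /cmod /= cos2Dsin2 sqrtr1.
Qed.

Lemma cexp_neq0 z : cexp z != 0.
Proof. by rewrite -cmod_gt0 cmod_cexp expR_gt0. Qed.

Lemma cexpN z : cexp (- z) = (cexp z)^-1.
Proof. by apply: (mulIf (cexp_neq0 z)); rewrite -cexpD addNr cexp0 mulVf // cexp_neq0. Qed.

Lemma cexpB z w : cexp (z - w) = cexp z / cexp w.
Proof. by rewrite cexpD cexpN. Qed.

Lemma cexp_2pi z : cexp (z + 'i * (pi *+ 2)%:C) = cexp z.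
Proof.
case: z => a b; have -> : a +i* b + 'i * (pi *+ 2)%:C = a +i* (b + pi *+ 2).
  by apply/eqP; rewrite eq_complex /=; apply/andP; split; apply/eqP; ring.
by rewrite !cexpE cosD sinD cos2pi sin2pi !mulr1 !mulr0 subr0 addr0.
Qed.

Lemma is_derive_small (g : R -> R) (d : R) : is_derive (0 : R) 1 g d ->
  forall e : R, 0 < e -> exists2 del : R, 0 < del &
    forall x, `|x| < del -> `|g x - g 0 - d * x| <= e * `|x|.
Proof.
move=> /pder_real h e /h[del del0 hd]; exists del => // x hx.
have := hd x; rewrite !subr0 -rmorphB -rmorphM -rmorphB !cmod_real; exact.
Qed.

Lemma cder_cexp0 : cder cexp 0 1.
Proof.
move=> e e0.
(* The four error terms below are at most 1, 3, 3 and 2 times [e' * m], so a tenth of [e] leaves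
   room. *)
have [e' [e'0 e'1 ee']] : exists e' : R, [/\ 0 < e', e' <= 1 & 10 * e' <= e].
  have [h|h] := lerP e 1; last by exists 10^-1; split; lra.
  by exists (e / 10); split; lra.
have [d1 d10 h1] := is_derive_small (is_derive_expR 0) e'0.
have [d2 d20 h2] := is_derive_small (is_derive_cos 0) e'0.
have [d3 d30 h3] := is_derive_small (is_derive_sin 0) e'0.
exists (Num.min d1 (Num.min d2 (Num.min d3 e'))) => [|[x y]].
  by rewrite !lt_min d10 d20 d30.
rewrite !subr0 mul1r cexp0 => hxy.
have hx : `|x| <= cmod (x +i* y) by exact: cmod_Re (x +i* y).
have hy : `|y| <= cmod (x +i* y) by exact: cmod_Im (x +i* y).
move: hxy; rewrite !lt_min => /and4P[a1 a2 a3 a4].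
have := h1 _ (le_lt_trans hx a1); have := h2 _ (le_lt_trans hy a2).
have := h3 _ (le_lt_trans hy a3).
rewrite expR0 cos0 sin0 oppr0 mul0r !mul1r !subr0 !addr0.
set m := cmod _ in hx hy a1 a2 a3 a4 *.
set E := expR x => k3 k2 k1.
have m0 : 0 <= m by exact: cmod_ge0.
have E0 : `|E| <= 3.
  have -> : E = (E - 1 - x) + x + 1 by ring.
  apply: le_trans (ler_normD _ _) _; rewrite normr1.
  have := ler_normD (E - 1 - x) x; nra.
have E1 : `|E - 1| <= 2 * m.
  have := ler_normD (E - 1 - x) x; rewrite subrK; nra.
apply: le_trans (cmod_ReIm _) _; rewrite cexpE /= -/E.
have -> : E * cos y - 1 - x = (E - 1 - x) + E * (cos y - 1) by ring.
have -> : E * sin y - 0 - y = E * (sin y - y) + (E - 1) * y by ring.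
have := ler_normD (E - 1 - x) (E * (cos y - 1)).
have := ler_normD (E * (sin y - y)) ((E - 1) * y).
rewrite !normrM.
have b0 : e' * `|y| <= e' * m by rewrite ler_pM2l.
have b1 : `|E| * `|cos y - 1| <= 3 * (e' * m) by rewrite ler_pM // (le_trans k2).
have b2 : `|E| * `|sin y - y| <= 3 * (e' * m) by rewrite ler_pM // (le_trans k3).
have b3 : `|E - 1| * `|y| <= 2 * (e' * m).
  apply: le_trans (_ : (2 * m) * m <= _); first by rewrite ler_pM.
  by rewrite -mulrA ler_pM2l // ler_wpM2r // ltW.
have b4 : e' * `|x| <= e' * m by rewrite ler_pM2l.
have b5 : 9 * (e' * m) <= e * m by nra.
lra.
Qed.

Lemma cder_cexp z : cder cexp z (cexp z).
Proof.
have h : cder (fun w => w - z) z 1.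
  by apply: gder_eqd (gderB (gder_i z) (gder_const z z)); rewrite subr0.
have := gder_comp h; rewrite subrr => /(_ _ _ cder_cexp0) k.
apply: (gder_ext _ (gder_eqd _ (gderMl (cexp z) k))) => [w|]; last by rewrite !mulr1.
by rewrite -cexpD subrKC.
Qed.

(** The kernel of the exponential is discrete, because [cos] is injective on [0, pi] and [1 < pi].
    Hence a continuous difference of two logarithms of one function is locally constant. *)
Lemma cexp_eq1_small z : cexp z = 1 -> cmod z < 1 -> z = 0.
Proof.
case: z => a b h hz; have ha : a = 0.
  have := cmod_cexp (a +i* b); rewrite h cmod1 /= => /esym/eqP.
  by rewrite -expR0 => /eqP /expR_inj.
rewrite {}ha in h hz *; move: h; rewrite cexpE expR0 !mul1r => -[cb sb].
suff -> : b = 0 by [].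
have b1 : `|b| < 1 by apply: le_lt_trans hz; exact: cmod_Im (0 +i* b).
apply/normr0_eq0/(@cos_inj R).
- by rewrite in_itv /= normr_ge0 /= (le_trans (ltW b1)) // (le_trans _ (pi_ge2 _)) // ler1n.
- by rewrite in_itv /= lexx pi_ge0.
by rewrite cos0 -cb; case: (ger0P b) => // _; rewrite cosN.
Qed.

Lemma cexp_polar w : w != 0 -> exists z,
  [/\ cexp z = w, complex.Re z = ln (cmod w) & `|complex.Im z| <= pi].
Proof.
move=> w0; have cw : 0 < cmod w by rewrite cmod_gt0.
pose x := complex.Re w / cmod w; pose y := complex.Im w / cmod w.
have xy : x ^+ 2 + y ^+ 2 = 1.
  by rewrite !expr_div_n -mulrDl -cmod_sqr divff // expf_neq0 ?gt_eqF.
have x1 : -1 <= x <= 1 by have := sqr_ge0 y; nra.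
have sx : sin (acos x) = `|y|.
  by rewrite sin_acos // (_ : 1 - x ^+ 2 = y ^+ 2) ?sqrtr_sqr // -xy; ring.
have [a0 api] := (acos_ge0 x1, acos_lepi x1).
pose th := if 0 <= y then acos x else - acos x.
have [ct st] : cos th = x /\ sin th = y.
  rewrite /th; case: ifP => hy; first by rewrite acosK ?sx ?ger0_norm.
  by rewrite cosN sinN acosK // sx ltr0_norm ?opprK // ltNge hy.
exists (ln (cmod w) +i* th); split => //=.
  rewrite cexpE lnK ?posrE // ct st /x /y.
  by rewrite ![cmod w * _]mulrC !divfK ?gt_eqF //; case: (w).
by rewrite /th; case: ifP => _; rewrite ?normrN ger0_norm.
Qed.

(* A logarithm of [w] only for [Re w > 0]: elsewhere the imaginary part is wrong. *)
Definition clog w : C := ln (cmod w) +i* atan (complex.Im w / complex.Re w).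

Lemma clogK w : 0 < complex.Re w -> cexp (clog w) = w.
Proof.
case: w => a b /= a0; set w := a +i* b.
have w0 : w != 0 by rewrite eq_complex /= gt_eqF.
have cw : 0 < cmod w by rewrite cmod_gt0.
rewrite cexpE lnK ?posrE //=.
have hc : cmod w * cos (atan (b / a)) = a.
  rewrite cos_atan; have -> : 1 + (b / a) ^+ 2 = cmod w ^+ 2 / a ^+ 2.
    by rewrite cmod_sqr /=; field; rewrite gt_eqF.
  rewrite sqrtrM ?sqr_ge0 // sqrtrV ?sqr_ge0 // !sqrtr_sqr !ger0_norm ?ltW //.
  by field; rewrite !gt_eqF.
have hs : cmod w * sin (atan (b / a)) = b.
  have ht := atanK (b / a); rewrite /tan in ht.
  have c0 : cos (atan (b / a)) != 0.
    by apply/eqP => h; move: hc a0; rewrite h mulr0 => <-; rewrite ltxx.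
  have -> : sin (atan (b / a)) = b / a * cos (atan (b / a)).
    by move: ht => /(congr1 (fun u => u * cos (atan (b / a)))); rewrite divfK.
  by rewrite mulrCA hc divfK ?gt_eqF.
by rewrite hc hs.
Qed.

End ComplexExponential.

(** * Goursat's theorem, primitives and means over circles *)

Section CurvePrimitive.
Context {R : realType}.
Local Notation C := R[i].

Lemma real_primitive_right (g : R -> R) (a : R) : continuous g ->
  exists F : R -> R, forall x, a < x -> is_derive x 1 F (g x).
Proof.
move=> cg; pose F x := (\int[@lebesgue_measure R]_(t in `[a, x]) (g t))%R.
exists F => x ax.
have xu : x < x + 1 by rewrite ltrDl.
have ig : (@lebesgue_measure R).-integrable `[a, x + 1] (EFin \o g).
  apply: continuous_compact_integrable; first exact: segment_compact.
  exact: continuous_subspaceT.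
have [dF F'] := continuous_FTC1_closed xu ig ax (cg x).
by apply: (DeriveDef dF); rewrite -derive1E.
Qed.

Lemma pder_const_on (p : R -> C) (a : R) : (forall x, a < x -> pder p x 0) ->
  forall x y, a < x -> a < y -> p x = p y.
Proof.
move=> hp; suff h x y : a < x -> x <= y -> p x = p y.
  by move=> x y ax ay; have [/h->|/ltW/h->] := lerP x y.
move=> ax xy; have := @pder_cmod_le_const _ p (fun=> 0) 0 x y xy.
rewrite mul0r => h; apply/eqP; rewrite eq_sym -subr_eq0 -cmod_eq0.
rewrite eq_le cmod_ge0 andbT; apply: h => t /andP[xt _]; last by rewrite cmod0.
by apply: hp; exact: lt_le_trans xt.
Qed.

(** The fundamental theorem of calculus gives a primitive to the right of each [- n]. Normalised to
    vanish at 0, these agree on common domains and can be glued. *)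
Lemma curve_primitive (g : R -> C) :
  continuous (fun x => complex.Re (g x)) -> continuous (fun x => complex.Im (g x)) ->
  exists F : R -> C, forall x, pder F x (g x).
Proof.
move=> cr ci.
have h (n : nat) : exists F : R -> C, forall x, - n%:R < x -> pder F x (g x).
  have [A hA] := real_primitive_right (- n%:R) cr.
  have [B hB] := real_primitive_right (- n%:R) ci.
  exists (fun x => (A x)%:C + 'i * (B x)%:C) => x nx.
  rewrite [g x]complexEi; apply: gderD; first exact/pder_real/hA.
  exact/gderMl/pder_real/hB.
have {h} [F hF] := choice h.
pose N (x : R) := (Num.truncn `|x|).+1.
have hN x : - (N x)%:R < x.
  have := truncnS_gt `|x|; rewrite -/(N x) ltr_norml; by case/andP.
have F0 n : - n.+1%:R < 0 :> R by rewrite oppr_lt0 ltr0n.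
have key n m x : (n <= m)%N -> - n.+1%:R < x -> F n.+1 x - F n.+1 0 = F m.+1 x - F m.+1 0.
  move=> nm nx; have := @pder_const_on (fun x => F n.+1 x - F m.+1 x) (- n.+1%:R) _ x 0 nx (F0 n).
  move=> e; apply/eqP; rewrite -subr_eq0; apply/eqP.
  rewrite [LHS](_ : _ = (F n.+1 x - F m.+1 x) - (F n.+1 0 - F m.+1 0)); last by ring.
  rewrite e ?subrr // => y ny; rewrite -(subrr (g y)).
  apply: gderB; first exact: hF.
  by apply: hF; apply: le_lt_trans ny; rewrite lerN2 ler_nat.
exists (fun x => F (N x) x - F (N x) 0) => x.
(* One more than [N x], so that all points at distance less than 1 from [x] lie to the right of
   [- n]. *)
pose n := (N x).+1.
apply: (@gder_local _ _ _ (fun y => F n y - F n 0) _ _ _ 1) => // [y|].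
  rewrite -rmorphB cmod_real => hy.
  have yn : - n%:R < y.
    by have := hN x; move: hy; rewrite /n -natr1 ltr_norml => /andP[? _] ?; lra.
  have [hle|hle] := leqP (Num.truncn `|y|) (N x); last first.
    by rewrite /n /N; rewrite (key _ _ y (ltnW hle)).
  by rewrite /N -(key _ _ y hle) // hN.
rewrite -[g x]subr0; apply: gderB; last exact: gder_const.
by apply: hF; rewrite /n -natr1; have := hN x; lra.
Qed.
End CurvePrimitive.

Section Goursat.
Context {R : realType}.
Local Notation C := R[i].
Variables (G : C -> C) (X Y : R -> R -> C).
Hypothesis hX : forall y x, pder (X y) x (G (x +i* y)).
Hypothesis hY : forall x y, pder (Y x) y (G (x +i* y)).

(* [X] and [Y] are primitives of [G] along horizontal and vertical lines, so
   this is the integral of [G] along the boundary of [a, b] x [c, d]. *)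
Definition rect_int (a b c d : R) : C :=
  X c b - X c a - (X d b - X d a) + 'i * (Y b d - Y b c - (Y a d - Y a c)).

Lemma pder_horizontal (y x : R) : pder (fun t : R => t +i* y) x 1.
Proof.
apply: (gder_ext _ (gder_eqd _ (gderD (gder_i x) (gder_const (0 +i* y) x)))) => [t|].
  by apply/eqP; rewrite eq_complex /= addr0 add0r !eqxx.
by rewrite addr0.
Qed.

Lemma pder_vertical (x y : R) : pder (fun t : R => x +i* t) y 'i.
Proof.
apply: (gder_ext _ (gder_eqd _ (gderD (gder_const (x%:C) y) (gderMl 'i (gder_i y))))) => [t|].
  by apply/eqP; rewrite eq_complex /=; apply/andP; split; apply/eqP; ring.
by rewrite add0r mulr1.
Qed.

Lemma cmod_rect_dist (a b c d x y x' y' : R) : a <= x <= b -> c <= y <= d ->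
  a <= x' <= b -> c <= y' <= d -> cmod ((x +i* y) - (x' +i* y')) <= (b - a) + (d - c).
Proof.
move=> /andP[? ?] /andP[? ?] /andP[? ?] /andP[? ?].
apply: le_trans (cmod_ReIm _) _; rewrite /= lerD // ler_norml; lra.
Qed.

(** The affine function [L] has the primitive [Q] and contributes nothing around a rectangle. What
    is left is [G - L], at most [e / 2 * s] in modulus, over sides of total length [2 * s]. *)
Lemma rect_int_local (px py : R) D : cder G (px +i* py) D ->
  forall e : R, 0 < e -> exists2 del : R, 0 < del &
    forall a b c d : R, a <= px <= b -> c <= py <= d -> (b - a) + (d - c) < del ->
      cmod (rect_int a b c d) <= e * ((b - a) + (d - c)) ^+ 2.
Proof.
set p := px +i* py => hG e e0; have e20 : 0 < e / 2 by lra.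
have [del del0 hdel] := hG _ e20; exists del => // a b c d hx hy.
set s := _ + (d - c) => sdel.
pose L z := G p + D * (z - p).
pose Q z := G p * z + D / 2 * (z - p) ^+ 2.
have two0 : (2 : C) != 0 by rewrite pnatr_eq0.
have hQ z : cder Q z (L z).
  have h1 := gderMl (G p) (@gder_i _ _ (@id C) z).
  have h2 := gderMl (D / 2) (gder_exp 2 (gderB (@gder_i _ _ (@id C) z) (gder_const p z))).
  by apply: gder_eqd (gderD h1 h2); rewrite /L /= expr1; field.
have hGL x y : a <= x <= b -> c <= y <= d -> cmod (G (x +i* y) - L (x +i* y)) <= e / 2 * s.
  move=> hx' hy'; have hd := cmod_rect_dist hx' hy' hx hy.
  rewrite /L opprD addrA; apply: le_trans (hdel _ (le_lt_trans hd sdel)) _.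
  by rewrite ler_pM2l.
have ab : a <= b by lra.
have cd : c <= d by lra.
have horiz y : c <= y <= d ->
    cmod ((X y b - Q (b +i* y)) - (X y a - Q (a +i* y))) <= e / 2 * s * (b - a).
  move=> hy'; apply: (@pder_cmod_le_const _ (fun x => X y x - Q (x +i* y))
    (fun x => G (x +i* y) - L (x +i* y) * 1)) => // x hx'; last by rewrite mulr1 hGL.
  exact: gderB (hX y x) (gder_comp (pder_horizontal y x) (hQ _)).
have verti x : a <= x <= b ->
    cmod (('i * Y x d - Q (x +i* d)) - ('i * Y x c - Q (x +i* c))) <= e / 2 * s * (d - c).
  move=> hx'; apply: (@pder_cmod_le_const _ (fun y => 'i * Y x y - Q (x +i* y))
    (fun y => 'i * G (x +i* y) - L (x +i* y) * 'i)) => // y hy'.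
    exact: gderB (gderMl 'i (hY x y)) (gder_comp (pder_vertical x y) (hQ _)).
  by rewrite mulrC -mulrBl cmodM cmodi mulr1 hGL.
have -> : rect_int a b c d =
    ((X c b - Q (b +i* c)) - (X c a - Q (a +i* c)))
  - ((X d b - Q (b +i* d)) - (X d a - Q (a +i* d)))
  + ((('i * Y b d - Q (b +i* d)) - ('i * Y b c - Q (b +i* c)))
  - (('i * Y a d - Q (a +i* d)) - ('i * Y a c - Q (a +i* c)))).
  by rewrite /rect_int; ring.
apply: le_trans (cmodD _ _) _.
have h1 := cmodB_le ((X c b - Q (b +i* c)) - (X c a - Q (a +i* c)))
  ((X d b - Q (b +i* d)) - (X d a - Q (a +i* d))).
have h2 := cmodB_le (('i * Y b d - Q (b +i* d)) - ('i * Y b c - Q (b +i* c)))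
  (('i * Y a d - Q (a +i* d)) - ('i * Y a c - Q (a +i* c))).
have c1 := horiz c; have c2 := horiz d; have c3 := verti b; have c4 := verti a.
have -> : e * s ^+ 2 = (e / 2 * s * (b - a) + e / 2 * s * (b - a)) +
   (e / 2 * s * (d - c) + e / 2 * s * (d - c)) by rewrite /s; field.
apply: lerD; [apply: le_trans h1 _; apply: lerD|apply: le_trans h2 _; apply: lerD];
 [apply: c1|apply: c2|apply: c3|apply: c4]; lra.
Qed.

Let side (q : (R * R) * (R * R)) := (q.1.2 - q.1.1) + (q.2.2 - q.2.1).
Let Iq (q : (R * R) * (R * R)) := rect_int q.1.1 q.1.2 q.2.1 q.2.2.

(** The integral is the sum over the four quarters, while the bound, quadratic in [side], is divided
    by exactly four: the excess survives in some quarter. *)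
Lemma rect_int_bisect (e : R) q : q.1.1 <= q.1.2 -> q.2.1 <= q.2.2 ->
  e * side q ^+ 2 < cmod (Iq q) ->
  exists q', [/\ q'.1.1 <= q'.1.2, q'.2.1 <= q'.2.2, e * side q' ^+ 2 < cmod (Iq q'),
    side q' = side q / 2 & [/\ q.1.1 <= q'.1.1, q'.1.2 <= q.1.2, q.2.1 <= q'.2.1 & q'.2.2 <= q.2.2]].
Proof.
case: q => [[a b] [c d]]; rewrite /side /Iq /= => ab cd h.
apply: contrapT => hn.
pose m := (a + b) / 2; pose n := (c + d) / 2.
have hm : [/\ a <= m, m <= b, m - a = (b - a) / 2 & b - m = (b - a) / 2] by rewrite /m; split; lra.
have hn' : [/\ c <= n, n <= d, n - c = (d - c) / 2 & d - n = (d - c) / 2] by rewrite /n; split; lra.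
case: hm hn' => m1 m2 m3 m4 [n1 n2 n3 n4].
have small a' b' c' d' : a <= a' -> b' <= b -> c <= c' -> d' <= d ->
    b' - a' = (b - a) / 2 -> d' - c' = (d - c) / 2 ->
    cmod (rect_int a' b' c' d') <= e * ((b - a + (d - c)) / 2) ^+ 2.
  move=> h1 h2 h3 h4 h5 h6; rewrite leNgt; apply/negP => hb; apply: hn.
  by exists ((a', b'), (c', d')); split => //=; [lra|lra|rewrite h5 h6 -mulrDl|lra].
move: h; apply/negP; rewrite -leNgt.
have -> : rect_int a b c d = (rect_int a m c n + rect_int m b c n) + (rect_int a m n d + rect_int m b n d).
  by rewrite /rect_int; ring.
have s1 := small a m c n (lexx _) m2 (lexx _) n2 m3 n3.
have s2 := small m b c n m1 (lexx _) (lexx _) n2 m4 n3.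
have s3 := small a m n d (lexx _) m2 n1 (lexx _) m3 n4.
have s4 := small m b n d m1 (lexx _) n1 (lexx _) m4 n4.
have := cmodD (rect_int a m c n + rect_int m b c n) (rect_int a m n d + rect_int m b n d).
have := cmodD (rect_int a m c n) (rect_int m b c n).
have := cmodD (rect_int a m n d) (rect_int m b n d).
have -> : e * (b - a + (d - c)) ^+ 2 = 4 * (e * ((b - a + (d - c)) / 2) ^+ 2) by field.
lra.
Qed.

(** An excess over [e * s0 ^+ 2] would persist in a nested sequence of rectangles; [rect_int_local]
    refutes it at their common point once they are small. *)
Lemma goursat (a b c d : R) : a <= b -> c <= d ->
  (forall x y, a <= x <= b -> c <= y <= d -> exists D, cder G (x +i* y) D) ->
  rect_int a b c d = 0.
Proof.
move=> ab cd hG; apply/eqP; rewrite -cmod_eq0 eq_le cmod_ge0 andbT; apply/ler_addgt0Pl => e0 e00.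
rewrite addr0; set s0 := (b - a) + (d - c).
have s00 : 0 <= s0 by rewrite /s0; lra.
pose e := e0 / (1 + s0 ^+ 2).
have e_gt0 : 0 < e by rewrite divr_gt0 // ltr_pwDl ?sqr_ge0.
apply: le_trans (_ : e * s0 ^+ 2 <= e0); last first.
  rewrite /e mulrAC ler_pdivrMr ?ltr_pwDl ?sqr_ge0 // ler_pM2l // lerDr ler01 //.
rewrite leNgt; apply/negP => hbad.
have step q : exists q', q.1.1 <= q.1.2 -> q.2.1 <= q.2.2 -> e * side q ^+ 2 < cmod (Iq q) ->
   [/\ q'.1.1 <= q'.1.2, q'.2.1 <= q'.2.2, e * side q' ^+ 2 < cmod (Iq q'),
    side q' = side q / 2 & [/\ q.1.1 <= q'.1.1, q'.1.2 <= q.1.2, q.2.1 <= q'.2.1 & q'.2.2 <= q.2.2]].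
  have [h|h] := pselect [/\ q.1.1 <= q.1.2, q.2.1 <= q.2.2 & e * side q ^+ 2 < cmod (Iq q)].
    by case: h => h1 h2 h3; have [q' hq'] := rect_int_bisect h1 h2 h3; exists q'.
  by exists q => h1 h2 h3; case: h.
have {step} [nxt hnxt] := choice step.
pose q n := iter n nxt ((a, b), (c, d)).
have inv n : [/\ (q n).1.1 <= (q n).1.2, (q n).2.1 <= (q n).2.2, e * side (q n) ^+ 2 < cmod (Iq (q n))
   & side (q n) = s0 / 2 ^+ n].
  elim: n => [|n [h1 h2 h3 h4]]; first by split => //=; rewrite /side /= expr0 divr1.
  have [k1 k2 k3 k4 _] := hnxt _ h1 h2 h3; split => //.
  by rewrite [LHS]k4 h4 exprSr invfM mulrA.
have nest n : [/\ (q n).1.1 <= (q n.+1).1.1, (q n.+1).1.2 <= (q n).1.2,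
    (q n).2.1 <= (q n.+1).2.1 & (q n.+1).2.2 <= (q n).2.2].
  by have [h1 h2 h3 _] := inv n; have [_ _ _ _] := hnxt _ h1 h2 h3.
have mono n k : [/\ (q n).1.1 <= (q (n + k)%N).1.1, (q (n + k)%N).1.2 <= (q n).1.2,
    (q n).2.1 <= (q (n + k)%N).2.1 & (q (n + k)%N).2.2 <= (q n).2.2].
  elim: k => [|k [h1 h2 h3 h4]]; first by rewrite addn0.
  have [k1 k2 k3 k4] := nest (n + k)%N; rewrite addnS; split; lra.
have sq (l u : nat -> R) : (forall n, l n <= u n) -> (forall n k, l n <= l (n + k)%N) ->
    (forall n k, u (n + k)%N <= u n) -> exists x, forall n, l n <= x <= u n.
  move=> lu hl hu.
  have lm n m : l n <= u m.
    apply: le_trans (hl n m) _; apply: le_trans (lu _) _.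
    by rewrite addnC.
  exists (sup (range l)) => n; apply/andP; split.
    apply: ub_le_sup; last by exists n.
    by exists (u 0%N) => _ [k _ <-].
  apply: ge_sup; first by exists (l 0%N), 0%N.
  by move=> _ [k _ <-].
have [px hpx] : exists x, forall n, (q n).1.1 <= x <= (q n).1.2.
  apply: sq => n; first by case: (inv n).
    by move=> k; case: (mono n k).
  by move=> k; case: (mono n k).
have [py hpy] : exists x, forall n, (q n).2.1 <= x <= (q n).2.2.
  apply: sq => n; first by case: (inv n).
    by move=> k; case: (mono n k).
  by move=> k; case: (mono n k).
have [D hD] := hG px py (hpx 0%N) (hpy 0%N).
have [del del0 hdel] := rect_int_local hD e_gt0.
pose n := Num.truncn (s0 / del).
have := inv n.+1 => -[_ _ h3 h4].
have := hdel _ _ _ _ (hpx n.+1) (hpy n.+1).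
rewrite -/(side (q n.+1)) -/(Iq (q n.+1)) leNgt h3 => /(_ _)/negP; apply=> //.
rewrite h4 ltr_pdivrMr ?exprn_gt0 // mulrC -ltr_pdivrMr //.
apply: lt_trans (truncnS_gt _) _.
by rewrite -natrX ltr_nat ltn_expl.
Qed.

End Goursat.

(** * Primitives in a half-plane and their periods *)

Section HalfPlanePrimitive.
Context {R : realType}.
Local Notation C := R[i].

Lemma pder_cmod_le_abs (p p' : R -> C) (B s t : R) :
  (forall r : R, `|r - s| <= `|t - s| -> pder p r (p' r)) ->
  (forall r : R, `|r - s| <= `|t - s| -> cmod (p' r) <= B) ->
  cmod (p t - p s) <= B * `|t - s|.
Proof.
move=> hp hB; case: (lerP s t) => [st|/ltW ts].
  have e : `|t - s| = t - s by rewrite ger0_norm ?subr_ge0.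
  have le r : s <= r <= t -> `|r - s| <= `|t - s|.
    by move=> /andP[h1 h2]; rewrite e ger0_norm; lra.
  by apply: (pder_cmod_le_const st) => r /le; [apply: hp|apply: hB].
have e : `|t - s| = s - t by rewrite distrC ger0_norm ?subr_ge0.
have le r : t <= r <= s -> `|r - s| <= `|t - s|.
  by move=> /andP[h1 h2]; rewrite e distrC ger0_norm; lra.
by rewrite cmodBC; apply: (pder_cmod_le_const ts) => r /le; [apply: hp|apply: hB].
Qed.

Lemma ccont_Re_line (G : C -> C) (gam : R -> C) (x : R) :
  ccont G (gam x) -> (forall e : R, 0 < e -> exists2 del : R, 0 < del &
    forall y, `|y - x| < del -> cmod (gam y - gam x) < e) ->
  {for x, continuous (fun t => complex.Re (G (gam t)))} /\
  {for x, continuous (fun t => complex.Im (G (gam t)))}.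
Proof.
move=> hG hgam; split; apply/cvgrPdist_lt => /= e e0;
  have [d1 d10 h1] := hG e e0; have [d2 d20 h2] := hgam d1 d10;
  (apply/nbhs_ballP; exists d2 => // y; rewrite /ball /= distrC => /h2/h1 h);
  rewrite distrC; apply: le_lt_trans h;
  [have := cmod_Re (G (gam y) - G (gam x))|have := cmod_Im (G (gam y) - G (gam x))];
  by case: (G _) (G _) => [? ?] [? ?].
Qed.

Section Primitive.
Variables (G : C -> C) (X Y : R -> R -> C) (b : R).
Hypothesis hX : forall y x, x < b -> pder (X y) x (G (x +i* y)).
Hypothesis hY : forall x y, x < b -> pder (Y x) y (G (x +i* y)).
Hypothesis hXY : forall a a' c c', a < b -> a' < b -> rect_int X Y a a' c c' = 0.
Hypothesis cG : forall x y, x < b -> ccont G (x +i* y).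

(** [P z] integrates along the real axis and then vertically. Since integrals around rectangles
    vanish, the horizontal increment may be taken at the height of [z] instead of 0, and
    [P z' - P z] becomes an integral over two short sides near [z]. *)
Lemma half_plane_primitive_subproof : exists P : C -> C,
  forall z, complex.Re z < b -> cder P z (G z).
Proof.
pose P z := X 0 (complex.Re z) + 'i * (Y (complex.Re z) (complex.Im z) - Y (complex.Re z) 0).
exists P => -[x y] /= xb e e0.
have e20 : 0 < e / 2 by lra.
have [del del0 hdel] := cG y xb e20.
exists (Num.min (del / 2) (b - x)) => [|[x' y']]; first by rewrite lt_min subr_gt0 xb andbT; lra.
set z := x +i* y; set z' := x' +i* y'; set k := z' - z.
rewrite lt_min => /andP[hk hkb].
have hRe : `|x' - x| <= cmod k by exact: (cmod_Re k).
have hIm : `|y' - y| <= cmod k by exact: (cmod_Im k).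
have x'b : x' < b by move: hRe; rewrite ler_norml => /andP[_]; lra.
have near_G u v : `|u - x| <= cmod k -> `|v - y| <= cmod k -> cmod (G (u +i* v) - G z) <= e / 2.
  move=> hu hv; apply/ltW/hdel; apply: le_lt_trans (cmod_ReIm _) _.
  by change (`|u - x| + `|v - y| < del); lra.
have ltb u : `|u - x| <= cmod k -> u < b by rewrite ler_norml => /andP[_]; lra.
have h1 : cmod ((X y x' - G z * x'%:C) - (X y x - G z * x%:C)) <= e / 2 * `|x' - x|.
  apply: (@pder_cmod_le_abs (fun u => X y u - G z * u%:C) (fun u => G (u +i* y) - G z * 1)).
    move=> u hu; apply: gderB; first by apply: hX; apply: ltb; exact: le_trans hRe.
    by apply: gderMl; exact: gder_i.
  move=> u hu; rewrite mulr1 near_G //; first exact: le_trans hRe.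
  by rewrite subrr normr0 cmod_ge0.
have h2 : cmod ((Y x' y' - G z * y'%:C) - (Y x' y - G z * y%:C)) <= e / 2 * `|y' - y|.
  apply: (@pder_cmod_le_abs (fun v => Y x' v - G z * v%:C) (fun v => G (x' +i* v) - G z * 1)).
    by move=> v hv; apply: gderB; [exact: hY|apply: gderMl; exact: gder_i].
  by move=> v hv; rewrite mulr1 near_G //; exact: le_trans hIm.
have := hXY 0 y xb x'b; rewrite /rect_int => hg.
have -> : P z' - P z - G z * k =
   ((X y x' - G z * x'%:C) - (X y x - G z * x%:C)) +
   'i * ((Y x' y' - G z * y'%:C) - (Y x' y - G z * y%:C)).
  have -> : P z' = X 0 x' + 'i * (Y x' y' - Y x' 0) by [].
  have -> : P z = X 0 x + 'i * (Y x y - Y x 0) by [].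
  have -> : k = x'%:C + 'i * y'%:C - (x%:C + 'i * y%:C) by rewrite -[LHS]/((x' +i* y') - (x +i* y)) (complexEi (x' +i* y')) (complexEi (x +i* y)).
  have ii : 'i * 'i = -1 :> C by rewrite -expr2 sqr_i.
  by rewrite -[LHS]subr0 -hg; ring: ii.
apply: le_trans (cmodD _ _) _; rewrite cmodM cmodi mul1r; nra.
Qed.
End Primitive.

Lemma rect_int_eq0 (G : C -> C) (X Y : R -> R -> C) (b : R) :
  (forall y x, pder (X y) x (G (x +i* y))) -> (forall x y, pder (Y x) y (G (x +i* y))) ->
  (forall x y, x < b -> exists D, cder G (x +i* y) D) ->
  forall a a' c c', a < b -> a' < b -> rect_int X Y a a' c c' = 0.
Proof.
move=> hX hY hG.
have h1 a a' c c' : a < b -> a' < b -> a <= a' -> c <= c' -> rect_int X Y a a' c c' = 0.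
  move=> ab a'b aa cc; apply: (goursat hX hY aa cc) => x y /andP[_ xa] _.
  by apply: hG; exact: le_lt_trans a'b.
have h2 a a' c c' : a < b -> a' < b -> a <= a' -> rect_int X Y a a' c c' = 0.
  move=> ab a'b aa; have [cc|/ltW cc] := lerP c c'; first exact: h1.
  by rewrite -[LHS]opprK -oppr0 -(h1 a a' c' c) // /rect_int; congr (- _); ring.
move=> a a' c c' ab a'b; have [aa|/ltW aa] := lerP a a'; first exact: h2.
by rewrite -[LHS]opprK -oppr0 -(h2 a' a c c') // /rect_int; congr (- _); ring.
Qed.

Lemma half_plane_primitive (G : C -> C) (b b' : R) : b' < b ->
  (forall z, complex.Re z < b -> exists D, cder G z D) ->
  exists P : C -> C, forall z, complex.Re z < b' -> cder P z (G z).
Proof.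
move=> b'b hG.
(* [G] is frozen to the right of the line [Re z = b']: the result is continuous along whole lines,
   as [curve_primitive] requires, and agrees with [G] to the left. *)
pose G' z := G (Num.min (complex.Re z) b' +i* complex.Im z).
have mb u : Num.min u b' < b by rewrite gt_min b'b orbT.
have cG z : complex.Re z < b -> ccont G z by move=> /hG[D]; exact: cder_cont.
have hmin u v : `|Num.min u b' - Num.min v b'| <= `|u - v|.
  have h1 := ler_norm (u - v); have h2 := ler_norm (v - u); rewrite (distrC v u) in h2.
  rewrite ler_norml; case: (ltP u b') => ?; case: (ltP v b') => ?; lra.
have hXc y : exists F : R -> C, forall x, pder F x (G' (x +i* y)).
  suff h x : {for x, continuous (fun t => complex.Re (G' (t +i* y)))} /\
     {for x, continuous (fun t => complex.Im (G' (t +i* y)))}.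
    by apply: curve_primitive => x; case: (h x).
  apply: (@ccont_Re_line G (fun t => Num.min t b' +i* y)); first by apply: cG; exact: mb.
  move=> e e0; exists e => // u hu; apply: le_lt_trans (cmod_ReIm _) _ => /=.
  by rewrite subrr normr0 addr0; exact: le_lt_trans hu.
have hYc x : exists F : R -> C, forall y, pder F y (G' (x +i* y)).
  suff h y : {for y, continuous (fun t => complex.Re (G' (x +i* t)))} /\
     {for y, continuous (fun t => complex.Im (G' (x +i* t)))}.
    by apply: curve_primitive => y; case: (h y).
  apply: (@ccont_Re_line G (fun t => Num.min x b' +i* t)); first by apply: cG; exact: mb.
  move=> e e0; exists e => // u hu; apply: le_lt_trans (cmod_ReIm _) _ => /=.
  by rewrite subrr normr0 add0r.
have [X hX] := choice hXc; have [Y hY] := choice hYc.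
have G'E z : complex.Re z < b' -> G' z = G z.
  by move=> zb; rewrite /G' min_l ?ltW //; case: (z).
have G'cder x y : x < b' -> exists D, cder G' (x +i* y) D.
  move=> xb; have [|D hD] := hG (x +i* y); first exact: lt_trans b'b.
  exists D; apply: (@gder_local _ _ _ G _ _ _ (b' - x)) hD; first by rewrite subr_gt0.
  move=> w /(le_lt_trans (cmod_Re _)) hw; rewrite G'E //.
  by have := le_lt_trans (ler_norm _) hw; case: (w) => u v /=; lra.
have [P hP] := @half_plane_primitive_subproof G' X Y b' (fun y x _ => hX y x) (fun x y _ => hY x y)
   (rect_int_eq0 hX hY G'cder) (fun x y xb => let: ex_intro D hD := G'cder x y xb in cder_cont hD).
by exists P => z zb; rewrite -G'E //; exact: hP.
Qed.

Local Notation per := ('i * (pi *+ 2)%:C : C).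

Lemma cder_eq0_const (F : C -> C) z w :
  (forall t : R, 0 <= t <= 1 -> cder F (z + t%:C * (w - z)) 0) -> F w = F z.
Proof.
move=> h; have := @cder_lipschitz _ F (fun=> 0) z w 0 h; rewrite mul0r => k.
apply/eqP; rewrite -subr_eq0 -cmod_eq0 eq_le cmod_ge0 andbT; apply: k => t _.
by rewrite cmod0.
Qed.

Lemma periodic_primitive (G : C -> C) (b b' : R) : b' < b ->
  (forall z, complex.Re z < b -> exists D, cder G z D) ->
  (forall z, G (z + per) = G z) ->
  exists P : C -> C, exists K : C,
    (forall z, complex.Re z < b' -> cder P z (G z)) /\
    (forall z, complex.Re z < b' -> P (z + per) - P z = K).
Proof.
move=> b'b hG per_G; have [P hP] := half_plane_primitive b'b hG.
exists P, (P ((b' - 1)%:C + per) - P (b' - 1)%:C); split => // z zb.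
have Reper w : complex.Re (w + per) = complex.Re w.
  by case: w => u v /=; rewrite !mul0r mul1r subr0 addr0.
apply: (@cder_eq0_const (fun w => P (w + per) - P w) (b' - 1)%:C z) => t /andP[t0 t1].
set w := _ + _ * _.
have wb : complex.Re w < b'.
  rewrite /w; case: (z) zb => u v /= ub.
  have h : 0 <= t * (b' - u) by rewrite mulr_ge0 // subr_ge0 ltW.
  by move: t1; rewrite le_eqVlt => /orP[/eqP->|t1]; lra.
rewrite -(subrr (G w)); apply: gderB; last exact: hP.
apply: (gder_eqd _ (gder_comp (gderD (gder_i w) (gder_const per w)) (hP _ _))).
  by rewrite per_G addr0 mulr1.
by rewrite Reper.
Qed.

(* The period of a primitive is read off the behaviour of [G] at [-oo], up to
   a term [q] with a periodic primitive. *)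
Lemma periodic_increment (P G Q q : C -> C) (b : R) (K c : C) :
  (forall z, complex.Re z < b -> cder P z (G z)) ->
  (forall z, complex.Re z < b -> P (z + per) - P z = K) ->
  (forall z, complex.Re z < b -> cder Q z (q z)) ->
  (forall z, Q (z + per) = Q z) ->
  (forall e : R, 0 < e -> exists B : R, forall z, complex.Re z < B -> cmod (G z - q z - c) <= e) ->
  K = c * per.
Proof.
move=> hP hK hQ perQ hlim.
apply/eqP; rewrite -subr_eq0 -cmod_eq0 eq_le cmod_ge0 andbT; apply/ler_addgt0Pl => e e0.
rewrite addr0; have p0 : 0 < pi *+ 2 :> R by rewrite mulrn_wgt0 // pi_gt0.
have e1 : 0 < e / (pi *+ 2) by rewrite divr_gt0.
have [B hB] := hlim _ e1.
pose x := Num.min b B - 1.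
have xb : x < b by rewrite /x ltrBlDr ltr_pwDr // ge_min lexx.
have xB : x < B by rewrite /x ltrBlDr ltr_pwDr // ge_min lexx orbT.
have Rex t : complex.Re (x%:C + t%:C * 'i) = x by rewrite /= mulr0 mul0r subr0 addr0.
have hd t : pder (fun s => (P (x%:C + s%:C * 'i) - Q (x%:C + s%:C * 'i)) - c * (x%:C + s%:C * 'i)) t
   ((G (x%:C + t%:C * 'i) - q (x%:C + t%:C * 'i) - c) * 'i).
  apply: (@pder_line _ (fun w => P w - Q w - c * w)); apply: gderB; last first.
    by apply: gder_eqd (gderMl c (gder_i _)); rewrite mulr1.
  by apply: gderB; [apply: hP|apply: hQ]; rewrite Rex.
have := @pder_cmod_le_const _ _ _ (e / (pi *+ 2)) 0 (pi *+ 2) (ltW p0) (fun t _ => hd t).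
rewrite subr0 divfK ?gt_eqF // => h.
have -> : K - c * per = P (x%:C + (pi *+ 2)%:C * 'i) - Q (x%:C + (pi *+ 2)%:C * 'i) -
  c * (x%:C + (pi *+ 2)%:C * 'i) - (P (x%:C + 0%:C * 'i) - Q (x%:C + 0%:C * 'i) - c * (x%:C + 0%:C * 'i)).
  have h0 := hK x%:C xb; have h1 := perQ x%:C.
  rewrite rmorph0 mul0r addr0 [_%:C * 'i]mulrC h1 -h0; ring.
by apply: h => t _; rewrite cmodM cmodi mulr1; apply: hB; rewrite Rex.
Qed.

End HalfPlanePrimitive.

Section CircleMeans.
Context {R : realType}.
Local Notation C := R[i].
Local Notation tau := (pi *+ 2 : R).

Definition cis (t : R) : C := cexp ('i * t%:C).

Lemma cmod_cis t : cmod (cis t) = 1.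
Proof. by rewrite cmod_cexp /= mul0r mul1r subrr expR0. Qed.

Lemma cis0 : cis 0 = 1.
Proof. by rewrite /cis mulr0 cexp0. Qed.

Lemma cexp_ln_cis (r t : R) : 0 < r -> cexp ((ln r)%:C + 'i * t%:C) = r%:C * cis t.
Proof.
move=> r0; rewrite cexpD; congr (_ * _).
by rewrite cexpE cos0 sin0 mulr1 mulr0 lnK ?posrE.
Qed.

Lemma cmod_cexp_lt z (r : R) : 0 < r -> complex.Re z < ln r -> cmod (cexp z) < r.
Proof. by move=> r0; rewrite cmod_cexp -ltr_expR lnK ?posrE. Qed.

Section Means.
Variables (h : C -> C) (z : C) (r rho : R).
Hypotheses (r0 : 0 < r) (rrho : r < rho).
Hypothesis hh : forall w, cmod (w - z) < rho -> exists D, cder h w D.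

(* [x = ln r + i t] turns the circles about [z] into vertical segments of length
   [2 pi] on which the integrand is periodic, and the integral is the period of
   a primitive: it does not depend on [r] and is computed at [r -> 0]. *)
Lemma circle_mean_gen (W Q q : C -> C) (c : C) :
  (forall x, exists D, cder W x D) -> (forall x, W (x + 'i * tau%:C) = W x) ->
  (forall x, cder Q x (q x)) -> (forall x, Q (x + 'i * tau%:C) = Q x) ->
  (forall e : R, 0 < e -> exists B : R, forall x, complex.Re x < B ->
     cmod (h (z + cexp x) * W x - q x - c) <= e) ->
  exists2 p : R -> C,
    forall t, pder p t (h (z + r%:C * cis t) * W ((ln r)%:C + 'i * t%:C)) &
    p tau - p 0 = c * tau%:C.
Proof.
move=> hW perW hQ perQ hlim.
pose G x := h (z + cexp x) * W x.
have rho0 : 0 < rho by exact: lt_trans rrho.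
have lnr : ln r < ln rho by rewrite ltr_ln ?posrE.
pose b' := (ln r + ln rho) / 2.
have b1 : ln r < b' by rewrite /b'; lra.
have b2 : b' < ln rho by rewrite /b'; lra.
have hG x : complex.Re x < ln rho -> exists D, cder G x D.
  move=> xb; have [D1 hD1] := hW x.
  have hx : cmod (z + cexp x - z) < rho by rewrite addrAC subrr add0r cmod_cexp_lt.
  have [D2 hD2] := hh hx.
  have k := gder_comp (gderD (gder_const z x) (cder_cexp x)) hD2.
  by exists (D2 * (0 + cexp x) * W x + h (z + cexp x) * D1); exact: gderM k hD1.
have perG x : G (x + 'i * tau%:C) = G x by rewrite /G cexp_2pi perW.
have [P [K [hP hK]]] := periodic_primitive b2 hG perG.
have KE := periodic_increment hP hK (fun x _ => hQ x) perQ hlim.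
exists (fun t => - 'i * P ((ln r)%:C + t%:C * 'i)) => [t|].
  have hx : complex.Re ((ln r)%:C + t%:C * 'i) < b'.
    by have -> : complex.Re ((ln r)%:C + t%:C * 'i) = ln r by rewrite /= mulr0 mul0r subr0 addr0.
  apply: gder_eqd (gderMl (- 'i) (pder_line (hP _ hx))).
  rewrite /G [t%:C * _]mulrC cexp_ln_cis // [_ * 'i]mulrC mulrA mulNr -expr2 sqr_i.
  by rewrite opprK mul1r.
have := hK (ln r)%:C b1; rewrite KE => k.
rewrite -mulrBr rmorph0 mul0r addr0 [_%:C * 'i]mulrC k.
by have ii : 'i * 'i = -1 :> C; [rewrite -expr2 sqr_i|ring: ii].
Qed.

Lemma tendsto_center (e : R) : 0 < e ->
  exists B : R, forall x, complex.Re x < B -> cmod (h (z + cexp x) - h z) <= e.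
Proof.
have [|D hD] := hh (w := z); first by rewrite subrr cmod0 (lt_trans r0).
move=> /(cder_cont hD)[del del0 hdel].
exists (ln del) => x xb; apply/ltW/hdel.
by rewrite addrAC subrr add0r cmod_cexp_lt.
Qed.

Lemma circle_mean0 : exists2 p : R -> C,
    forall t, pder p t (h (z + r%:C * cis t)) & p tau - p 0 = h z * tau%:C.
Proof.
have [|x|x|x|e e0|p hp pE] := @circle_mean_gen (fun=> 1) (fun=> 0) (fun=> 0) (h z).
- by move=> x; exists 0; exact: gder_const.
- by [].
- exact: gder_const.
- by [].
- by have [B hB] := tendsto_center e0; exists B => x /hB; rewrite mulr1 subr0.
by exists p => // t; have := hp t; rewrite mulr1.
Qed.

(** Cauchy's formula for the derivative. The weighted integrand contains the term
    [h z * cexp (- x)], unbounded at [-oo]; it has a periodic primitive and is the [q] of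
    [circle_mean_gen]. *)
Lemma circle_mean1 d : cder h z d -> exists2 p : R -> C,
    forall t, pder p t (h (z + r%:C * cis t) * cis (- t)) & p tau - p 0 = r%:C * d * tau%:C.
Proof.
move=> hd.
have hneg (x : C) : cder (fun y => cexp (- y)) x (- cexp (- x)).
  by apply: gder_eqd (gder_comp (gderN (gder_i x)) (cder_cexp _)); rewrite mulrN1.
have pern x : cexp (- (x + 'i * tau%:C)) = cexp (- x) by rewrite !cexpN cexp_2pi.
have [|x|x|x|e e0|p hp pE] := @circle_mean_gen (fun x => cexp (- x)) (fun x => - h z * cexp (- x))
   (fun x => h z * cexp (- x)) d.
- by move=> x; exists (- cexp (- x)).
- exact: pern.
- have k := gderMl (- h z) (hneg x). apply: (gder_eqd _ k); ring.
- by rewrite pern.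
- have [del del0 hdel] := hd e e0; exists (ln del) => x xb.
  have := hdel (z + cexp x); rewrite addrAC subrr add0r cmod_cexp_lt // => /(_ isT) k.
  have -> : h (z + cexp x) * cexp (- x) - h z * cexp (- x) - d =
     (h (z + cexp x) - h z - d * cexp x) * cexp (- x).
    by rewrite cexpN; field; exact: cexp_neq0.
  by rewrite cmodM cexpN cmodV ler_pdivrMr // cmod_gt0 cexp_neq0.
exists (fun t => r%:C * p t) => [t|]; last by rewrite -mulrBr pE mulrA.
apply: gder_eqd (gderMl r%:C (hp t)); rewrite opprD cexpD cexpN -[(ln r)%:C]addr0 -(mulr0 'i).
rewrite -(rmorph0 (real_complex R)) cexp_ln_cis // cis0 mulr1 /cis rmorphN mulrN.
by field; rewrite fmorph_eq0 gt_eqF.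
Qed.

(** In the variable [x] the weight [cexp x] tends to 0 towards the centre, so this Fourier
    coefficient vanishes. That allows the first coefficient of [Re h] to be expressed through that
    of [h]. *)
Lemma circle_meanN1 : exists2 p : R -> C,
    forall t, pder p t (h (z + r%:C * cis t) * cis t) & p tau - p 0 = 0.
Proof.
have [|x|x|x|e e0|p hp pE] := @circle_mean_gen (fun x => cexp x) (fun=> 0) (fun=> 0) 0.
- by move=> x; exists (cexp x); exact: cder_cexp.
- exact: cexp_2pi.
- exact: gder_const.
- by [].
- have [B hB] := tendsto_center ltr01; pose k := cmod (h z) + 1.
  have k0 : 0 < k by rewrite ltr_wpDl ?cmod_ge0.
  exists (Num.min B (ln (e / k))) => x; rewrite lt_min => /andP[xB xk].
  rewrite !subr0 cmodM; apply: le_trans (_ : k * (e / k) <= _); last by rewrite mulrCA divff ?mulr1 ?gt_eqF.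
  rewrite ler_pM ?cmod_ge0 //; last by apply/ltW/cmod_cexp_lt => //; rewrite divr_gt0.
  have := cmodB_ge (h (z + cexp x)) (h z); have := hB x xB; rewrite /k; lra.
exists (fun t => r%:C^-1 * p t) => [t|]; last by rewrite -mulrBr pE mul0r mulr0.
apply: gder_eqd (gderMl r%:C^-1 (hp t)); rewrite cexp_ln_cis //.
by field; rewrite fmorph_eq0 gt_eqF.
Qed.
End Means.
End CircleMeans.

(** * Maximum principle and Cauchy estimates *)

Section MaximumPrinciple.
Context {R : realType}.
Local Notation C := R[i].
Local Notation tau := (pi *+ 2 : R).

Definition cclosed (K : set C) := forall z : C,
  (forall e : R, 0 < e -> exists2 w, K w & cmod (w - z) < e) -> K z.

Lemma compact_square (B : R) :
  compact [set z : C | `|complex.Re z| <= B /\ `|complex.Im z| <= B].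
Proof.
pose j (x : R * R) : C := x.1 +i* x.2.
have -> : [set z : C | `|complex.Re z| <= B /\ `|complex.Im z| <= B] =
    j @` (`[- B, B] `*` `[- B, B]).
  apply/seteqP; split => [[a b] /= [ha hb]|_ [[a b] /= [ha hb] <-]].
    by exists (a, b) => //=; rewrite !in_itv /= -!ler_norml.
  by move: ha hb; rewrite !in_itv /= -!ler_norml.
apply: continuous_compact; last by apply: compact_setX; exact: segment_compact.
apply: continuous_subspaceT => -[a b] V /nbhs_cmodP[e e0 he].
have e20 : 0 < e / 2 by lra.
exists ([set x | `|a - x| < e / 2], [set x | `|b - x| < e / 2]) => /=.
  by split; apply/nbhs_ballP; exists (e / 2).
move=> [x y] /= [hx hy]; apply: he; apply: le_lt_trans (cmod_ReIm _) _ => /=.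
by rewrite (distrC x) (distrC y); lra.
Qed.

Lemma cclosed_compact (K : set C) (B : R) : cclosed K ->
  (forall z, K z -> cmod z <= B) -> compact K.
Proof.
move=> hK hB; apply: (subclosed_compact _ (@compact_square B)).
  move=> z hz; apply: hK => e e0.
  have [w [Kw hw]] := hz [set w | cmod (w - z) < e] (proj2 (nbhs_cmodP _ _) (ex_intro2 _ _ e e0 (fun w h => h))).
  by exists w.
by move=> z /hB h /=; split; [apply: le_trans (cmod_Re z) h|apply: le_trans (cmod_Im z) h].
Qed.

Lemma max_attained (K : set C) (phi : C -> R) (B : R) : K !=set0 -> cclosed K ->
  (forall z, K z -> cmod z <= B) ->
  (forall z, K z -> forall e : R, 0 < e -> exists2 del : R, 0 < del &
     forall w, K w -> cmod (w - z) < del -> `|phi w - phi z| < e) ->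
  exists2 z, K z & forall w, K w -> phi w <= phi z.
Proof.
move=> K0 cK hB hphi.
have wphi : {within K, continuous phi}.
  apply/subspace_continuousP => z Kz; apply/cvgrPdist_lt => e e0.
  have [del del0 hdel] := hphi z Kz e e0.
  apply/nbhs_cmodP; exists del => // w hw Kw.
  by rewrite distrC; exact: hdel.
have [z zK hz] := compact_EVT_max K0 (cclosed_compact cK hB) wphi.
by exists z; [rewrite inE in zK|move=> w Kw; apply: hz; rewrite inE].
Qed.

Lemma tau_gt0 : 0 < tau.
Proof. by rewrite mulrn_wgt0 // pi_gt0. Qed.

Lemma nondecreasing_period_deriv (g g' : R -> R) (a b : R) : a < b ->
  (forall t : R, is_derive t 1 g (g' t)) -> (forall t, a <= t <= b -> 0 <= g' t) -> g a = g b ->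
  forall t, a <= t <= b -> g' t = 0.
Proof.
move=> ab hg hg' gab t tab; apply/eqP; rewrite eq_le hg' // andbT leNgt; apply/negP => c0.
have mono x y : a <= x -> x <= y -> y <= b -> g x <= g y.
  move=> ax xy yb; apply: (pder_ge0_le xy (fun s _ => hg s)) => s /andP[xs sy].
  by apply: hg'; rewrite (le_trans ax xs) (le_trans sy yb).
have const x : a <= x <= b -> g x = g a.
  move=> /andP[ax xb]; apply: le_anti; rewrite {1}gab.
  by rewrite (mono x b) // (mono a x).
have c20 : 0 < g' t / 2 by lra.
have [del del0 hdel] := pder_real (hg t) c20.
(* A point of the interval near [t] but different from it: to the right of [t], or to its left when
   [t = b]. *)
have [s [sab st sd]] : exists s, [/\ a <= s <= b, s != t & `|s - t| < del].
  case/andP: tab => ta tb; have [tb'|bt] := ltP t b.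
    exists (Num.min b (t + del / 2)); rewrite le_min ge_min lexx /= (ltW ab) /= neq_lt lt_min tb' /=.
    have h : t < Num.min b (t + del / 2) by rewrite lt_min tb' /=; lra.
    split; first by lra.
      by rewrite orbC; apply/orP; left; lra.
    rewrite ger0_norm ?subr_ge0 ?ltW // ltrBlDl gt_min; apply/orP; right; lra.
  have {bt}tb' : t = b by lra.
  exists (Num.max a (t - del / 2)).
  have h : Num.max a (t - del / 2) < t by rewrite gt_max; apply/andP; split; lra.
  split; first by rewrite le_max lexx ge_max; lra.
    by rewrite lt_eqF.
  rewrite distrC ger0_norm ?subr_ge0 ?ltW // ltrBlDr -ltrBlDl lt_max; apply/orP; right; lra.
have := hdel s; rewrite -!rmorphB -rmorphM -rmorphB !cmod_real => /(_ sd).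
rewrite (const s) // (const t) // subrr sub0r normrN normrM (ger0_norm (ltW c0)).
by apply/negP; rewrite -ltNge ltr_pM2r ?normr_gt0 ?subr_eq0 //; lra.
Qed.

(** The equality case of the Cauchy-Schwarz inequality: under the hypotheses, expanding
    [cmod (u - v) ^+ 2] gives at most 0. *)
Lemma Re_conj_eq (u v : C) : cmod v <= cmod u ->
  complex.Re ((complex.Re u +i* - complex.Im u) * v) = cmod u ^+ 2 -> v = u.
Proof.
rewrite -(@ler_pXn2r _ 2) ?nnegrE ?cmod_ge0 // !cmod_sqr.
case: u v => [a b] [c d] /= h1 h2.
have h : (a - c) ^+ 2 + (b - d) ^+ 2 <= 0 by nra.
have ha := sqr_ge0 (a - c); have hb := sqr_ge0 (b - d).
have /eqP : (a - c) ^+ 2 = 0 by lra.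
have /eqP : (b - d) ^+ 2 = 0 by lra.
by rewrite !sqrf_eq0 !subr_eq0 => /eqP -> /eqP ->.
Qed.

(** The deficit [g'] of the real part of [conj (h p) * h] from [cmod (h p) ^+ 2] is nonnegative on
    the circle and has mean zero, so it vanishes; equality in Cauchy-Schwarz then identifies the
    values. *)
Lemma circle_eq (h : C -> C) p (r rho : R) : 0 < r -> r < rho ->
  (forall w, cmod (w - p) < rho -> exists D, cder h w D) ->
  (forall t, cmod (h (p + r%:C * cis t)) <= cmod (h p)) ->
  forall t, 0 <= t <= tau -> h (p + r%:C * cis t) = h p.
Proof.
move=> r0 rrho hh hle; have [q hq qE] := circle_mean0 r0 rrho hh.
pose u := complex.Re (h p) +i* - complex.Im (h p).
pose g t := cmod (h p) ^+ 2 * t - complex.Re (u * q t).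
pose g' t := cmod (h p) ^+ 2 - complex.Re (u * h (p + r%:C * cis t)).
have hg (t : R) : is_derive t 1 g (g' t).
  apply: is_deriveB; last first.
    by apply: is_derive_Re; exact: gderMl (hq t).
  by apply: is_derive_eq; rewrite /GRing.scale /= mulr1.
have cu : cmod u = cmod (h p) by rewrite /u; case: (h p) => a b; rewrite /cmod /= sqrrN.
have hg' t : 0 <= g' t.
  rewrite subr_ge0; apply: le_trans (ler_norm _) _; apply: le_trans (cmod_Re _) _.
  by rewrite cmodM cu expr2 ler_wpM2l ?cmod_ge0.
have gE : g 0 = g tau.
  apply/eqP; rewrite eq_sym -subr_eq0 /g mulr0 sub0r opprK.
  rewrite -[X in X == 0]/(_ : R) -addrA [X in _ + X](_ : _ = - complex.Re (u * (q tau - q 0))); last first.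
    by rewrite mulrBr raddfB /= opprB addrC.
  rewrite qE cmod_sqr /u; case: (h p) => a b /=; apply/eqP; ring.
move=> t ht; have := nondecreasing_period_deriv tau_gt0 hg (fun t _ => hg' t) gE ht.
by move=> /eqP; rewrite subr_eq0 => /eqP e; apply: Re_conj_eq (hle t) _; rewrite -e.
Qed.

Lemma max_principle (K : set C) (H : C -> C) (B0 B : R) : cclosed K ->
  (forall z, K z -> cmod z <= B0) -> (forall z, K z -> exists D, cder H z D) ->
  (forall z, K z -> (forall e : R, 0 < e -> exists2 w, ~ K w & cmod (w - z) < e) -> cmod (H z) <= B) ->
  forall z, K z -> cmod (H z) <= B.
Proof.
move=> cK bK dK hB.
have contH z : K z -> ccont H z by move=> /dK[D]; exact: cder_cont.
move=> z1 Kz1.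
have [||z0 Kz0 hz0] := @max_attained K (fun z => cmod (H z)) B0 _ cK bK.
- by exists z1.
- move=> z Kz e e0; have [del del0 hdel] := contH z Kz e e0.
  by exists del => // w _ /hdel; apply: le_lt_trans; exact: cmod_dist.
apply: le_trans (hz0 z1 Kz1) _; rewrite leNgt; apply/negP => mB.
pose E z := K z /\ cmod (H z0) <= cmod (H z).
have cE : cclosed E.
  move=> z hz; have Kz : K z by apply: cK => e /hz[w [Kw _] hw]; exists w.
  split => //; rewrite leNgt; apply/negP => hlt.
  have [del del0 hdel] := contH z Kz (cmod (H z0) - cmod (H z)) (ltac:(by rewrite subr_gt0)).
  have [w [Kw hw] /hdel] := hz del del0.
  have := cmodB_ge (H w) (H z); lra.
(* On a small circle around the rightmost maximum point [p] the function would
   be constant, which yields a maximum point further to the right. *)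
have [||p [Kp Ep] hp] := @max_attained E (@complex.Re R) B0 _ cE (fun z Ez => bK z Ez.1).
- by exists z0.
- move=> z _ e e0; exists e => // w _; apply: le_lt_trans.
  by rewrite -raddfB; exact: cmod_Re.
have [e e0 he] : exists2 e : R, 0 < e & forall w, cmod (w - p) < e -> K w.
  apply: contrapT => hn; have := hB p Kp; rewrite leNgt => /(_ _)/negP; apply.
    move=> e e0; apply: contrapT => hw; apply: hn; exists e => // w hwe.
    by apply: contrapT => nK; apply: hw; exists w.
  exact: lt_le_trans Ep.
have e20 : 0 < e / 2 by lra.
have e2e : e / 2 < e by lra.
have hcirc t : cmod (p + (e / 2)%:C * cis t - p) < e.
  by rewrite addrAC subrr add0r cmodM cmod_cis mulr1 cmod_real ger0_norm // ltW.
have := @circle_eq H p (e / 2) e e20 e2e (fun w hw => dK w (he w hw)) _ 0 _.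
rewrite lexx ltW ?tau_gt0 // cis0 mulr1 => eqH.
have := hp (p + (e / 2)%:C).
rewrite leNgt raddfD /= ltrDl e20 => /(_ _)/negP; apply=> //.
split; first by apply: he; rewrite addrAC subrr add0r cmod_real ger0_norm // ltW.
rewrite eqH // => t; apply: le_trans Ep; apply: hz0; apply: he; exact: hcirc.
Qed.

End MaximumPrinciple.

Section CauchyEstimates.
Context {R : realType}.
Local Notation C := R[i].
Local Notation tau := (pi *+ 2 : R).

Lemma circle_point (z w : C) (r : R) : 0 < r -> cmod (w - z) = r ->
  exists2 t, 0 <= t <= tau & w = z + r%:C * cis t.
Proof.
move=> r0 hr; have wz : w - z != 0 by rewrite -cmod_gt0 hr.
have [[a b] [e ea eb]] := cexp_polar wz; rewrite /= hr in ea eb.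
have p0 := @pi_gt0 R.
have e' : w = z + r%:C * cis b.
  have -> : r%:C * cis b = w - z.
    by rewrite -cexp_ln_cis // -ea -e; congr (cexp _); rewrite [RHS]complexEi.
  by rewrite subrKC.
have [b0|b0] := lerP 0 b.
  exists b => //; rewrite b0 (le_trans _ (_ : pi <= tau)) //; last by rewrite mulr2n; lra.
  by rewrite (le_trans (ler_norm b)).
exists (b + tau).
  by move: eb; rewrite ler_norml mulr2n => /andP[? ?]; apply/andP; split; lra.
by rewrite e' /cis rmorphD mulrDr cexp_2pi.
Qed.

Lemma cmod_circle (z : C) (r t : R) : 0 <= r -> cmod (z + r%:C * cis t - z) = r.
Proof. by move=> r0; rewrite addrAC subrr add0r cmodM cmod_cis mulr1 cmod_real ger0_norm. Qed.

(** Comparing the means over two translated circles yields a Lipschitz bound for the derivative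
    before the latter is known to be differentiable. *)
Lemma cauchy_diff (h : C -> C) z w d d' (r rho B : R) : 0 < r -> r < rho ->
  (forall x, cmod (x - z) < rho -> exists D, cder h x D) ->
  (forall x, cmod (x - w) < rho -> exists D, cder h x D) ->
  cder h z d -> cder h w d' ->
  (forall t, cmod (h (z + r%:C * cis t) - h (w + r%:C * cis t)) <= B) ->
  r * cmod (d - d') <= B.
Proof.
move=> r0 rrho hz hw hd hd' hB.
have [p hp pE] := circle_mean1 r0 rrho hz hd.
have [q hq qE] := circle_mean1 r0 rrho hw hd'.
have := @pder_cmod_le_const _ _ _ B 0 tau (ltW tau_gt0) (fun t _ => gderB (hp t) (hq t)).
have -> : p tau - q tau - (p 0 - q 0) = r%:C * (d - d') * tau%:C.
  rewrite [LHS](_ : _ = (p tau - p 0) - (q tau - q 0)); last by ring.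
  by rewrite pE qE; ring.
rewrite subr0 !cmodM !cmod_real !ger0_norm ?(ltW r0) ?(ltW tau_gt0) // => k.
rewrite -(ler_pM2r (tau_gt0 (R := R))); apply: k => t _.
by rewrite -mulrBl cmodM cmod_cis mulr1.
Qed.

Lemma cauchy_est (h : C -> C) z d (r rho B : R) : 0 < r -> r < rho ->
  (forall x, cmod (x - z) < rho -> exists D, cder h x D) -> cder h z d ->
  (forall w, cmod (w - z) = r -> cmod (h w) <= B) -> r * cmod d <= B.
Proof.
move=> r0 rrho hz hd hB.
have [p hp pE] := circle_mean1 r0 rrho hz hd.
have := @pder_cmod_le_const _ _ _ B 0 tau (ltW tau_gt0) (fun t _ => hp t).
rewrite subr0 pE !cmodM !cmod_real !ger0_norm ?(ltW r0) ?(ltW tau_gt0) // => k.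
rewrite -(ler_pM2r (tau_gt0 (R := R))); apply: k => t _.
by rewrite cmodM cmod_cis mulr1; apply: hB; rewrite cmod_circle // ltW.
Qed.

Lemma gcontM (X : Type) (i u v : X -> C) (x : X) :
  (forall e : R, 0 < e -> exists2 del : R, 0 < del & forall y, cmod (i y - i x) < del -> cmod (u y - u x) < e) ->
  (forall e : R, 0 < e -> exists2 del : R, 0 < del & forall y, cmod (i y - i x) < del -> cmod (v y - v x) < e) ->
  (forall e : R, 0 < e -> exists2 del : R, 0 < del &
     forall y, cmod (i y - i x) < del -> cmod (u y * v y - u x * v x) < e).
Proof.
move=> hu hv e e0; pose k := cmod (u x) + cmod (v x) + 1.
have k0 : 0 < k by rewrite /k; have := cmod_ge0 (u x); have := cmod_ge0 (v x); lra.
have m0 : 0 < Num.min 1 (e / k) by rewrite lt_min ltr01 divr_gt0.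
have [d1 d10 h1] := hu _ m0; have [d2 d20 h2] := hv _ m0.
exists (Num.min d1 d2) => [|y]; first by rewrite lt_min d10.
rewrite lt_min => /andP[/h1 + /h2]; rewrite !lt_min => /andP[a1 a2] /andP[b1 b2].
have -> : u y * v y - u x * v x = (u y - u x) * (v y - v x) + u x * (v y - v x) + v x * (u y - u x) by ring.
apply: le_lt_trans (cmodD _ _) _; have := cmodD ((u y - u x) * (v y - v x)) (u x * (v y - v x)).
rewrite !cmodM.
have : k * (e / k) = e by rewrite mulrCA divff ?mulr1 ?gt_eqF.
move: a1 a2 b1 b2; set m := e / k; rewrite /k => a1 a2 b1 b2 <-.
have ux0 := cmod_ge0 (u x); have vx0 := cmod_ge0 (v x).
have A0 := cmod_ge0 (u y - u x); have B0 := cmod_ge0 (v y - v x).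
set A := cmod (u y - u x) in a1 a2 A0 *; set B := cmod (v y - v x) in b1 b2 B0 *.
have : A * B <= 1 * B by rewrite ler_wpM2r // ltW.
have : cmod (u x) * B <= cmod (u x) * m by rewrite ler_wpM2l // ltW.
have : cmod (v x) * A <= cmod (v x) * m by rewrite ler_wpM2l // ltW.
lra.
Qed.

Lemma cclosed_disc (z : C) (r : R) : cclosed [set w | cmod (w - z) <= r].
Proof.
move=> w hw /=; apply/ler_addgt0Pl => e /hw[v /= hv1 hv2].
by apply: le_trans (cmod_tri w v z) _; rewrite cmodBC lerD // ltW.
Qed.

Lemma bounded_on_disc (h : C -> C) z (r : R) : 0 <= r ->
  (forall w, cmod (w - z) <= r -> ccont h w) ->
  exists B : R, forall w, cmod (w - z) <= r -> cmod (h w) <= B.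
Proof.
move=> r0 hc.
have [||w Kw e e0|x _ hx] := @max_attained _ [set w | cmod (w - z) <= r] (fun w => cmod (h w)) (r + cmod z) _ (@cclosed_disc z r).
- by exists z; rewrite /= subrr cmod0.
- by move=> w /= hw; have := cmodB_ge w z; lra.
- have [del del0 hdel] := hc w Kw e e0.
  by exists del => // v _ /hdel; apply: le_lt_trans; exact: cmod_dist.
by exists (cmod (h x)).
Qed.

(** Differentiation under the integral sign: [h'] is a circle mean of [h], and the derivative of
    [h'] is the same mean of [h']. The error is uniformly quadratic on the circle because [h'] is
    Lipschitz. An eighth of [rho] leaves room for the nested discs of radii [3 * r] to [7 * r] on
    which the bounds are taken. *)
Lemma cder_der (h h' : C -> C) z (rho : R) : 0 < rho ->
  (forall w, cmod (w - z) < rho -> cder h w (h' w)) -> exists D, cder h' z D.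
Proof.
move=> rho0 hh.
pose r := rho / 8.
have r0 : 0 < r by rewrite /r; lra.
have rE : rho = 8 * r by rewrite /r; lra.
have hE w : cmod (w - z) < rho -> exists D, cder h w D by move=> /hh ?; exists (h' w).
have [B hB] : exists B : R, forall w, cmod (w - z) <= 7 * r -> cmod (h w) <= B.
  apply: bounded_on_disc; first by lra.
  by move=> w hw; apply: (cder_cont (hh w _)); lra.
have sub x w s : cmod (x - z) <= s -> cmod (w - x) < 3 * r -> s + 3 * r <= rho -> cmod (w - z) < rho.
  by move=> h1 h2 h3; have := cmod_tri w x z; lra.
have hB' x : cmod (x - z) <= 5 * r -> r * cmod (h' x) <= B.
  move=> hx; apply: (@cauchy_est h x (h' x) r (3 * r)); rewrite ?rE; try lra.
  - by move=> w hw; apply: hE; apply: sub hx hw _; lra.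
  - by apply: hh; lra.
  - by move=> w hw; apply: hB; have := cmod_tri w x z; lra.
pose B1 := B / r.
have hB1 x : cmod (x - z) <= 5 * r -> cmod (h' x) <= B1.
  by move=> /hB'; rewrite /B1 ler_pdivlMr // mulrC.
have B10 : 0 <= B1 by apply: le_trans (cmod_ge0 (h' z)) (hB1 z _); rewrite subrr cmod0; lra.
have lip x y : cmod (x - z) < 4 * r -> cmod (y - z) < 4 * r -> cmod (h x - h y) <= B1 * cmod (x - y).
  move=> hx hy; apply: (@cder_lipschitz _ h h') => t ht.
    by apply: hh; have := ball_segment ht hy hx; lra.
  by apply: hB1; have := ball_segment ht hy hx; lra.
pose L := B1 / r.
have L0 : 0 <= L by rewrite divr_ge0 // ltW.
have lip' x y : cmod (x - z) < 3 * r -> cmod (y - z) < 3 * r -> cmod (h' x - h' y) <= L * cmod (x - y).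
  move=> hx hy; rewrite /L mulrAC ler_pdivlMr // mulrC.
  apply: (@cauchy_diff h x y (h' x) (h' y) r (3 * r)); try lra.
  - by move=> w hw; apply: hE; apply: sub (ltW hx) hw _; lra.
  - by move=> w hw; apply: hE; apply: sub (ltW hy) hw _; lra.
  - by apply: hh; lra.
  - by apply: hh; lra.
  move=> t; have := lip (x + r%:C * cis t) (y + r%:C * cis t).
  have -> : x + r%:C * cis t - (y + r%:C * cis t) = x - y by ring.
  have c1 := cmod_circle x t (ltW r0); have c2 := cmod_circle y t (ltW r0).
  apply; [have := cmod_tri (x + r%:C * cis t) x z|have := cmod_tri (y + r%:C * cis t) y z]; lra.
have quad x k : cmod (x - z) < 3 * r -> cmod (x + k - z) < 3 * r ->
    cmod (h (x + k) - h x - h' x * k) <= L * cmod k * cmod k.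
  move=> hx hk; have := @cder_lipschitz _ (fun w => h w - h' x * w) (fun w => h' w - h' x * 1) x (x + k) (L * cmod k).
  have -> : x + k - x = k by ring.
  have -> : h (x + k) - h' x * (x + k) - (h x - h' x * x) = h (x + k) - h x - h' x * k by ring.
  have seg t : 0 <= t <= 1 -> cmod (x + t%:C * k - z) < 3 * r.
    by move=> ht; have := ball_segment ht hx hk; rewrite (_ : x + k - x = k) //; ring.
  apply=> t ht; have hs := seg t ht.
    by apply: gderB; [apply: hh; lra|apply: gderMl; exact: gder_i].
  rewrite mulr1; apply: le_trans (lip' _ _ hs hx) _; rewrite ler_wpM2l //.
  rewrite addrAC subrr add0r cmodM cmod_real; case/andP: ht => t0 t1.
  by rewrite ger0_norm // ler_piMl ?cmod_ge0.
pose gam t := z + r%:C * cis t.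
have hgam t : cmod (gam t - z) = r by rewrite cmod_circle // ltW.
have gamder t : pder gam t (r%:C * (cis t * 'i)).
  have h1 : pder (fun s : R => 'i * s%:C) t 'i.
    by apply: gder_eqd (gderMl 'i (gder_i t)); rewrite mulr1.
  have h2 := gder_comp h1 (cder_cexp ('i * t%:C)).
  by apply: gder_eqd (gderD (gder_const z t) (gderMl r%:C h2)); rewrite add0r.
have gamc t := gder_cont (gamder t).
have [ps hps] : exists p : R -> C, forall t, pder p t (h' (gam t) * cis (- t)).
  have cc t : forall e : R, 0 < e -> exists2 del : R, 0 < del &
     forall s : R, cmod (s%:C - t%:C) < del -> cmod (h' (gam s) * cis (- s) - h' (gam t) * cis (- t)) < e.
    apply: (@gcontM R (real_complex R)) => e e0.
      have e1 : 0 < e / (L + 1) by rewrite divr_gt0 // ltr_wpDl.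
      have [del del0 hdel] := gamc t _ e1; exists del => // s /hdel hs.
      apply: le_lt_trans (lip' _ _ _ _) _; rewrite ?hgam; try lra.
      apply: le_lt_trans (_ : (L + 1) * cmod (gam s - gam t) < e).
        by rewrite ler_wpM2r ?cmod_ge0 //; lra.
      by rewrite mulrC -ltr_pdivlMr // ltr_wpDl.
    have h1 : pder (fun s : R => 'i * (- s)%:C) t ('i * -1).
      apply: gderMl; apply: (gder_ext _ (gderN (gder_i t))) => s; exact: esym (rmorphN _ _).
    exact: (gder_cont (gder_comp h1 (cder_cexp _)) e0).
  have lib t : {for t, continuous (fun s => complex.Re (h' (gam s) * cis (- s)))} /\
     {for t, continuous (fun s => complex.Im (h' (gam s) * cis (- s)))}.
    by split; apply/cvgrPdist_lt => /= e e0; have [del del0 hdel] := cc t e e0;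
    apply/nbhs_ballP; exists del => // s; rewrite /ball /= distrC => hs;
    have := hdel s; rewrite -rmorphB cmod_real => /(_ hs); rewrite distrC; apply: le_lt_trans;
    rewrite -raddfB; [exact: cmod_Re|exact: cmod_Im].
  by apply: curve_primitive => t; case: (lib t).
have rt0 : r%:C * tau%:C != 0 :> C by rewrite mulf_neq0 ?fmorph_eq0 ?gt_eqF ?tau_gt0.
exists ((ps tau - ps 0) / (r%:C * tau%:C)) => e e0.
pose e' := e * r / (L + 1).
have e'0 : 0 < e' by rewrite divr_gt0 ?mulr_gt0 // ltr_wpDl.
exists (Num.min r e') => [|y]; first by rewrite lt_min r0.
rewrite lt_min => /andP[hy1 hy2]; set k := y - z in hy1 hy2 *.
have [p hp pE] := @circle_mean1 _ h y r (3 * r) r0 (ltac:(lra))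
  (fun w hw => hE w (sub y w r (ltW hy1) hw (ltac:(lra)))) (h' y) (hh y (ltac:(lra))).
have [q hq qE] := @circle_mean1 _ h z r (3 * r) r0 (ltac:(lra))
  (fun w hw => hE w (ltac:(lra))) (h' z) (hh z (ltac:(rewrite subrr cmod0; lra))).
have := @pder_cmod_le_const _ _ _ (L * cmod k * cmod k) 0 tau (ltW tau_gt0)
   (fun t _ => gderB (gderB (hp t) (hq t)) (gderMl k (hps t))).
rewrite subr0 => hmain.
have T0 := @tau_gt0 R.
have -> : h' y - h' z - (ps tau - ps 0) / (r%:C * tau%:C) * k =
  (p tau - q tau - k * ps tau - (p 0 - q 0 - k * ps 0)) / (r%:C * tau%:C).
  apply: (mulIf rt0); rewrite divfK // mulrBl mulrAC divfK //.
  rewrite [RHS](_ : _ = (p tau - p 0) - (q tau - q 0) - k * (ps tau - ps 0)); last by ring.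
  by rewrite pE qE; ring.
rewrite cmodM cmodV cmodM !cmod_real !ger0_norm ?(ltW r0) ?(ltW T0) // ler_pdivrMr ?mulr_gt0 //.
apply: le_trans (hmain _) _.
  move=> t _; have -> : h (y + r%:C * cis t) * cis (- t) - h (z + r%:C * cis t) * cis (- t) -
     k * (h' (gam t) * cis (- t)) = (h (gam t + k) - h (gam t) - h' (gam t) * k) * cis (- t).
    have -> : gam t + k = y + r%:C * cis t by rewrite /gam /k; ring.
    by rewrite /gam; ring.
  rewrite cmodM cmod_cis mulr1; apply: quad; rewrite ?hgam; first by lra.
  have -> : gam t + k - z = (gam t - z) + k by ring.
  by apply: le_lt_trans (cmodD _ _) _; rewrite hgam; lra.
have key : L * cmod k <= e * r.
  have -> : e * r = (L + 1) * e' by rewrite /e'; field; rewrite gt_eqF // ltr_wpDl.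
  by rewrite ler_pM ?cmod_ge0 // ?ltW //; lra.
rewrite (_ : e * cmod k * (r * tau) = e * r * cmod k * tau); last by ring.
by rewrite ler_wpM2r ?(ltW T0) // ler_wpM2r ?cmod_ge0.
Qed.

End CauchyEstimates.

(** * Growth of the maximum modulus *)

Section Growth.
Context {R : realType}.
Local Notation C := R[i].

Definition holo (f : C -> C) := forall z, exists d, cder f z d.

Section MaxModulus.
Variable f : C -> C.
Hypothesis hf : holo f.
Local Notation M := (max_modulus f).

Lemma holo_cont z : ccont f z.
Proof. by have [d] := hf z; exact: cder_cont. Qed.

Lemma cmod_le_max_modulus z : cmod (f z) <= M (cmod z).
Proof.
have [B hB] := @bounded_on_disc _ f 0 (cmod z) (cmod_ge0 z) (fun w _ => holo_cont w).
apply: ub_le_sup; last by exists z.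
by exists B => _ [w /= hw <-]; apply: hB; rewrite subr0 hw.
Qed.

Lemma max_modulus_le (r B : R) : 0 <= r -> (forall z, cmod z = r -> cmod (f z) <= B) -> M r <= B.
Proof.
move=> r0 hB; apply: ge_sup; last by move=> _ [z /= hz <-]; exact: hB.
by exists (cmod (f r%:C)), r%:C => //=; rewrite cmod_real ger0_norm.
Qed.

Lemma max_modulus_mono (r s : R) : 0 <= r -> r <= s -> M r <= M s.
Proof.
move=> r0 rs; apply: max_modulus_le => // z hz.
apply: (@max_principle _ [set w | cmod (w - 0) <= s] f s (M s)).
- exact: cclosed_disc.
- by move=> w /=; rewrite subr0.
- by move=> w _; exact: hf.
- move=> w /=; rewrite subr0 => ws hw; suff <- : cmod w = s by exact: cmod_le_max_modulus.
  apply: le_anti; rewrite ws /= leNgt; apply/negP => ws'.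
  have [v nv hv] := hw (s - cmod w) (ltac:(by rewrite subr_gt0)).
  by apply: nv; have := cmodB_ge v w; rewrite subr0; lra.
by rewrite /= subr0 hz.
Qed.

Lemma cmod_le_max_modulus_disc z (r : R) : cmod z <= r -> cmod (f z) <= M r.
Proof.
by move=> zr; apply: le_trans (cmod_le_max_modulus z) _; apply: max_modulus_mono; rewrite ?cmod_ge0.
Qed.

Lemma max_modulus_ge0 (r : R) : 0 <= r -> 0 <= M r.
Proof. by move=> r0; apply: le_trans (cmod_ge0 (f 0)) _; rewrite cmod_le_max_modulus_disc // cmod0. Qed.

Lemma max_modulus_attained (r : R) : 0 <= r -> exists2 z, cmod z = r & cmod (f z) = M r.
Proof.
move=> r0.
have [|||w Kw e e0|x Kx hx] := @max_attained _ [set w | cmod w = r] (fun w => cmod (f w)) r.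
- by exists r%:C; rewrite /= cmod_real ger0_norm.
- move=> z hz; apply/eqP; rewrite -subr_eq0 -normr_eq0 eq_le normr_ge0 andbT; apply/ler_addgt0Pl => e e0.
  by rewrite addr0; have [w /= <- /ltW] := hz e e0; rewrite distrC; apply: le_trans; exact: cmod_dist.
- by move=> w ->.
- have [del del0 hdel] := holo_cont w e0.
  by exists del => // v _ /hdel; apply: le_lt_trans; exact: cmod_dist.
exists x => //; apply: le_anti; rewrite -{1}Kx cmod_le_max_modulus /=.
by apply: max_modulus_le => // z hz; exact: hx.
Qed.

(* The maximum principle for [f z / z ^+ K] on an annulus. *)
Lemma three_circles (K : nat) (r s S B : R) : 0 < r -> r <= s -> s <= S ->
  M r <= B * r ^+ K -> M S <= B * S ^+ K -> M s <= B * s ^+ K.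
Proof.
move=> r0 rs sS hr hS.
have s0 : 0 < s by exact: lt_le_trans rs.
have hB w x : cmod w = x -> 0 < x -> M x <= B * x ^+ K -> cmod (f w / w ^+ K) <= B.
  move=> hw x0 hx; rewrite cmodM cmodV cmodX hw ler_pdivrMr ?exprn_gt0 //.
  by apply: le_trans hx; rewrite -hw cmod_le_max_modulus.
apply: max_modulus_le => [|z hz]; first exact: ltW.
have -> : cmod (f z) = cmod (f z / z ^+ K) * s ^+ K.
  by rewrite cmodM cmodV cmodX hz divfK // gt_eqF // exprn_gt0.
rewrite ler_pM2r ?exprn_gt0 //.
apply: (@max_principle _ [set w | r <= cmod w /\ cmod w <= S] (fun w => f w / w ^+ K) S B).
- move=> w hw; split; apply/ler_addgt0Pl => e /hw[v /= [hv1 hv2] hvw].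
    by have := cmodB_ge v w; lra.
  by have := cmodB_ge w v; rewrite cmodBC; lra.
- by move=> w [].
- move=> w [rw _]; have w0 : w != 0 by rewrite -cmod_gt0 (lt_le_trans r0).
  have [d hd] := hf w.
  have hp := gder_exp K (@gder_i _ C id w).
  by eexists; apply: (gder_div _ hd hp); rewrite expf_neq0.
- move=> w [rw wS] hw.
  have [e|ne] := eqVneq (cmod w) r; first exact: hB e _ _.
  have [e|ne'] := eqVneq (cmod w) S.
    by apply: hB e _ _ => //; rewrite (lt_le_trans s0).
  have m0 : 0 < Num.min (cmod w - r) (S - cmod w).
    by rewrite lt_min !subr_gt0 !lt_def ne rw eq_sym ne' wS.
  have [v nv] := hw _ m0; rewrite lt_min => /andP[h1 h2]; case: nv; split.
    by have := cmodB_ge w v; rewrite cmodBC; lra.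
  by have := cmodB_ge v w; lra.
by rewrite /= hz.
Qed.
End MaxModulus.

Lemma cder_const_holo (f : C -> C) : (forall z, cder f z 0) -> forall z, f z = f 0.
Proof. by move=> h z; apply: cder_eq0_const => t _; exact: h. Qed.

Lemma cder_horner (p : {poly C}) z : cder (fun w => p.[w]) z p^`().[z].
Proof.
elim/poly_ind: p => [|p c IH].
  by rewrite deriv0 horner0; apply: (gder_ext _ (gder_const 0 z)) => w; rewrite horner0.
rewrite derivD derivC addr0 derivM derivX mulr1 hornerD hornerM hornerX.
apply: (gder_ext _ (gder_eqd _ (gderD (gderM IH (@gder_i _ C id z)) (gder_const c z)))) => [w|].
  by rewrite hornerD hornerM hornerX hornerC.
by rewrite addr0 mulr1.
Qed.

Lemma poly_primitive (p : {poly C}) : exists q : {poly C}, q^`() = p.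
Proof.
exists (\poly_(i < (size p).+1) (p`_i.-1 / i%:R)); apply/polyP => i.
rewrite coef_deriv coef_poly ltnS; case: ltnP => hi /=.
  by rewrite -[LHS]mulr_natr divfK // pnatr_eq0.
by rewrite mul0rn nth_default.
Qed.

(** Liouville's theorem by induction on the degree: on the disc of half the radius, Cauchy's
    estimate lowers the exponent by one for [f']. The bound is assumed only for arbitrarily large
    radii, which is all that a failure of [max_modulus_growth] provides. *)
Lemma poly_growth (K : nat) (f : C -> C) (A : R) : holo f ->
  (forall r1 : R, exists2 r, r1 <= r & forall z, cmod z <= r -> cmod (f z) <= A * r ^+ K) ->
  exists p : {poly C}, forall z, f z = p.[z].
Proof.
elim: K f A => [|K IH] f A hf hA.
  have h0 z : cder f z 0.
    have [d hd] := hf z; suff d0 : d = 0 by rewrite -d0.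
    apply/eqP; rewrite -cmod_eq0 eq_le cmod_ge0 andbT; apply/ler_addgt0Pl => e e0; rewrite addr0.
    have [r hr hB] := hA (cmod z + 1 + `|A| / e).
    have A0 := normr_ge0 A.
    have Ae : 0 <= `|A| / e by rewrite divr_ge0 // ltW.
    pose s := r - cmod z.
    have s1 : 1 + `|A| / e <= s by rewrite /s; lra.
    have s0 : 0 < s by lra.
    have := @cauchy_est _ f z d s (s + 1) A s0 (ltac:(lra)) (fun x _ => hf x) hd.
    move=> /(_ _) hc; have hsd : s * cmod d <= A.
      apply: hc => w hw; have := hB w; rewrite expr0 mulr1; apply.
      by have := cmodB_ge w z; rewrite hw /s; lra.
    rewrite -(ler_pM2l s0); apply: le_trans hsd _; apply: le_trans (ler_norm A) _.
    by rewrite -ler_pdivrMr //; lra.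
  by exists (f 0)%:P => z; rewrite hornerC; exact: cder_const_holo.
have [f' hf'] := choice hf.
have holo' : holo f' by move=> z; apply: (@cder_der _ f f' z 1).
have [|p hp] := IH f' (A * 2 ^+ K.+1) holo'.
  move=> r1; have [r hr hB] := hA (Num.max (2 * r1) 1).
  move: hr; rewrite ge_max => /andP[hr1 hr2].
  exists (r / 2) => [|z hz]; first by lra.
  have r20 : 0 < r / 2 by lra.
  have := @cauchy_est _ f z (f' z) (r / 2) r (A * r ^+ K.+1) r20 (ltac:(lra)) (fun x _ => hf x) (hf' z).
  move=> /(_ _) hc; rewrite -(ler_pM2l r20).
  have -> : r / 2 * (A * 2 ^+ K.+1 * (r / 2) ^+ K) = A * r ^+ K.+1.
    rewrite expr_div_n !exprS; field.
    by rewrite expf_neq0.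
  by apply: hc => w hw; apply: hB; have := cmodB_ge w z; lra.
have [q hq] := poly_primitive p.
exists (q + (f 0 - q.[0])%:P) => z; rewrite hornerD hornerC.
have := @cder_const_holo (fun w => f w - q.[w]) _ z.
move=> <-; first by ring.
move=> w; rewrite -(subrr (f' w)); apply: gderB; first exact: hf'.
by have := cder_horner q w; rewrite hq -hp.
Qed.

(** The identity theorem from [three_circles]: as [g = f - c] vanishes on an inner circle, its
    maximum modulus at [s] is at most the one at [2 * s] divided by [2 ^+ K], for every [K]. *)
Lemma const_on_disc (f : C -> C) (c : C) (S : R) : holo f -> 0 < S ->
  (forall z, cmod z < S -> f z = c) -> forall z, f z = c.
Proof.
move=> hf S0 hc z; have [/hc//|Sz] := ltP (cmod z) S.
pose g w := f w - c.
have hg : holo g.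
  by move=> w; have [d hd] := hf w; exists (d - 0); apply: gderB hd (gder_const c w).
pose r := S / 2; pose s := cmod z.
have r0 : 0 < r by rewrite /r; lra.
have rs : r <= s by rewrite /r /s; lra.
have s0 : 0 < s by lra.
have Mr : max_modulus g r = 0.
  apply: le_anti; rewrite (max_modulus_ge0 hg (ltW r0)) andbT.
  apply: max_modulus_le => [|w hw]; first exact: ltW.
  by rewrite /g hc ?subrr ?cmod0 // hw /r; lra.
have hK K : max_modulus g s <= max_modulus g (2 * s) / 2 ^+ K.
  have M2 : 0 <= max_modulus g (2 * s) by apply: max_modulus_ge0 => //; lra.
  have -> : max_modulus g (2 * s) / 2 ^+ K = max_modulus g (2 * s) / (2 * s) ^+ K * s ^+ K.
    by rewrite exprMn; field; rewrite !expf_neq0 // gt_eqF.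
  apply: (three_circles hg r0 rs (_ : s <= 2 * s)); first by lra.
    by rewrite Mr mulr_ge0 ?exprn_ge0 ?divr_ge0 ?exprn_ge0 //; lra.
  by rewrite divfK // expf_neq0 // gt_eqF //; lra.
have : cmod (g z) = 0.
  apply: le_anti; rewrite cmod_ge0 andbT leNgt; apply/negP => gz0.
  have hz := cmod_le_max_modulus hg z; rewrite -/s in hz.
  pose K := (Num.truncn (max_modulus g (2 * s) / cmod (g z))).+1.
  have : max_modulus g (2 * s) / cmod (g z) < 2 ^+ K.
    apply: lt_trans (truncnS_gt _) _; rewrite -natrX ltr_nat; exact: ltn_expl.
  rewrite ltr_pdivrMr // [2 ^+ K * _]mulrC -ltr_pdivrMr ?exprn_gt0 //.
  by have := hK K; lra.
by move/eqP; rewrite cmod_eq0 subr_eq0 => /eqP.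
Qed.

(** * Maximum modulus of a transcendental function and its iterates *)

Section Transcendental.
Variable f : C -> C.
Hypotheses (hf : holo f) (ntf : ~ (exists p : {poly C}, forall z, f z = p.[z])).
Local Notation M := (max_modulus f).

Lemma max_modulus_growth (K : nat) : exists2 r1 : R, 0 < r1 & forall r, r1 <= r -> r ^+ K <= M r.
Proof.
apply: contrapT => hn; apply: ntf; apply: (@poly_growth K f 1 hf) => r1.
apply: contrapT => hr; apply: hn; exists (Num.max 1 r1); first by rewrite lt_max ltr01.
move=> r; rewrite ge_max => /andP[r1' r1r]; rewrite leNgt; apply/negP => hM.
apply: hr; exists r => // z hz; rewrite mul1r; apply: le_trans (ltW hM).
exact: cmod_le_max_modulus_disc.
Qed.

(** Otherwise an interior point [p] attains the maximum over the disc of radius [S]. By [circle_eq],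
    [f] is constant around every point where it takes the value [f p], and a chain of steps of
    length at most [del] along segments spreads this value over a disc; [f] would be a constant
    polynomial. *)
Lemma max_modulus_strict (r S : R) : 0 <= r -> r < S -> M r < M S.
Proof.
move=> r0 rS; rewrite ltNge; apply/negP => MSr.
have [p pr fp] := max_modulus_attained hf r0.
have bound z : cmod z <= S -> cmod (f z) <= cmod (f p).
  by move=> zS; rewrite fp; apply: le_trans MSr; exact: cmod_le_max_modulus_disc.
have step y z : cmod y < S -> f y = f p -> cmod (z - y) < S - cmod y -> f z = f p.
  move=> yS fy hz; have [->//|zy] := eqVneq z y.
  have d0 : 0 < cmod (z - y) by rewrite cmod_gt0 subr_eq0.
  have [t ht zE] := circle_point d0 (erefl _).
  rewrite zE -fy; apply: (circle_eq d0 hz _ _ ht) => [w _|s]; first exact: hf.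
  rewrite fy; apply: bound; have := cmodB_ge (y + (cmod (z - y))%:C * cis s) y.
  by rewrite cmod_circle ?cmod_ge0 //; lra.
pose r' := (r + S) / 2; pose del := S - r'.
have rr' : r < r' by rewrite /r'; lra.
have del0 : 0 < del by rewrite /del /r'; lra.
have chain n z : cmod z < r' -> cmod (z - p) <= n%:R * del -> f z = f p.
  elim: n z => [|n IH] z hz; first by rewrite mul0r => h; suff -> : z = p by []; apply/eqP; rewrite -subr_eq0 -cmod_eq0 eq_le h cmod_ge0.
  move=> hzp; pose t : R := n%:R / n.+1%:R.
  have n0 : 0 < n.+1%:R :> R by rewrite ltr0n.
  have tE : 1 - t = n.+1%:R^-1 by rewrite /t -natr1; field; rewrite natr1 gt_eqF.
  have t01 : 0 <= t <= 1.
    by rewrite divr_ge0 ?ler0n //= ler_pdivrMr // mul1r ler_nat.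
  have p' : cmod (p - 0) < r' by rewrite subr0 pr.
  have z' : cmod (z - 0) < r' by rewrite subr0.
  have yr := ball_segment t01 p' z'; rewrite subr0 in yr.
  apply: (step _ _ (lt_trans yr _) _ _); first by rewrite /r'; lra.
    apply: IH => //; rewrite addrAC subrr add0r cmodM cmod_real ger0_norm; last by case/andP: t01.
    by rewrite /t mulrAC ler_pdivrMr // -mulrA [del * _]mulrC mulrA -mulrA ler_wpM2l.
  have -> : z - (p + t%:C * (z - p)) = (1 - t)%:C * (z - p) by rewrite rmorphB rmorph1; ring.
  rewrite tE cmodM cmod_real ger0_norm ?invr_ge0 // mulrC.
  apply: le_lt_trans (_ : del < _); first by rewrite ler_pdivrMr // mulrC.
  by rewrite /del; lra.
have cst z : cmod z < r' -> f z = f p.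
  move=> hz; apply: (chain (Num.truncn (cmod (z - p) / del)).+1 z hz).
  by rewrite -ler_pdivrMr // ltW // truncnS_gt.
apply: ntf; exists (f p)%:P => z; rewrite hornerC.
by apply: (const_on_disc hf _ cst); lra.
Qed.

(** [three_circles] with exponent 2 between the radii 1 and [S]. The constant [M S / S ^+ 2] also
    serves on the unit circle, since [M S >= S ^+ 3] and [S >= M 1]. *)
Lemma max_modulus_ratio : exists2 s0 : R, 0 < s0 & forall s S, s0 <= s -> s <= S ->
  M s * S ^+ 2 <= M S * s ^+ 2.
Proof.
have [r1 r10 hr1] := max_modulus_growth 3.
exists (Num.max r1 (Num.max 1 (M 1))) => [|s S]; first by rewrite lt_max r10.
rewrite !ge_max => /and3P[h1 h2 h3] sS.
have S0 : 0 < S by lra.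
have S2 : 0 < S ^+ 2 by rewrite exprn_gt0.
rewrite -ler_pdivlMr // mulrAC.
have MS : M 1 <= M S / S ^+ 2.
  rewrite ler_pdivlMr //; apply: le_trans (hr1 S _); last by lra.
  by rewrite exprS ler_wpM2r ?(ltW S2) //; lra.
apply: (three_circles hf ltr01 h2 sS); first by rewrite expr1n mulr1.
by rewrite divfK // gt_eqF.
Qed.

Lemma cmod_iter_le n z (r : R) : cmod z <= r -> cmod (iter n f z) <= iter n M r.
Proof. by move=> zr; elim: n => [|n IH] //=; exact: cmod_le_max_modulus_disc. Qed.

Section Iterates.
Variable r0 : R.
Hypotheses (r00 : 0 < r0) (hM : forall r : R, r0 <= r -> r < M r).

Lemma iter_max_modulus_ge n : r0 <= iter n M r0.
Proof. by elim: n => [|n IH] //=; apply: le_trans IH (ltW (hM IH)). Qed.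

Lemma iter_max_modulus_incr m n : (m <= n)%N -> iter m M r0 <= iter n M r0.
Proof.
move=> /subnK <-; elim: (n - m)%N => [|k IH]; first by rewrite add0n.
by rewrite addSn iterS; apply: le_trans IH (ltW (hM (iter_max_modulus_ge _))).
Qed.

(** Bounded iterates would have a supremum [T] with [T < M T]. By continuity of [f] at a point where
    [M T] is attained, [M (t * T)] already exceeds [T] for some [t < 1], so the successor of an
    iterate above [t * T] exceeds [T]. *)
Lemma iter_max_modulus_unbounded (B : R) : exists n0, forall n, (n0 <= n)%N -> B < iter n M r0.
Proof.
suff [n0 h] : exists n, B < iter n M r0.
  by exists n0 => n hn; apply: lt_le_trans h _; exact: iter_max_modulus_incr.
apply: contrapT => hn.
have hB n : iter n M r0 <= B by rewrite leNgt; apply/negP => h; apply: hn; exists n.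
pose A := range (fun n => iter n M r0).
have ubA : has_ubound A by exists B => _ [n _ <-].
pose T := sup A.
have hT n : iter n M r0 <= T by apply: ub_le_sup => //; exists n.
have r0T : r0 <= T := hT 0%N.
have T0 : 0 < T by exact: lt_le_trans r0T.
have [p pT fp] := max_modulus_attained hf (ltW T0).
have fpT : T < cmod (f p) by rewrite fp; exact: hM.
have [del del0 hdel] := @holo_cont f hf p _ (ltac:(by rewrite subr_gt0; exact: fpT) : 0 < cmod (f p) - T).
have [t [t0 t1 tdel]] : exists t, [/\ 0 < t, t < 1 & (1 - t) * T < del].
  have m0 : 0 < Num.min (1 / 2) (del / (2 * T)) by rewrite lt_min !divr_gt0 // mulr_gt0.
  have m1 : Num.min (1 / 2) (del / (2 * T)) <= 1 / 2 by rewrite ge_min lexx.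
  have m2 : Num.min (1 / 2) (del / (2 * T)) <= del / (2 * T) by rewrite ge_min lexx orbT.
  exists (1 - Num.min (1 / 2) (del / (2 * T))); split; [lra|lra|].
  rewrite opprB addrC subrK; apply: le_lt_trans (_ : del / (2 * T) * T < del).
    by rewrite ler_wpM2r ?(ltW T0).
  by rewrite invfM mulrA mulfVK ?gt_eqF //; lra.
have htp : cmod (f (t%:C * p)) > T.
  have := hdel (t%:C * p); have -> : t%:C * p - p = (t - 1)%:C * p by rewrite rmorphB rmorph1; ring.
  rewrite cmodM cmod_real pT ler0_norm ?subr_le0 ?(ltW t1) // opprB => /(_ tdel).
  by have := cmodB_ge (f p) (f (t%:C * p)); rewrite cmodBC; lra.
have tT : t * T < T by rewrite gtr_pMl.
have [n hn'] : exists n, t * T < iter n M r0.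
  have [|_ [n _ <-] h] := @sup_gt _ A (t * T) _ tT; first by exists r0, 0%N.
  by exists n.
have := hT n.+1; rewrite leNgt iterS => /negP; apply.
apply: lt_le_trans htp _; apply: cmod_le_max_modulus_disc => //.
by rewrite cmodM cmod_real pT ger0_norm ?ltW.
Qed.
End Iterates.
End Transcendental.
End Growth.

(** * Continuous logarithms *)

Section Lifting.
Context {R : realType}.
Local Notation C := R[i].

Lemma cvg_cmodP (T : Type) (F : set_system T) {FF : Filter F} (u : T -> C) (l : C) :
  u @ F --> l <-> forall e : R, 0 < e -> \forall x \near F, cmod (u x - l) < e.
Proof.
split=> [h e e0|h V /nbhs_cmodP[e e0 he]].
  by have := h [set w | cmod (w - l) < e] (proj2 (nbhs_cmodP _ _) (ex_intro2 _ _ e e0 (fun w h => h))).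
by have := h e e0; apply: filterS => x; exact: he.
Qed.

Lemma ccontP (f : C -> C) z : ccont f z <-> {for z, continuous f}.
Proof.
split=> [h|h e e0].
  apply/(@cvg_cmodP C (nbhs z) (nbhs_filter z)) => e /h[del del0 hd]; apply/nbhs_cmodP; exists del => //.
by move/(@cvg_cmodP C (nbhs z) (nbhs_filter z)): h => /(_ e e0) /nbhs_cmodP[del del0 hd]; exists del.
Qed.

Lemma lip_continuous (phi : C -> R) :
  (forall w z, `|phi w - phi z| <= cmod (w - z)) -> continuous phi.
Proof.
move=> h z V /nbhs_ballP[e /= e0 he]; apply/nbhs_cmodP; exists e => // w hw.
by apply: he; rewrite /ball /= distrC; exact: le_lt_trans hw.
Qed.

Lemma cmod_continuous : continuous (@cmod R).
Proof. by apply: lip_continuous => w z; exact: cmod_dist. Qed.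

Lemma Re_continuous : continuous (@complex.Re R).
Proof. by apply: lip_continuous => w z; rewrite -raddfB; exact: cmod_Re. Qed.

Lemma Im_continuous : continuous (@complex.Im R).
Proof. by apply: lip_continuous => w z; rewrite -raddfB; exact: cmod_Im. Qed.

Lemma cvg_complex (T : Type) (F : set_system T) {FF : Filter F} (u v : T -> R) (a b : R) :
  u @ F --> a -> v @ F --> b -> (fun x => u x +i* v x) @ F --> (a +i* b).
Proof.
move=> /cvgrPdist_lt hu /cvgrPdist_lt hv; apply/cvg_cmodP => e e0.
have e20 : 0 < e / 2 by lra.
near=> x.
have h1 : `|a - u x| < e / 2 by near: x; exact: hu.
have h2 : `|b - v x| < e / 2 by near: x; exact: hv.
by apply: le_lt_trans (cmod_ReIm _) _; rewrite /= (distrC (u x)) (distrC (v x)); lra.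
Unshelve. all: by end_near. Qed.

Lemma cvg_pairR (T : Type) (F : set_system T) {FF : Filter F} (u v : T -> R) (a b : R) :
  u @ F --> a -> v @ F --> b -> (fun x => (u x, v x)) @ F --> ((a, b) : R * R).
Proof.
move=> hu hv V [[A B] /= [hA hB] AB].
near=> x; apply: AB; split => /=; near: x; [exact: hu|exact: hv].
Unshelve. all: by end_near. Qed.

Lemma fst_cvg (x : R * R) : (fun y : R * R => y.1) @ x --> x.1.
Proof. by case: x => a b; exact: cvg_fst. Qed.

Lemma snd_cvg (x : R * R) : (fun y : R * R => y.2) @ x --> x.2.
Proof. by case: x => a b; exact: cvg_snd. Qed.

Lemma clog_continuous (w : C) : 0 < complex.Re w -> {for w, continuous clog}.
Proof.
move=> w0; apply: (@cvg_complex _ _ (nbhs_filter w)).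
  apply: (@cvg_comp _ _ _ (@cmod R) (@ln R)); first exact: cmod_continuous.
  apply: continuous_ln; rewrite cmod_gt0; apply/eqP => h; by rewrite h ltxx in w0.
apply: (@cvg_comp _ _ _ (fun v : C => complex.Im v / complex.Re v) (@atan R)); last exact: continuous_atan.
apply: (@cvgM _ _ _ (nbhs_filter w) (@complex.Im R) (fun v : C => (complex.Re v)^-1)).
  exact: Im_continuous.
apply: (@cvgV _ _ _ (nbhs_filter w) (@complex.Re R)); last exact: Re_continuous.
by rewrite gt_eqF.
Qed.

Lemma clog1 : clog 1 = 0 :> C.
Proof. by rewrite /clog cmod1 ln1 /= mul0r atan0. Qed.

Lemma Re_quot_gt0 (a b : C) : cmod (a - b) < cmod b -> 0 < complex.Re (a / b).
Proof.
move=> h; have b0 : b != 0 by rewrite -cmod_gt0; apply: le_lt_trans h; exact: cmod_ge0.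
have : cmod (a / b - 1) < 1.
  have -> : a / b - 1 = (a - b) / b by field.
  by rewrite cmodM cmodV ltr_pdivrMr ?mul1r // cmod_gt0.
have := cmod_Re (a / b - 1); rewrite raddfB /= ler_norml => /andP[h1 h2]; lra.
Qed.

Section StarShaped.
Variables (K : set (R * R)) (c : R * R -> C) (B : R).
Let sc (t : R) (x : R * R) : R * R := (t * x.1, t * x.2).
Hypotheses (cK : compact K) (K0 : K (0, 0)).
Hypothesis starK : forall t x, 0 <= t <= 1 -> K x -> K (sc t x).
Hypothesis bK : forall x, K x -> `|x.1| <= B /\ `|x.2| <= B.
Hypotheses (cc : {within K, continuous c}) (cn0 : forall x, K x -> c x != 0).

Lemma star_min : exists2 m : R, 0 < m & forall x, K x -> m <= cmod (c x).
Proof.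
have w : {within K, continuous (fun x => cmod (c x))}.
  apply/subspace_continuousP => x Kx.
  by apply: cvg_comp (proj1 (subspace_continuousP _ _) cc x Kx) (@cmod_continuous _).
have [|x /set_mem Kx hx] := compact_EVT_min _ cK w; first by exists (0, 0).
exists (cmod (c x)); first by rewrite cmod_gt0 cn0.
by move=> y Ky; apply: hx; rewrite inE.
Qed.

Lemma star_unif (m : R) : 0 < m -> exists2 del : R, 0 < del &
  forall x y, K x -> K y -> ball x del y -> cmod (c y - c x) < m.
Proof.
move=> m0; have m20 : 0 < m / 2 by lra.
have /near_covering_withinP nc := proj1 (compact_near_coveringP K) cK.
have := nc R (0 : R)^'+ (fun del x => forall y, K y -> ball x del y -> cmod (c y - c x) < m) _ _.
case.
  move=> x Kx; have := proj1 (subspace_continuousP _ _) cc x Kx.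
  move=> /cvg_cmodP /(_ _ m20) /nbhs_ballP[e /= e0 he].
  have e20 : 0 < e / 2 by lra.
  exists (ball x (e / 2), [set d | d < e / 2]) => /=.
    by split; [apply: nbhsx_ballx|apply: nbhs_right_lt].
  move=> [x' d] /= [hx' hd] Kx' y Ky hy.
  have h1 := he x' (le_ball (ltW (_ : e / 2 < e)) hx') Kx'.
  have h2 : cmod (c y - c x) < m / 2.
    apply: he => //; rewrite (_ : e = e / 2 + e / 2); last by lra.
    by apply: ball_triangle hx' _; apply: le_ball hy; exact: ltW.
  have h1' : cmod (c x' - c x) < m / 2 by apply: h1; lra.
  by have := cmod_tri (c y) (c x) (c x'); rewrite (cmodBC (c x)); lra.
move=> del /= del0 hdel; exists (del / 2) => [|x y Kx Ky]; first by rewrite divr_gt0.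
apply: hdel => //; last by rewrite divr_gt0.
by rewrite /ball /= sub0r normrN gtr0_norm ?divr_gt0 // gtr_pMr // invf_lt1 // ltr1n.
Qed.

Lemma star_lift : exists2 l : R * R -> C, {within K, continuous l} & forall x, K x -> cexp (l x) = c x.
Proof.
have [m m0 hm] := star_min; have [del del0 hdel] := star_unif m0.
have B0 : 0 <= B by have [h _] := bK K0; apply: le_trans h.
pose n := (Num.truncn ((B + 1) / del)).+1.
have n0 : 0 < n%:R :> R by rewrite ltr0n.
have hn : (B + 1) / n%:R < del.
  by rewrite ltr_pdivrMr // mulrC -ltr_pdivrMr // truncnS_gt.
pose a j : R := j%:R / n%:R.
have a01 j : (j <= n)%N -> 0 <= a j <= 1.
  by move=> jn; rewrite divr_ge0 ?ler0n //= ler_pdivrMr // mul1r ler_nat.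
(* The logarithm is a sum of principal logarithms of the quotients of [c] at
   consecutive points of the segment from the origin to [x]. *)
pose q j x := c (sc (a j.+1) x) / c (sc (a j) x).
have Req j x : (j < n)%N -> K x -> 0 < complex.Re (q j x).
  move=> jn Kx; have k1 := starK (a01 _ jn) Kx; have k2 := starK (a01 _ (ltnW jn)) Kx.
  apply: Re_quot_gt0; apply: lt_le_trans (hm _ k2); apply: hdel => //.
  have [b1 b2] := bK Kx.
  have close u : `|u| <= B -> `|a j * u - a j.+1 * u| < del.
    move=> hu; rewrite -mulrBl normrM distrC.
    have -> : a j.+1 - a j = n%:R^-1 by rewrite /a -mulrBl -natrB // subSnn mul1r.
    have ni : 0 <= n%:R^-1 :> R by rewrite invr_ge0 ltW.
    rewrite (ger0_norm ni) mulrC; apply: le_lt_trans hn.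
    by rewrite ler_wpM2r //; lra.
  by split; apply: close.
have [z0 [hz0 _ _]] := cexp_polar (cn0 K0).
pose L k x := z0 + \sum_(j < k) clog (q j x).
have LS k x : L k.+1 x = L k x + clog (q k x) by rewrite /L big_ord_recr /= addrA.
have hL k x : (k <= n)%N -> K x -> cexp (L k x) = c (sc (a k) x).
  elim: k => [|k IH] kn Kx.
    by rewrite /L big_ord0 addr0 hz0 /a mul0r /sc !mul0r.
  have ck : c (sc (a k) x) != 0 by apply: cn0; apply: starK => //; apply: a01; exact: ltnW.
  by rewrite LS cexpD (IH (ltnW kn) Kx) (clogK (Req k x kn Kx)) /q [LHS]mulrC divfK.
exists (L n) => [|x Kx]; last first.
  by rewrite hL // /a divff ?gt_eqF // /sc !mul1r; case: (x).
apply/subspace_continuousP => x Kx.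
have hsc t : 0 <= t <= 1 -> (fun y => c (sc t y)) @ within K (nbhs x) --> c (sc t x).
  move=> t01; have Kt := starK t01 Kx.
  apply: (@cvg_comp _ _ _ (sc t) c _ (within K (nbhs (sc t x)))); last first.
    exact: (proj1 (subspace_continuousP _ _) cc _ Kt).
  move=> V hV; have hsc : sc t y @[y --> x] --> sc t x.
    apply: (@cvg_pairR _ _ (nbhs_filter x)); (apply: cvgM; first exact: cvg_cst).
      exact: fst_cvg.
    exact: snd_cvg.
  have := hsc _ hV; rewrite /within /nbhs /= => h.
  by apply: filterS h => y /= hy Ky; apply: hy; exact: starK.
have hLk k : (k <= n)%N -> L k @ within K (nbhs x) --> L k x.
  elim: k => [|k IH] kn.
    by rewrite /L big_ord0; under eq_cvg do rewrite big_ord0; exact: cvg_cst.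
  rewrite LS; under eq_cvg do rewrite LS.
  apply: cvgD; first by apply: IH; exact: ltnW.
  apply: (@cvg_comp _ _ _ (q k) clog); last first.
    by apply: clog_continuous; exact: Req.
  apply: cvgM; first by apply: hsc; exact: a01.
  apply: cvgV; last by apply: hsc; apply: a01; exact: ltnW.
  by apply: cn0; apply: starK => //; apply: a01; exact: ltnW.
exact: hLk.
Qed.
End StarShaped.

(** For [k = l w - l z], small by continuity, [cexp k = H w / H z]; since the exponential has
    derivative 1 at 0, [k] is at most twice [cexp k - 1] in modulus and differs from it by a small
    fraction. *)
Lemma log_cder (l H : C -> C) z d (r : R) : 0 < r -> ccont l z ->
  (forall w, cmod (w - z) < r -> cexp (l w) = H w) -> cder H z d -> cder l z (d / H z).
Proof.
move=> r0 cl hl hd e e0.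
have Hz : H z = cexp (l z) by rewrite hl // subrr cmod0.
have Hz0 : H z != 0 by rewrite Hz cexp_neq0.
pose q w := H w / H z.
have hq : cder q z (d / H z).
  apply: (gder_ext _ (gder_eqd _ (gderMl (H z)^-1 hd))) => [w|]; exact: mulrC.
set D := d / H z in hq *; set k0 := 1 + cmod D.
have k00 : 0 < k0 by rewrite ltr_pwDl ?cmod_ge0.
have [e1 [e10 e1h e1e]] : exists e1 : R, [/\ 0 < e1, e1 <= 1 / 2 & e1 * (2 * k0) <= e / 2].
  exists (Num.min (1 / 2) (e / 2 / (2 * k0))).
  have p0 : 0 < 2 * k0 by lra.
  split; first by rewrite lt_min !divr_gt0.
    by rewrite ge_min lexx.
  by rewrite -ler_pdivlMr // ge_min lexx orbT.
have e20 : 0 < e / 2 by lra.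
have [d1 d10 h1] := hq (Num.min 1 (e / 2)) (ltac:(by rewrite lt_min ltr01)).
have [d2 d20 h2] := cder_cexp0 e10.
have [d3 d30 h3] := cl d2 d20.
exists (Num.min r (Num.min d1 d3)) => [|w]; first by rewrite !lt_min r0 d10.
rewrite !lt_min => /and3P[wr w1 w3].
set k := l w - l z; set x := w - z in w1 *.
have ek : cexp k = q w by rewrite /k cexpB hl // -Hz.
have := h2 k; rewrite !subr0 cexp0 mul1r ek => /(_ (h3 w w3)) a1.
have := h1 w w1; rewrite -/x /q divff // => a2.
rewrite -/(q w) in a2.
have x0 := cmod_ge0 x; have kk0 := cmod_ge0 k.
have a2' : cmod (q w - 1 - D * x) <= cmod x.
  by apply: le_trans a2 _; rewrite ler_piMl // ge_min lexx.
have a2'' : cmod (q w - 1 - D * x) <= e / 2 * cmod x.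
  by apply: le_trans a2 _; rewrite ler_wpM2r // ge_min lexx orbT.
have b1 : cmod (q w - 1) <= k0 * cmod x.
  rewrite -(subrK (D * x) (q w - 1)); apply: le_trans (cmodD _ _) _.
  by rewrite cmodM /k0 mulrDl mul1r lerD2r.
have b2 : cmod k <= 2 * k0 * cmod x.
  have := cmodB_ge k (q w - 1); rewrite cmodBC => b.
  have b3 : e1 * cmod k <= 1 / 2 * cmod k by rewrite ler_wpM2r.
  by rewrite -mulrA; lra.
have -> : k - D * x = (q w - 1 - D * x) - (q w - 1 - k) by ring.
apply: le_trans (cmodB_le _ _) _; apply: le_trans (lerD a2'' a1) _.
have : e1 * cmod k <= e1 * (2 * k0 * cmod x) by rewrite ler_pM2l.
have : e1 * (2 * k0) * cmod x <= e / 2 * cmod x by rewrite ler_wpM2r.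
by rewrite mulrA; lra.
Qed.

Lemma log_on_disc (H : C -> C) z (rho : R) : 0 < rho ->
  (forall w, cmod (w - z) < rho -> exists D, cder H w D) ->
  (forall w, cmod (w - z) < rho -> H w != 0) ->
  exists l : C -> C, forall w, cmod (w - z) < rho / 4 ->
    cexp (l w) = H w /\ exists D, cder l w D.
Proof.
(* The square of half side [s] about [z] contains the disc of radius [s] and stays within distance
   [2 * s] of [z], inside the disc of radius [rho]. *)
move=> rho0 hH Hn0; pose s := rho / 4.
have s0 : 0 < s by rewrite /s; lra.
pose K : set (R * R) := `[- s, s] `*` `[- s, s].
have KE x : K x <-> `|x.1| <= s /\ `|x.2| <= s.
  by rewrite /K /= !in_itv /= -!ler_norml.
pose j (x : R * R) : C := z + (x.1 +i* x.2).
have jK x : K x -> cmod (j x - z) < rho.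
  move=> /KE[h1 h2]; rewrite /j addrAC subrr add0r; apply: le_lt_trans (cmod_ReIm _) _.
  by rewrite /=; move: h1 h2; rewrite /s; lra.
have cj : {within K, continuous (fun x => H (j x))}.
  apply/subspace_continuousP => x Kx; apply: cvg_within_filter.
  have [D hD] := hH _ (jK x Kx).
  apply: (@cvg_comp _ _ _ j H); last by apply/ccontP; exact: cder_cont hD.
  apply: cvgD; first exact: cvg_cst.
  by apply: (@cvg_complex _ _ (nbhs_filter x)); [exact: fst_cvg|exact: snd_cvg].
have [||t x t01 /KE[h1 h2]|x /KE //|x Kx|l cl hl] := @star_lift K (fun x => H (j x)) s _ _ _ _ cj.
- by apply: compact_setX; exact: segment_compact.
- by apply/KE; rewrite /= normr0 ltW.
- case/andP: t01 => t0 t1.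
  by apply/KE; rewrite /= !normrM (ger0_norm t0); split; [apply: le_trans h1|apply: le_trans h2]; rewrite ler_piMl.
- by apply: Hn0; exact: jK.
pose l' w := l (complex.Re (w - z), complex.Im (w - z)).
have Ks w : cmod (w - z) < s -> K (complex.Re (w - z), complex.Im (w - z)).
  move=> hw; apply/KE => /=.
  by split; apply: le_trans (ltW hw); [exact: cmod_Re|exact: cmod_Im].
have hl' w : cmod (w - z) < s -> cexp (l' w) = H w.
  move=> hw; rewrite /l' hl; last exact: Ks.
  by rewrite /j /= -[_ +i* _](_ : w - z = _) ?subrKC //; case: (w - z).
exists l' => w hw; split; first exact: hl'.
have [D hD] := hH w (ltac:(rewrite /s in s0; lra)).
exists (D / H w); apply: (@log_cder l' H w D (s - cmod (w - z))) => //.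
- by rewrite subr_gt0.
- apply/ccontP.
  have hpt : K (complex.Re (w - z), complex.Im (w - z)) := Ks w hw.
  have := proj1 (subspace_continuousP _ _) cl _ hpt => hc.
  apply: (@cvg_comp _ _ _ (fun v : C => (complex.Re (v - z), complex.Im (v - z))) l _ (within K (nbhs (complex.Re (w - z), complex.Im (w - z))))) hc.
  move=> V hV.
  have hp : (complex.Re (v - z), complex.Im (v - z)) @[v --> w] --> (complex.Re (w - z), complex.Im (w - z)).
    have hsub : {for w, continuous (fun v : C => v - z)}.
      apply/ccontP => e e0; exists e => // v.
      by have -> : v - z - (w - z) = v - w by ring.
    by apply: (@cvg_pairR _ _ (nbhs_filter w)); [apply: (@cvg_comp _ _ _ (fun v : C => v - z) (@complex.Re R) _ _ _ hsub)|
      apply: (@cvg_comp _ _ _ (fun v : C => v - z) (@complex.Im R) _ _ _ hsub)];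
      [exact: Re_continuous|exact: Im_continuous].
  have h1 : nbhs w [set v : C | K (complex.Re (v - z), complex.Im (v - z)) ->
      V (complex.Re (v - z), complex.Im (v - z))] := hp _ hV.
  have [d1 d10 hd1] := proj1 (nbhs_cmodP _ _) h1.
  apply/nbhs_cmodP; exists (Num.min d1 (s - cmod (w - z))); first by rewrite lt_min d10 subr_gt0.
  move=> v; rewrite lt_min => /andP[/hd1 k1 k2]; apply/k1/Ks.
  by have := cmod_tri v w z; lra.
- by move=> v hv; apply: hl'; have := cmod_tri v w z; lra.
Qed.

End Lifting.

(** * Logarithms on simply connected domains *)

Section SimplyConnectedLog.
Context {R : realType}.
Local Notation C := R[i].

(** A retraction onto the unit interval: composing with it trades continuity within [0, 1] for
    continuity on the whole line. *)
Definition clamp (t : R) : R := Num.max 0 (Num.min 1 t).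

Lemma clamp01 t : 0 <= clamp t <= 1.
Proof. by rewrite /clamp le_max lexx ge_max ler01 ge_min lexx. Qed.

Lemma clamp_id t : 0 <= t <= 1 -> clamp t = t.
Proof. by move=> /andP[t0 t1]; rewrite /clamp min_r // max_r. Qed.

Lemma clamp_le0 t : t <= 0 -> clamp t = 0.
Proof. by move=> t0; rewrite /clamp min_r ?(le_trans t0) // max_l. Qed.

Lemma clamp_ge1 t : 1 <= t -> clamp t = 1.
Proof. by move=> t0; rewrite /clamp min_l // max_r. Qed.

Lemma clamp_lip s t : `|clamp s - clamp t| <= `|s - t|.
Proof.
have h1 := ler_norm (s - t); have h2 := ler_norm (t - s); rewrite (distrC t s) in h2.
have cl u : [\/ u <= 0 /\ clamp u = 0, 0 <= u <= 1 /\ clamp u = u | 1 <= u /\ clamp u = 1].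
  have [u0|/ltW u0] := leP u 0; first by apply: Or31; rewrite clamp_le0.
  have [u1|/ltW u1] := leP u 1; first by apply: Or32; split; [apply/andP|apply: clamp_id; apply/andP].
  by apply: Or33; rewrite clamp_ge1.
rewrite ler_norml; case: (cl s) => -[hs ->]; case: (cl t) => -[ht ->]; apply/andP; split; lra.
Qed.

Lemma clamp_continuous : continuous clamp.
Proof.
move=> t V /nbhs_ballP[e /= e0 he]; apply/nbhs_ballP; exists e => // s hs; apply: he.
by move: hs; rewrite /ball /=; apply: le_lt_trans; exact: clamp_lip.
Qed.

Lemma within_clamp (u : R -> C) : {within `[0, 1], continuous u} <-> continuous (u \o clamp).
Proof.
split=> [/subspace_continuousP h t|h].
  have ct : `[0, 1]%classic (clamp t) by rewrite /= in_itv /= clamp01.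
  apply: (@cvg_comp _ _ _ clamp u _ (within `[0, 1] (nbhs (clamp t)))); last exact: h.
  move=> V hV; have := clamp_continuous hV; rewrite /nbhs /= => -[e e0 he].
  exists e => // s hs; apply: he => //; first by rewrite /= in_itv /= clamp01.
apply/subspace_continuousP => t; rewrite /= in_itv /= => t01.
have := h t; rewrite /continuous_at /= clamp_id // => k.
move=> V /k; rewrite /nbhs /= => -[e e0 he]; exists e => // s hs s01.
by move: s01; rewrite /= in_itv /= => s01; have := he s hs; rewrite /= clamp_id.
Qed.

(** By [cexp_eq1_small], [u] is locally constant, hence has derivative zero. *)
Lemma cexp1_path_const (u : R -> C) : continuous u -> (forall t, cexp (u t) = 1) -> u 0 = u 1.
Proof.
move=> cu hu.
have h t : pder u t 0.
  have [d d0 hd] : exists2 d : R, 0 < d & forall s, `|s - t| < d -> cmod (u s - u t) < 1.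
    have h1 : nbhs (u t) [set w : C | cmod (w - u t) < 1] by apply/nbhs_cmodP; exists 1.
    have /nbhs_ballP[d /= d0 hd] := cu t _ h1; exists d => // s hs; apply: hd.
    by rewrite /ball /= distrC.
  apply: (@gder_local _ _ _ (fun=> u t) _ _ _ d) => // [s|]; last exact: gder_const.
  rewrite -rmorphB cmod_real => /hd hs; apply/esym/eqP; rewrite -subr_eq0; apply/eqP.
  by apply: cexp_eq1_small => //; rewrite cexpB !hu divr1.
by apply: (@pder_const_on _ u (-1)) => [x _||]; rewrite ?h //; lra.
Qed.

Section Log.
Variables (U : set C) (phi : C -> C).
Hypotheses (cphi : forall z, U z -> ccont phi z) (phi0 : forall z, U z -> phi z != 0).

(** One statement serves both for paths, with a segment as [K], and for homotopies, with the unit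
    square. *)
Lemma lift_in_domain (T : R * R -> C) (K : set (R * R)) :
  compact K -> K (0, 0) -> (forall t x, 0 <= t <= 1 -> K x -> K (t * x.1, t * x.2)) ->
  (forall x, K x -> 0 <= x.1 <= 1 /\ 0 <= x.2 <= 1) ->
  {within K, continuous T} -> (forall x, K x -> U (T x)) ->
  exists2 l : R * R -> C, {within K, continuous l} & forall x, K x -> cexp (l x) = phi (T x).
Proof.
move=> cK K0 sK bK cT hT; refine (@star_lift R K (fun x => phi (T x)) 1 cK K0 sK _ _ _).
- move=> x /bK[/andP[a1 a2] /andP[b1 b2]]; by rewrite !ger0_norm.
- apply/subspace_continuousP => x Kx.
  apply: cvg_comp (proj1 (subspace_continuousP _ _) cT x Kx) _.
  by apply/ccontP/cphi/hT.
- by move=> x /hT/phi0.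
Qed.

Lemma path_lift (g : R -> C) : {within `[0, 1], continuous g} -> (forall t, 0 <= t <= 1 -> U (g t)) ->
  exists2 l : R -> C, continuous (l \o clamp) & forall t, 0 <= t <= 1 -> cexp (l t) = phi (g t).
Proof.
move=> cg gU; pose K : set (R * R) := `[0, 1] `*` [set 0].
have KE x : K x <-> 0 <= x.1 <= 1 /\ x.2 = 0 by rewrite /K /= in_itv.
have [||t x t01 /KE[a b]|x /KE[a ->]||x /KE[a b]|l cl hl] := @lift_in_domain (fun x => g x.1) K.
- by apply: compact_setX; [exact: segment_compact|exact: compact_set1].
- by apply/KE; rewrite /= lexx ler01.
- case/andP: t01 a => t0 t1 /andP[a0 a1].
  by apply/KE; rewrite /= b mulr0 mulr_ge0 // mulr_ile1.
- by rewrite lexx ler01.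
- apply/subspace_continuousP => x /KE[a b].
  have hg : g @ within `[0, 1] (nbhs x.1) --> g x.1.
    by apply: (proj1 (subspace_continuousP _ _) cg); rewrite /= in_itv.
  apply: (@cvg_comp _ _ _ fst g _ (within `[0, 1] (nbhs x.1))) hg => V hV.
  have := @fst_cvg R x _ hV; rewrite /within /nbhs /= => -[D hD hDV].
  exists D => // y Dy /KE[y1 _]; apply: (hDV y Dy); by rewrite /= in_itv.
- exact: gU.
exists (fun t => l (t, 0)); last by move=> t t01; rewrite hl //; apply/KE.
move=> t; have Kt : K (clamp t, 0) by apply/KE; rewrite clamp01.
apply: (@cvg_comp _ _ _ (fun s => (clamp s, 0)) l _ (within K (nbhs (clamp t, 0)))); last first.
  exact: (proj1 (subspace_continuousP _ _) cl).
move=> V hV.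
have : nbhs t [set s | K (clamp s, 0) -> V (clamp s, 0)].
  exact: (@cvg_pairR R _ _ (nbhs_filter t) clamp (fun=> 0) (clamp t) 0 (@clamp_continuous t) (cvg_cst 0)) _ hV.
move=> /nbhs_ballP[e /= e0 he]; apply/nbhs_ballP; exists e => // s /he; apply.
by apply/KE; rewrite clamp01.
Qed.

(** Monodromy. A lift [L] of the homotopy is constant on the three sides of the square that [H]
    sends to [x], so it agrees at the two ends of the fourth side. There [L] and [l] lift the same
    path and differ by a constant. *)
Lemma null_homotopic_lift (x : C) (g : R -> C) (l : R -> C) : null_homotopic U x g ->
  continuous (l \o clamp) -> (forall t, 0 <= t <= 1 -> cexp (l t) = phi (g t)) -> l 0 = l 1.
Proof.
move=> [H [cH HU H01 Hs]] cl hl.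
pose K : set (R * R) := `[0, 1] `*` `[0, 1].
have KE y : K y <-> 0 <= y.1 <= 1 /\ 0 <= y.2 <= 1 by rewrite /K /= !in_itv.
have [||t y t01 /KE[a b]|y /KE //||y Ky|L cL hL] := @lift_in_domain H K.
- by apply: compact_setX; exact: segment_compact.
- by apply/KE; rewrite /= lexx ler01.
- case/andP: t01 a b => t0 t1 /andP[a0 a1] /andP[b0 b1].
  by apply/KE; rewrite /= !mulr_ge0 // !mulr_ile1.
- exact: cH.
- by apply: HU; exists y.
have cLe (p : R -> R * R) : (forall s, K (p s)) -> continuous p -> continuous (L \o p).
  move=> Kp cp t.
  apply: (@cvg_comp _ _ _ p L _ (within K (nbhs (p t)))); last exact: (proj1 (subspace_continuousP _ _) cL).
  move=> V hV; have : nbhs t [set s | K (p s) -> V (p s)] := cp t _ hV.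
  by move=> /nbhs_ballP[e /= e0 he]; apply/nbhs_ballP; exists e => // s /he; apply.
have cpr : continuous (fun s => (1 : R, clamp s)).
  by move=> t; apply: (@cvg_pairR R _ _ (nbhs_filter t)); [exact: cvg_cst|exact: clamp_continuous].
have cpl : continuous (fun s => (0 : R, clamp s)).
  by move=> t; apply: (@cvg_pairR R _ _ (nbhs_filter t)); [exact: cvg_cst|exact: clamp_continuous].
have cpb : continuous (fun s => (clamp s, 0 : R)).
  by move=> t; apply: (@cvg_pairR R _ _ (nbhs_filter t)); [exact: clamp_continuous|exact: cvg_cst].
have cpt : continuous (fun s => (clamp s, 1 : R)).
  by move=> t; apply: (@cvg_pairR R _ _ (nbhs_filter t)); [exact: clamp_continuous|exact: cvg_cst].
have zero01 : 0 <= (0 : R) <= 1 by rewrite lexx ler01.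
have o01 : 0 <= (1 : R) <= 1 by rewrite lexx ler01.
have Kr s : K (1, clamp s) by apply/KE; rewrite clamp01.
have Kl s : K (0, clamp s) by apply/KE; rewrite clamp01.
have Kb s : K (clamp s, 0) by apply/KE; rewrite clamp01.
have Kt s : K (clamp s, 1) by apply/KE; rewrite clamp01.
have c0 : clamp 0 = 0 by rewrite clamp_id.
have c1 : clamp 1 = 1 by rewrite clamp_id.
have edge (p : R -> R * R) : (forall s, K (p s)) -> continuous p -> (forall s, H (p s) = x) ->
    L (p 0) = L (p 1).
  move=> Kp cp Hp; have := @cexp1_path_const (fun s => L (p s) - L (p 0)) _ _.
  move=> /(_ _ _)/eqP; rewrite subrr eq_sym subr_eq0 => h; apply/esym/eqP/h.
    move=> t; apply: cvgB; last exact: cvg_cst.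
    exact: cLe.
  have Ux : U x by rewrite -(Hp 0); apply: HU; exists (p 0) => //; exact: Kp.
  by move=> s; rewrite cexpB !hL // !Hp divff // phi0.
have er := edge _ Kr cpr (fun s => (H01 (clamp s) (clamp01 s)).2).
have eb := edge _ Kb cpb (fun s => (Hs (clamp s) (clamp01 s)).1).
have et := edge _ Kt cpt (fun s => (Hs (clamp s) (clamp01 s)).2).
rewrite /= !c0 !c1 in er eb et.
have := @cexp1_path_const (fun s => l (clamp s) - L (0, clamp s)) _ _.
rewrite c0 c1 => /(_ _ _) h.
have {}h : l 0 - L (0, 0) = l 1 - L (0, 1).
  apply: h => s; last first.
    rewrite cexpB hl ?clamp01 // hL // (H01 _ (clamp01 s)).1 divff // phi0 //.
    by rewrite -(H01 _ (clamp01 s)).1; apply: HU; exists (0, clamp s) => //; exact: Kl.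
  by apply: cvgB; [exact: cl|exact: (cLe _ Kl cpl s)].
by move: h; rewrite eb er -et => /addIr.
Qed.

Hypothesis scU : simply_connected U.
Hypothesis oU : forall z, U z -> exists2 r : R, 0 < r & forall w, cmod (w - z) < r -> U w.

(** [h y] is the end value of a lift along a chosen path from [x0] to [y]. The paths to [y] and to a
    nearby [y'], joined by the segment between them, form a loop whose lift closes up; thus [h] near
    [y] is [h y] plus a principal logarithm, which is continuous. *)
Lemma simply_connected_log : exists h : C -> C,
  forall z, U z -> cexp (h z) = phi z /\ ccont h z.
Proof.
have [[x0 Ux0]|nU] := pselect (exists x, U x); last first.
  by exists id => z Uz; case: nU; exists z.
have [ze [hze _ _]] := cexp_polar (phi0 Ux0).
have o01 : 0 <= (1 : R) <= 1 by rewrite lexx ler01.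
have z01 : 0 <= (0 : R) <= 1 by rewrite lexx ler01.
have pathy y : exists gl : (R -> C) * (R -> C), U y ->
   [/\ path_in U x0 y gl.1, continuous (gl.2 \o clamp), forall t, 0 <= t <= 1 -> cexp (gl.2 t) = phi (gl.1 t)
     & gl.2 0 = ze].
  have [Uy|nUy] := pselect (U y); last by exists (fun=> 0, fun=> 0).
  have [g [cg gU g0 g1]] := scU.1 x0 y Ux0 Uy.
  have gU' t : 0 <= t <= 1 -> U (g t) by move=> t01; apply: gU; exists t => //; rewrite /= in_itv.
  have [l cl hl] := path_lift cg gU'.
  pose l2 (t : R) : C := l t - l 0 + ze.
  have cl2 : continuous (l2 \o clamp).
    move=> t; apply: cvgD; last exact: cvg_cst.
    by apply: cvgB; [exact: cl|exact: cvg_cst].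
  have hl2 t : 0 <= t <= 1 -> cexp (l2 t) = phi (g t).
    by move=> t01; rewrite /l2 cexpD cexpB (hl t t01) (hl 0 z01) g0 hze divfK // phi0.
  have l20 : l2 0 = ze by rewrite /l2 subrr add0r.
  by exists (g, l2) => _; exact: (And4 (And4 cg gU g0 g1) cl2 hl2 l20).
have [gl hgl] := choice pathy.
pose h y := (gl y).2 1.
have hh y : U y -> cexp (h y) = phi y.
  by move=> /hgl[[_ _ _ g1] _ hl _]; rewrite /h hl // g1.
exists h => y Uy; split; first exact: hh.
have [[cg gU g0 g1] cl hl l0] := hgl y Uy.
set g := (gl y).1 in cg gU g0 g1 hl; set l := (gl y).2 in cl hl l0.
have phiy0 : 0 < cmod (phi y) by rewrite cmod_gt0 phi0.
have [r1 r10 hr1] := oU Uy.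
have [r2 r20 hr2] := cphi Uy phiy0.
have key y' : cmod (y' - y) < Num.min r1 r2 -> h y' = h y + clog (phi y' / phi y).
  rewrite lt_min => /andP[hy1 hy2].
  have Uy' := hr1 y' hy1.
  have [[cg' gU' g0' g1'] cl' hl' l0'] := hgl y' Uy'.
  set g' := (gl y').1 in cg' gU' g0' g1' hl'; set l' := (gl y').2 in cl' hl' l0'.
  pose seg (t : R) : C := y + t%:C * (y' - y).
  have segr t : 0 <= t <= 1 -> cmod (seg t - y) <= cmod (y' - y).
    move=> /andP[t0 t1]; rewrite /seg addrAC subrr add0r cmodM cmod_real ger0_norm //.
    by rewrite ler_piMl ?cmod_ge0.
  have segU t : 0 <= t <= 1 -> U (seg t) by move=> /segr k; apply: hr1; exact: le_lt_trans hy1.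
  have segp t : 0 <= t <= 1 -> 0 < complex.Re (phi (seg t) / phi y).
    by move=> /segr k; apply: Re_quot_gt0; apply: hr2; exact: le_lt_trans hy2.
  pose s (t : R) : C := h y + clog (phi (seg t) / phi y).
  have seg0 : seg 0 = y by rewrite /seg rmorph0 mul0r addr0.
  have seg1 : seg 1 = y' by rewrite /seg rmorph1 mul1r subrKC.
  have cseg : continuous seg.
    move=> t; apply: cvgD; first exact: cvg_cst.
    apply: cvgM; last exact: cvg_cst.
    apply: (@cvg_complex R _ _ (nbhs_filter t) id (fun=> 0)); [exact: cvg_id|exact: cvg_cst].
  have cs : continuous (s \o clamp).
    move=> t; apply: cvgD; first exact: cvg_cst.
    apply: (@cvg_comp _ _ _ (fun t => phi (seg (clamp t)) / phi y) (@clog R)); last first.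
      by apply: clog_continuous; apply: segp; exact: clamp01.
    apply: cvgM; last exact: cvg_cst.
    apply: (@cvg_comp _ _ _ (fun t => seg (clamp t)) phi); last first.
      by apply/ccontP/cphi/segU; exact: clamp01.
    apply: (@cvg_comp _ _ _ clamp seg); first exact: clamp_continuous.
    exact: cseg.
  have hs t : 0 <= t <= 1 -> cexp (s t) = phi (seg t).
    by move=> t01; rewrite /s cexpD hh // clogK ?segp // mulrC divfK // phi0.
  (* The concatenation of three paths, and of their lifts, written as a sum of
     clamped paths so that its continuity is immediate. *)
  pose cA (t : R) := clamp (3 * t); pose cB (t : R) := clamp (3 * t - 1); pose cD (t : R) := clamp (1 - clamp (3 * t - 2)).
  pose Gam t := g (cA t) + (seg (cB t) - y) + (g' (cD t) - y').
  pose Lam t := l (cA t) + (s (cB t) - h y) + (l' (cD t) - h y').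
  have s0 : s 0 = h y by rewrite /s seg0 divff ?phi0 // clog1 addr0.
  have c3 : continuous (fun t : R => 3 * t) by move=> t; apply: cvgM; [exact: cvg_cst|exact: cvg_id].
  have ccomp (u : R -> C) (v : R -> R) : continuous (u \o clamp) -> continuous v -> continuous (fun t => u (clamp (v t))).
    by move=> cu cv t; apply: (@cvg_comp _ _ _ v (u \o clamp)); [exact: cv|exact: cu].
  have c31 : continuous (fun t : R => 3 * t - 1) by move=> t; apply: cvgB; [exact: c3|exact: cvg_cst].
  have c32 : continuous (fun t : R => 1 - clamp (3 * t - 2)).
    move=> t; apply: cvgB; first exact: cvg_cst.
    apply: (@cvg_comp _ _ _ (fun t : R => 3 * t - 2) clamp); last exact: clamp_continuous.
    by apply: cvgB; [exact: c3|exact: cvg_cst].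
  have cGam : continuous Gam.
    move=> t; apply: cvgD; last first.
      apply: cvgB; last exact: cvg_cst.
      by apply: (ccomp g' _ _ c32 t); apply/within_clamp.
    apply: cvgD; first by apply: (ccomp g _ _ c3 t); apply/within_clamp.
    apply: cvgB; last exact: cvg_cst.
    apply: (ccomp seg _ _ c31 t) => u.
    by apply: (@cvg_comp _ _ _ clamp seg); [exact: clamp_continuous|exact: cseg].
  have cLam : continuous Lam.
    move=> t; apply: cvgD; last first.
      apply: cvgB; last exact: cvg_cst.
      exact: (ccomp l' _ cl' c32 t).
    apply: cvgD; first exact: (ccomp l _ cl c3 t).
    apply: cvgB; last exact: cvg_cst.
    exact: (ccomp s _ cs c31 t).
  have g1y : g 1 = y by [].
  have k0 : clamp 0 = 0 by apply: clamp_le0.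
  have k1 : clamp 1 = 1 by apply: clamp_ge1.
  have kN1 : clamp (-1) = 0 by apply: clamp_le0; lra.
  have kN2 : clamp (-2) = 0 by apply: clamp_le0; lra.
  have k3 : clamp 3 = 1 by apply: clamp_ge1; lra.
  have k2 : clamp (3 - 1) = 1 by apply: clamp_ge1; lra.
  have k1' : clamp (3 - 2) = 1 by apply: clamp_ge1; lra.
  have thirds t : 0 <= t <= 1 -> U (Gam t) /\ cexp (Lam t) = phi (Gam t).
    move=> /andP[t0 t1]; rewrite /Gam /Lam /cA /cB /cD.
    have [t3|t3] := leP t (1 / 3).
      have -> : clamp (3 * t - 1) = 0 by apply: clamp_le0; lra.
      have -> : clamp (3 * t - 2) = 0 by apply: clamp_le0; lra.
      rewrite subr0 k1 seg0 g1' s0 -/(h y') !subrr !addr0; split; last by rewrite hl ?clamp01.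
      by apply: gU; exists (clamp (3 * t)) => //; rewrite /= in_itv /= clamp01.
    have -> : clamp (3 * t) = 1 by apply: clamp_ge1; lra.
    rewrite g1y -/(h y) !subrKC.
    have [t2|t2] := leP t (2 / 3).
      have -> : clamp (3 * t - 2) = 0 by apply: clamp_le0; lra.
      rewrite subr0 k1 g1' -/(h y') !subrr !addr0; split; last by rewrite hs ?clamp01.
      exact: segU (clamp01 _).
    have -> : clamp (3 * t - 1) = 1 by apply: clamp_ge1; lra.
    rewrite seg1 subrKC; set v := clamp (1 - _); have v01 : 0 <= v <= 1 := clamp01 _.
    split; first by apply: gU'; exists v => //; rewrite /= in_itv.
    by rewrite cexpD cexpB hs // hl' // hh // seg1 mulrC divfK // phi0.
  have Gam0 : Gam 0 = x0.
    rewrite /Gam /cA /cB /cD mulr0 !sub0r.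
    by rewrite k0 kN1 kN2 subr0 k1 g0 seg0 g1' !subrr !addr0.
  have Gam1 : Gam 1 = x0.
    rewrite /Gam /cA /cB /cD mulr1.
    rewrite k3 k2 k1' (subrr (1 : R)) k0.
    by rewrite g1y seg1 g0' subrKC addrC subrK.
  have Gloop : path_in U x0 x0 Gam.
    clearbody Gam; have cG : {within `[0, 1], continuous Gam}.
      apply/within_clamp => t.
      by apply: (@cvg_comp _ _ _ clamp Gam); [exact: clamp_continuous|exact: cGam].
    have GU : Gam @` `[0, 1] `<=` U.
      by move=> _ [t t01 <-]; apply: (thirds t _).1; move: t01; rewrite /= in_itv.
    exact: (And4 cG GU Gam0 Gam1).
  have LamC : continuous (Lam \o clamp).
    by move=> t; apply: (@cvg_comp _ _ _ clamp Lam); [exact: clamp_continuous|exact: cLam].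
  have := null_homotopic_lift (scU.2 x0 Gam Gloop) LamC (fun t t01 => (thirds t t01).2).
  rewrite /Lam /cA /cB /cD mulr0 mulr1 !sub0r.
  rewrite k0 kN1 kN2 subr0 k1 k3 k2 k1' (subrr (1 : R)) k0.
  rewrite s0 l0 l0' -/(h y) -/(h y') !subrr !addr0 subrKC => e.
  have : s 1 = h y'.
    by apply/eqP; rewrite -subr_eq0; apply/eqP; move/eqP: e; rewrite -subr_eq0 => /eqP e; rewrite -[RHS]oppr0 -e; ring.
  by rewrite /s seg1.
have cl1 : ccont (@clog R) 1 by apply/ccontP/clog_continuous; rewrite /= ltr01.
move=> e e0; have [d1 d10 hd1] := cl1 e e0.
have [d2 d20 hd2] := cphi Uy (mulr_gt0 d10 phiy0).
exists (Num.min d2 (Num.min r1 r2)); first by rewrite !lt_min d20 r10.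
move=> w; rewrite lt_min => /andP[/hd2 k1 k2].
rewrite key // addrAC subrr add0r -[clog _]subr0 -clog1; apply: hd1.
have -> : phi w / phi y - 1 = (phi w - phi y) / phi y by field; exact: phi0.
by rewrite cmodM cmodV ltr_pdivrMr.
Qed.
End Log.
End SimplyConnectedLog.

(** * Harnack's inequality and Bloch's theorem *)

Section HarnackBloch.
Context {R : realType}.
Local Notation C := R[i].
Local Notation tau := (pi *+ 2 : R).

Lemma cexp_real (x : R) : cexp x%:C = (expR x)%:C.
Proof. by rewrite cexpE cos0 sin0 mulr1 mulr0. Qed.

(* For a function with nonnegative real part the first Fourier coefficient on a
   circle is at most twice the mean of the real part. *)
Lemma cder_Re_ge0 (l : C -> C) (w d : C) (r rho : R) : 0 < r -> r < rho ->
  (forall x, cmod (x - w) < rho -> exists D, cder l x D) -> cder l w d ->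
  (forall x, cmod (x - w) < rho -> 0 <= complex.Re (l x)) ->
  r * cmod d <= 2 * complex.Re (l w).
Proof.
move=> r0 rrho hl hd lge0.
have T0 := @tau_gt0 R.
have [->|dn0] := eqVneq d 0.
  by rewrite cmod0 mulr0 mulr_ge0 // lge0 // subrr cmod0 (lt_trans r0).
have [p0 hp0 p0E] := circle_mean0 r0 rrho hl.
have [p1 hp1 p1E] := circle_mean1 r0 rrho hl hd.
have [pN hpN pNE] := circle_meanN1 r0 rrho hl.
have cd : 0 < cmod d by rewrite cmod_gt0.
(* [a +i* b] is the conjugate of [d] scaled to modulus 1. Below, [g'] equals [2 * Re l] times
   [1 - (a * cos t + b * sin t)], a product of nonnegative factors. *)
pose a := complex.Re d / cmod d; pose b := - complex.Im d / cmod d.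
have ab : a ^+ 2 + b ^+ 2 = 1.
  by rewrite !expr_div_n -mulrDl sqrrN -cmod_sqr divff // expf_neq0 ?gt_eqF.
have ad : complex.Re ((a +i* b) * d) = cmod d.
  have : a * complex.Re d - b * complex.Im d = cmod d ^+ 2 / cmod d.
    by rewrite cmod_sqr /a /b; ring.
  by rewrite expr2 mulfK ?gt_eqF //; case: (d) => x y /=.
pose g t := 2 * complex.Re (p0 t) - complex.Re ((a +i* b) * p1 t) - complex.Re ((a +i* - b) * pN t).
pose x t := w + r%:C * cis t.
pose g' t := 2 * complex.Re (l (x t)) - complex.Re ((a +i* b) * (l (x t) * cis (- t)))
   - complex.Re ((a +i* - b) * (l (x t) * cis t)).
have hg (t : R) : is_derive t 1 g (g' t).
  apply: is_deriveB; last by apply: is_derive_Re; exact: gderMl (hpN t).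
  apply: is_deriveB; last by apply: is_derive_Re; exact: gderMl (hp1 t).
  apply: is_derive_eq; last by rewrite /GRing.scale.
  by have := is_derive_Re (hp0 t); exact: is_deriveZ.
have g'0 t : 0 <= g' t.
  have l0 : 0 <= complex.Re (l (x t)) by apply: lge0; rewrite /x cmod_circle // ltW.
  have cisE s : cis s = cos s +i* sin s :> C.
    by rewrite /cis (_ : 'i * s%:C = 0 +i* s) ?cexpE ?expR0 ?mul1r //; apply/eqP; rewrite eq_complex /=; apply/andP; split; apply/eqP; ring.
  have k : a * cos t + b * sin t <= 1.
    have := cos2Dsin2 t; have := sqr_ge0 (a - cos t); have := sqr_ge0 (b - sin t); nra.
  rewrite /g' !cisE cosN sinN; case: (l (x t)) l0 => u v /= u0.
  rewrite [X in _ <= X](_ : _ = 2 * u * (1 - (a * cos t + b * sin t))); last by ring.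
  by rewrite mulr_ge0 ?subr_ge0 //; lra.
have := pder_ge0_le (ltW T0) (fun t _ => hg t) (fun t _ => g'0 t).
rewrite -subr_ge0 /g.
have e0 : complex.Re (p0 tau) - complex.Re (p0 0) = complex.Re (l w) * tau.
  by rewrite -raddfB p0E /=; case: (l w) => u v /=; ring.
have e1 : complex.Re ((a +i* b) * p1 tau) - complex.Re ((a +i* b) * p1 0) = r * cmod d * tau.
  rewrite -raddfB -mulrBr p1E -ad; case: (d) => u v /=; ring.
have eN : complex.Re ((a +i* - b) * pN tau) - complex.Re ((a +i* - b) * pN 0) = 0.
  by rewrite -raddfB -mulrBr pNE mulr0.
move=> h; have : 0 <= (2 * complex.Re (l w) - r * cmod d) * tau by lra.
by rewrite pmulr_lge0 // subr_ge0.
Qed.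

Lemma harnack (H : C -> C) z (rho : R) : 0 < rho ->
  (forall w, cmod (w - z) < rho -> exists D, cder H w D) ->
  (forall w, cmod (w - z) < rho -> 1 <= cmod (H w)) ->
  forall w w', cmod (w - z) < rho / 16 -> cmod (w' - z) < rho / 16 ->
    ln (cmod (H w')) <= expR 4 * ln (cmod (H w)).
Proof.
move=> rho0 hH H1 w w' hw hw'.
have [|l hl] := log_on_disc rho0 hH.
  by move=> x /H1; rewrite -cmod_gt0; apply: lt_le_trans.
have hRe x : cmod (x - z) < rho / 4 -> complex.Re (l x) = ln (cmod (H x)).
  by move=> /hl[<- _]; rewrite cmod_cexp expRK.
have hge0 x : cmod (x - z) < rho / 4 -> 0 <= complex.Re (l x).
  by move=> hx; rewrite hRe // ln_ge0 // H1 //; lra.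
rewrite -!hRe; try lra.
have seg t : 0 <= t <= 1 -> cmod (w + t%:C * (w' - w) - z) < rho / 16.
  by move=> t01; exact: ball_segment.
have dl x : exists D, cmod (x - z) < rho / 16 -> cder l x D.
  have [hx|hx] := ltP (cmod (x - z)) (rho / 16); last by exists 0.
  by have [_ [D hD]] := hl x (ltac:(lra)); exists D.
have [l' hl'] := choice dl.
have bound x : cmod (x - z) < rho / 16 -> rho / 16 * cmod (l' x) <= 2 * complex.Re (l x).
  move=> hx; apply: (@cder_Re_ge0 l x (l' x) (rho / 16) (rho / 8)); try lra.
  - by move=> y hy; apply: (hl y _).2; have := cmod_tri y x z; lra.
  - exact: hl'.
  - by move=> y hy; apply: hge0; have := cmod_tri y x z; lra.
(* Gronwall: [|u'| <= 4 u] along the segment, where [u = Re l]. *)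
pose q (t : R) := - complex.Re (l (w + t%:C * (w' - w)) * cexp ((-4)%:C * t%:C)).
pose v := w' - w.
(* The segment is at most twice [rho / 16] long, and [bound] gives
   [cmod l' <= 2 * Re l / (rho / 16)]: hence the constant 4. *)
have vb : cmod v <= rho / 8 by have := cmod_tri w' z w; rewrite (cmodBC z); rewrite /v; lra.
pose q' (t : R) := - complex.Re ((l' (w + t%:C * v) * v) * cexp ((-4)%:C * t%:C) +
   l (w + t%:C * v) * (cexp ((-4)%:C * t%:C) * (-4)%:C)).
have hq (t : R) : 0 <= t <= 1 -> is_derive t 1 q (q' t).
  move=> t01; apply: is_deriveN; apply: is_derive_Re.
  apply: gderM; first by apply: pder_line; apply: hl'; exact: seg.
  have h1 : pder (fun s : R => (-4)%:C * s%:C) t (-4)%:C.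
    by apply: gder_eqd (gderMl (-4)%:C (gder_i t)); rewrite mulr1.
  exact: gder_comp h1 (cder_cexp _).
have q'0 t : 0 <= t <= 1 -> 0 <= q' t.
  move=> t01; rewrite /q' -rmorphM cexp_real; set E := expR _.
  have E0 : 0 < E by exact: expR_gt0.
  have -> : l' (w + t%:C * v) * v * E%:C + l (w + t%:C * v) * (E%:C * (-4)%:C) =
     (l' (w + t%:C * v) * v - 4%:C * l (w + t%:C * v)) * E%:C by rewrite rmorphN; ring.
  rewrite oppr_ge0 (_ : complex.Re (_ * E%:C) = complex.Re (l' (w + t%:C * v) * v - 4%:C * l (w + t%:C * v)) * E); last first.
    by case: (_ - _) => x y /=; ring.
  rewrite pmulr_lle0 // raddfB /= subr_le0.
  rewrite (_ : complex.Re (4%:C * _) = 4 * complex.Re (l (w + t%:C * v))); last by case: (l _) => x y /=; ring.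
  apply: le_trans (ler_norm _) _; apply: le_trans (cmod_Re _) _; rewrite cmodM.
  have h1 := bound _ (seg t t01); have h2 : cmod (l' (w + t%:C * v)) * cmod v <= cmod (l' (w + t%:C * v)) * (rho / 8).
    by rewrite ler_wpM2l ?cmod_ge0.
  by rewrite -/v in h1; lra.
have := pder_ge0_le ler01 hq q'0.
rewrite /q rmorph0 rmorph1 mul0r addr0 mul1r subrKC mulr0 mulr1 cexp0 mulr1 cexp_real lerN2.
rewrite (_ : complex.Re (_ * _) = complex.Re (l w') * expR (- 4)); last by case: (l w') => x y /=; ring.
by rewrite expRN ler_pdivrMr ?expR_gt0 // mulrC.
Qed.

(* Bloch's theorem, applied at a maximum point of [(rho - |w - p|) |h' w|]. *)
Lemma bloch (h h' : C -> C) p (rho rho' : R) : 0 < rho -> rho < rho' ->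
  (forall w, cmod (w - p) < rho' -> cder h w (h' w)) ->
  384 < rho * cmod (h' p) ->
  exists c, forall w, cmod (w - c) < 6 -> exists2 z, cmod (z - p) < rho & h z = w.
Proof.
move=> rho0 rr hh hbig.
have hE w : cmod (w - p) < rho' -> exists D, cder h w D by move=> /hh ?; exists (h' w).
have ch' w : cmod (w - p) < rho' -> ccont h' w.
  move=> hw; have [||D hD] := @cder_der _ h h' w (rho' - cmod (w - p)).
  - by rewrite subr_gt0.
  - by move=> x hx; apply: hh; have := cmod_tri x w p; lra.
  exact: cder_cont hD.
have Dc := @cclosed_disc R.
have [|||w Kw e e0|a Ka ha] := @max_attained _ [set w | cmod (w - p) <= rho]
    (fun w => (rho - cmod (w - p)) * cmod (h' w)) (rho + cmod p).
- by exists p; rewrite /= subrr cmod0 ltW.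
- exact: Dc.
- by move=> w /= hw; have := cmodB_ge w p; lra.
- have hw : cmod (w - p) < rho' by move: Kw => /=; lra.
  have hA : forall e : R, 0 < e -> exists2 del : R, 0 < del & forall y, cmod (y - w) < del ->
       cmod ((rho - cmod (y - p))%:C - (rho - cmod (w - p))%:C) < e.
    move=> e1 e10; exists e1 => // y hy; rewrite -rmorphB cmod_real.
    have -> : rho - cmod (y - p) - (rho - cmod (w - p)) = cmod (w - p) - cmod (y - p) by ring.
    apply: le_lt_trans (cmod_dist _ _) _; rewrite cmodBC.
    by have -> : y - p - (w - p) = y - w by ring.
  have [del del0 hdel] := @gcontM _ C id _ h' w hA (ch' w hw) e e0.
  exists del => // y Ky hy; have := hdel y hy => hlt.
  have absE x : cmod (x - p) <= rho ->
      (rho - cmod (x - p)) * cmod (h' x) = cmod ((rho - cmod (x - p))%:C * h' x).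
    by move=> hx; rewrite cmodM cmod_real ger0_norm ?subr_ge0.
  by rewrite !absE //; apply: le_lt_trans hlt; exact: cmod_dist.
have a1 : cmod (a - p) <= rho := Ka.
pose t := (rho - cmod (a - p)) / 2; pose m := cmod (h' a).
have t2 : rho - cmod (a - p) = 2 * t by rewrite /t; field.
(* Half of 384. On the circle of radius [t / 8] about [a] the values will keep a distance of at
   least [t * m / 16 > 12] from [h a], twice the radius 6 to be covered. *)
have tm : 192 < t * m.
  have := ha p; rewrite /= subrr cmod0 subr0 t2 => /(_ (ltW rho0)).
  by rewrite -mulrA -/m; lra.
have t0 : 0 < t.
  have : 0 <= t by rewrite /t; lra.
  by rewrite le_eqVlt => /orP[/eqP t00|//]; move: tm; rewrite -t00 mul0r ltrn0.
have m0 : 0 < m by rewrite -(pmulr_rgt0 _ t0); lra.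
have bd z : cmod (z - a) <= t -> cmod (z - p) < rho /\ cmod (h' z) <= 2 * m.
  move=> hz; have k := cmod_tri z a p.
  have hzr : t <= rho - cmod (z - p) by lra.
  split; first by lra.
  have := ha z; rewrite /= t2 -/m => /(_ (ltac:(lra))) k2.
  rewrite -(ler_pM2l t0); apply: le_trans (_ : (rho - cmod (z - p)) * cmod (h' z) <= _); last by rewrite mulrCA mulrA.
  by rewrite ler_wpM2r ?cmod_ge0.
have t20 : 0 < t / 2 by lra.
have lip z : cmod (z - a) < t / 2 -> t / 2 * cmod (h' z - h' a) <= 2 * m * cmod (z - a).
  move=> hz; have sub y x : cmod (y - a) < t / 2 -> cmod (x - y) < t -> cmod (x - p) < rho'.
    move=> h1 h2; have k1 := cmod_tri x y p; have k2 := cmod_tri y a p; lra.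
  apply: (@cauchy_diff _ h z a (h' z) (h' a) (t / 2) t); try lra.
  - by move=> x hx; apply: hE; exact: sub hz hx.
  - by move=> x hx; apply: hE; apply: sub hx; rewrite subrr cmod0.
  - by apply: hh; have := bd z (ltac:(lra)); lra.
  - by apply: hh; lra.
  move=> s; have -> : cmod (z - a) = cmod (z + (t / 2)%:C * cis s - (a + (t / 2)%:C * cis s)).
    by congr cmod; ring.
  have c1 : cmod (z + (t / 2)%:C * cis s - a) < t.
    by have := cmod_circle z s (ltW t20); have := cmod_tri (z + (t / 2)%:C * cis s) z a; lra.
  have c2 : cmod (a + (t / 2)%:C * cis s - a) < t by rewrite cmod_circle; lra.
  apply: (@cder_lipschitz _ h h') => u hu; have k := ball_segment hu c2 c1.
    by apply: hh; have := bd _ (ltW k); lra.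
  by have [] := bd _ (ltW k).
have half z : cmod (z - a) <= t / 8 -> cmod (h' z - h' a) <= m / 2.
  move=> hz; have := lip z (ltac:(lra)) => k.
  rewrite -(ler_pM2l t20); apply: le_trans k _.
  have : m * cmod (z - a) <= m * (t / 8) by rewrite ler_pM2l.
  lra.
have t8 : t / 8 <= t by lra.
have lower z : cmod (z - a) <= t / 8 -> m / 2 * cmod (z - a) <= cmod (h z - h a).
  move=> hz.
  have := @cder_lipschitz _ (fun x => h x - h' a * x) (fun x => h' x - h' a * 1) a z (m / 2).
  have seg (s : R) : 0 <= s <= 1 -> cmod (a + s%:C * (z - a) - a) <= t / 8.
    move=> /andP[s0 s1]; rewrite addrAC subrr add0r cmodM cmod_real ger0_norm //.
    by apply: le_trans hz; rewrite ler_piMl ?cmod_ge0.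
  have hd (s : R) : 0 <= s <= 1 -> cder (fun x => h x - h' a * x) (a + s%:C * (z - a)) (h' (a + s%:C * (z - a)) - h' a * 1).
    move=> /seg hs; apply: gderB; last by apply: gderMl; exact: gder_i.
    by apply: hh; have := bd _ (le_trans hs t8); lra.
  move=> /(_ hd) k.
  have {}k : cmod (h z - h' a * z - (h a - h' a * a)) <= m / 2 * cmod (z - a).
    by apply: k => s hs; rewrite mulr1; apply: half; exact: seg.
  have e : h' a * (z - a) = (h z - h a) - (h z - h' a * z - (h a - h' a * a)) by ring.
  have := cmodB_le (h z - h a) (h z - h' a * z - (h a - h' a * a)).
  by rewrite -e cmodM -/m; lra.
(* A point [b] of the closed disc where [cmod (h b - w)] is minimal cannot lie on the circle, whose
   image is too far from [h a]; at an interior minimum the distance must be 0. *)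
exists (h a) => w hw.
have [|||x Kx e e0|b Kb hb] := @max_attained _ [set z | cmod (z - a) <= t / 8]
    (fun z => - cmod (h z - w)) (t / 8 + cmod a).
- by exists a; rewrite /= subrr cmod0; lra.
- exact: Dc.
- by move=> x /= hx; have := cmodB_ge x a; lra.
- have hx : cmod (x - p) < rho' by have := bd x (le_trans Kx t8); lra.
  have [del del0 hdel] := cder_cont (hh x hx) e0.
  exists del => // y _ /hdel hy; rewrite -opprD normrN.
  apply: le_lt_trans (cmod_dist _ _) _.
  by have -> : h y - w - (h x - w) = h y - h x by ring.
have Kb' : cmod (b - a) <= t / 8 := Kb.
have hba : cmod (h b - w) <= cmod (h a - w).
  by have := hb a; rewrite lerN2; apply; rewrite /= subrr cmod0; lra.
have hwa : cmod (h a - w) < 6 by rewrite cmodBC.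
have bint : cmod (b - a) < t / 8.
  rewrite lt_def Kb' andbT; apply/eqP => e.
  have := lower b Kb'; rewrite -e => k.
  have := cmod_tri (h b) w (h a); rewrite (cmodBC w).
  have : m / 2 * (t / 8) = t * m / 16 by field.
  lra.
exists b; first by have := bd b (le_trans Kb' t8); lra.
apply/eqP; rewrite -subr_eq0 -cmod_eq0 eq_le cmod_ge0 andbT leNgt; apply/negP => del0.
set D := h b - w in del0 hba.
have hb0 : h' b != 0.
  rewrite -cmod_gt0; have := half b Kb'; have := cmodB_ge (h' a) (h' b); rewrite cmodBC -/m.
  by lra.
(* A Newton step: moving from [b] by [s * xi] multiplies [D] by [1 - s] up to an error of at most
   [s * cmod D / 2], which would lower the minimum. *)
pose xi := - D / h' b.
have xi0 : 0 < cmod xi by rewrite cmodM cmodN cmodV divr_gt0 // cmod_gt0.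
have e0 : 0 < cmod D / 2 / cmod xi by rewrite !divr_gt0.
have [d d0 hd] := hh b (ltac:(have := bd b (le_trans Kb' t8); lra)) _ e0.
have [s [s0 s1 sd st]] : exists s : R, [/\ 0 < s, s <= 1, s * cmod xi < d & s * cmod xi <= t / 8 - cmod (b - a)].
  exists (Num.min 1 (Num.min (d / 2 / cmod xi) ((t / 8 - cmod (b - a)) / cmod xi))).
  have k1 : 0 < d / 2 / cmod xi by rewrite !divr_gt0.
  have k2 : 0 < (t / 8 - cmod (b - a)) / cmod xi by rewrite divr_gt0 // subr_gt0.
  split; first by rewrite !lt_min ltr01 k1.
  - by rewrite ge_min lexx.
  - apply: le_lt_trans (_ : d / 2 / cmod xi * cmod xi < d).
      by rewrite ler_pM2r // !ge_min lexx !orbT.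
    by rewrite divfK ?gt_eqF //; lra.
  - apply: le_trans (_ : (t / 8 - cmod (b - a)) / cmod xi * cmod xi <= _).
      by rewrite ler_pM2r // !ge_min lexx !orbT.
    by rewrite divfK ?gt_eqF.
pose y := b + s%:C * xi.
have yb : y - b = s%:C * xi by rewrite /y addrAC subrr add0r.
have cyb : cmod (y - b) = s * cmod xi by rewrite yb cmodM cmod_real ger0_norm // ltW.
have := hd y; rewrite cyb => /(_ sd) k.
have := hb y; rewrite /= lerN2 -/D => /(_ (ltac:(have := cmod_tri y b a; rewrite cyb; lra))).
apply/negP; rewrite -ltNge.
have -> : h y - w = (1 - s)%:C * D + (h y - h b - h' b * (y - b)).
  by rewrite yb /xi /D rmorphB rmorph1; field.
apply: le_lt_trans (cmodD _ _) _; rewrite cmodM cmod_real ger0_norm ?subr_ge0 //.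
have e1 : cmod D / 2 / cmod xi * (s * cmod xi) = s * cmod D / 2 by field; rewrite gt_eqF.
rewrite e1 in k.
have : 0 < s * cmod D by rewrite mulr_gt0.
lra.
Qed.
End HarnackBloch.

(** * Fatou components *)

Section FatouComponents.
Context {R : realType}.
Local Notation C := R[i].

Lemma connected_induct (U W : set C) : connected U -> W !=set0 -> W `<=` U ->
  (forall z, W z -> exists2 e : R, 0 < e & forall w, U w -> cmod (w - z) < e -> W w) ->
  (forall z, U z -> (forall e : R, 0 < e -> exists2 w, W w & cmod (w - z) < e) -> W z) ->
  U `<=` W.
Proof.
move=> cU W0 WU oW cW.
suff -> : W = U by [].
apply: cU => //.
  pose O := [set w : C | exists2 e : R, 0 < e & forall v, U v -> cmod (v - w) < e -> W v].
  exists O.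
    rewrite openE => w [e e0 he]; apply/nbhs_cmodP; exists (e / 2); first by rewrite divr_gt0.
    move=> v hv; exists (e / 2) => [|x Ux hx]; first by rewrite divr_gt0.
    by apply: he => //; have := cmod_tri x v w; lra.
  apply/seteqP; split => [z Wz|z [Uz [e e0 he]]]; last by apply: he; rewrite // subrr cmod0.
  by split; [exact: WU|exact: oW].
exists (closure W); first exact: closed_closure.
apply/seteqP; split => [z Wz|z [Uz hz]]; first by split; [exact: WU|exact: subset_closure].
apply: cW => // e e0.
have [w [Ww hw]] := hz [set w | cmod (w - z) < e] (proj2 (nbhs_cmodP _ _) (ex_intro2 _ _ e e0 (fun w h => h))).
by exists w.
Qed.

Lemma segment_connectedC (z w : C) : connected [set z + t%:C * (w - z) | t in `[0, 1] : set R].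
Proof.
apply: connected_continuous_connected; first exact: segment_connected.
apply/subspace_continuousP => t _; apply: cvg_within_filter.
move=> V /nbhs_cmodP[e e0 he]; apply/nbhs_ballP.
have k0 : 0 < cmod (w - z) + 1 by rewrite ltr_wpDl ?cmod_ge0.
exists (e / (cmod (w - z) + 1)) => /=; first by rewrite divr_gt0.
move=> s; rewrite /ball /= distrC => hs; apply: he.
have -> : z + s%:C * (w - z) - (z + t%:C * (w - z)) = (s - t)%:C * (w - z).
  by rewrite rmorphB; ring.
rewrite cmodM cmod_real; apply: le_lt_trans (_ : `|s - t| * (cmod (w - z) + 1) < e).
  by rewrite ler_wpM2l // lerDl.
by rewrite -ltr_pdivlMr.
Qed.

(** * Normality near escaping points and comparison of orbits *)

Section Dynamics.
Variable f : C -> C.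
Local Notation F := (fatou_set f).
Local Notation M := (max_modulus f).

Lemma fatou_open z : F z -> exists2 r : R, 0 < r & forall w, cmod (w - z) < r -> F w.
Proof.
move=> [V [oV Vz] nV].
have /nbhs_cmodP[r r0 hr] : nbhs z V by move: oV; rewrite openE => /(_ z Vz).
by exists r => // w hw; exists V => //; split => //; exact: hr.
Qed.

Lemma component_ball U z w (r : R) : fatou_component f U -> U w -> cmod (w - z) < r ->
  (forall v, cmod (v - z) < r -> F v) -> U z.
Proof.
move=> [x Fx ->] Uw hw hF.
apply: (connected_component_trans Uw).
apply: (@connected_component_max _ _ [set w + t%:C * (z - w) | t in `[0, 1] : set R]).
- by exists 0; rewrite /= ?in_itv /= ?lexx ?ler01 // rmorph0 mul0r addr0.
- move=> _ [t t01 <-]; have {}t01 : 0 <= t <= 1 by move: t01; rewrite /= in_itv.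
  apply: hF; apply: ball_segment => //.
  by rewrite subrr cmod0 (le_lt_trans _ hw) ?cmod_ge0.
- exact: segment_connectedC.
- by exists 1; rewrite /= ?in_itv /= ?lexx ?ler01 // rmorph1 mul1r subrKC.
Qed.

Lemma component_open U z : fatou_component f U -> U z ->
  exists2 r : R, 0 < r & forall w, cmod (w - z) < r -> U w.
Proof.
move=> hU Uz; have Fz : F z by move: Uz; case: hU => x _ -> h; exact: connected_component_sub h.
have [r r0 hr] := fatou_open Fz; exists (r / 2) => [|w hw]; first by rewrite divr_gt0.
apply: (@component_ball U w z (r / 2) hU Uz); first by rewrite cmodBC.
by move=> v hv; apply: hr; have := cmod_tri v w z; lra.
Qed.

Definition escaping z := forall B : R, exists N, forall n, (N <= n)%N -> B <= cmod (iter n f z).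

Lemma chordalC (a b : option C) : chordal a b = chordal b a.
Proof. by case: a b => [a|] [b|] //=; rewrite cmodBC [_ * Num.sqrt _]mulrC. Qed.

(** Since [sqrt (1 + x ^+ 2) <= 1 + x], the threshold bounds from below the chordal distance between
    the disc of radius [A] and the complement of the disc of radius [1 + A], infinity included. *)
Lemma chordal_bounded (a : C) (b : option C) (A : R) : 0 <= A -> cmod a <= A ->
  chordal (Some a) b < 2 / ((1 + A) * (2 + A)) -> exists2 c, b = Some c & cmod c <= 1 + A.
Proof.
move=> A0 aA.
have sq (x : R) : 0 <= x -> 0 < Num.sqrt (1 + x ^+ 2) /\ Num.sqrt (1 + x ^+ 2) <= 1 + x.
  move=> x0; have x2 := sqr_ge0 x; split; first by rewrite sqrtr_gt0 ltr_pwDl.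
  rewrite -(@ler_pXn2r _ 2) ?nnegrE ?sqrtr_ge0 ?addr_ge0 // sqr_sqrtr ?addr_ge0 //.
  by rewrite sqrrD expr1n; nra.
have [s0 s1] := sq _ (cmod_ge0 a).
have A1 : 0 < 1 + A by lra.
have A2 : 0 < 2 + A by lra.
case: b => [c|] /=; last first.
  rewrite ltNge => /negP[].
  rewrite ler_pdivrMr ?mulr_gt0 // mulrAC ler_pdivlMr // ler_pM2l //.
  by apply: le_trans s1 _; nra.
have [t0 t1] := sq _ (cmod_ge0 c).
move=> h; exists c => //; rewrite leNgt; apply/negP => hc; move: h; apply/negP; rewrite -leNgt.
rewrite ler_pdivrMr ?mulr_gt0 // mulrAC ler_pdivlMr ?mulr_gt0 // -!mulrA ler_pM2l //.
have d : cmod c - A <= cmod (a - c) by have := cmodB_ge c a; rewrite cmodBC; lra.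
apply: le_trans (_ : (1 + A) * (1 + cmod c) <= _).
  by rewrite ler_pM ?sqrtr_ge0 //; lra.
apply: le_trans (_ : (cmod c - A) * ((1 + A) * (2 + A)) <= _); last first.
  by rewrite ler_wpM2r // mulr_ge0 // ltW.
nra.
Qed.

Section Escape.
Hypothesis hf : holo f.

Lemma holo_iter n : holo (iter n f).
Proof.
elim: n => [|n IH] z; first by exists 1; exact: gder_i.
have [d hd] := IH z; have [d' hd'] := hf (iter n f z).
by exists (d' * d); exact: gder_comp hd hd'.
Qed.

(** Otherwise points tending to [z] have images of modulus less than 1 under iterates of growing
    index. A subsequence of these iterates converges uniformly near [z]; its limit [h] is finite at
    one of the points, which bounds a fixed iterate near [z] and in turn the limit at an escaping
    point [w]. Then the iterates of the subsequence stay bounded at [w]. *)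
Lemma fatou_near_escaping z : F z ->
  (forall e : R, 0 < e -> exists2 w, escaping w & cmod (w - z) < e) ->
  exists2 rho : R, 0 < rho & exists N, forall n w, (N <= n)%N -> cmod (w - z) < rho ->
    1 <= cmod (iter n f w).
Proof.
move=> [V [oV Vz] nV] hesc; apply: contrapT => hn.
have seqk (k : nat) : exists nv : nat * C, [/\ (k < nv.1)%N, cmod (nv.2 - z) < k.+1%:R^-1 &
    cmod (iter nv.1 f nv.2) < 1].
  apply: contrapT => hk; apply: hn; exists (k.+1%:R^-1); first by rewrite invr_gt0 ltr0n.
  exists k.+1 => n w kn hw; rewrite leNgt; apply/negP => h1; apply: hk.
  by exists (n, w).
have [nv hnv] := choice seqk.
have [k|phi hphi [h hh]] := nV (fun k => iter (nv k).1 f).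
  by exists (nv k).1 => //=; have [h _ _] := hnv k; exact: leq_ltn_trans h.
have phik k : (k <= phi k)%N.
  elim: k => [//|k IH]; apply: leq_ltn_trans IH _; exact: hphi.
have [V1 /nbhs_cmodP[d1 d10 hd1] conv] := hh z Vz.
have /nbhs_cmodP[d2 d20 hd2] : nbhs z V by move: oV; rewrite openE => /(_ z Vz).
(* The threshold for the largest bound used. Moduli pass from 1 to 2 and 3 at [v], by continuity to
   4 at [w], then to 5 for [h w] and 6 for the later iterates of [w], against 7 from escape. *)
pose e : R := 2 / ((1 + 5) * (2 + 5)).
have e0 : 0 < e by rewrite divr_gt0 // mulr_gt0 //; lra.
have small (A : R) : 0 <= A -> A <= 5 -> e <= 2 / ((1 + A) * (2 + A)).
  move=> A0 A5; have p1 : 0 < (1 + A) * (2 + A) by rewrite mulr_gt0 //; lra.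
  have p2 : 0 < (1 + 5) * (2 + 5) :> R by rewrite mulr_gt0 //; lra.
  by rewrite /e ler_pM2l // lef_pV2 ?posrE //; nra.
have [K hK] := conv e e0.
pose d := Num.min d1 d2.
have d0 : 0 < d by rewrite lt_min d10.
have hKd k w : (K <= k)%N -> cmod (w - z) < d -> chordal (Some (iter (nv (phi k)).1 f w)) (h w) < e.
  by move=> Kk; rewrite lt_min => /andP[h1 h2]; apply: hK => //; [exact: hd2|exact: hd1].
pose n0 := (nv (phi K)).1.
have [del del0 hdel] := holo_cont (holo_iter n0) z (ltac:(lra) : 0 < 1 / 2 :> R).
pose m := Num.min d del.
have m0 : 0 < m by rewrite lt_min d0.
pose j := maxn K (Num.truncn m^-1).
have hj : cmod ((nv (phi j)).2 - z) < m.
  have [_ h1 _] := hnv (phi j); apply: lt_trans h1 _.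
  rewrite -[m]invrK ltf_pV2 ?posrE ?invr_gt0 // ?ltr0n //.
  apply: lt_le_trans (truncnS_gt _) _; rewrite ler_nat ltnS.
  by apply: leq_trans (phik j); rewrite leq_maxr.
move: hj; rewrite lt_min => /andP[vd vdel].
set v := (nv (phi j)).2 in vd vdel.
have vz4 : cmod (iter n0 f z) <= 4 - 1 / 2.
  have [_ _ h1] := hnv (phi j); rewrite -/v in h1.
  have [|c hc c2] := @chordal_bounded _ (h v) 1 ler01 (ltW h1).
    by apply: lt_le_trans (hKd j v (leq_maxl _ _) vd) _; apply: small; lra.
  have := hKd K v (leqnn _) vd; rewrite hc chordalC => hk.
  have [||c' [<-] c3] := @chordal_bounded c (Some (iter n0 f v)) 2 (ltac:(lra)) _ _.
  - by lra.
  - by apply: lt_le_trans hk _; apply: small; lra.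
  have := hdel v vdel; have := cmod_tri (iter n0 f z) (iter n0 f v) 0; rewrite !subr0 cmodBC.
  lra.
have [w ew hw] := hesc m m0.
have [N hN] := ew 7.
move: hw; rewrite lt_min => /andP[wd wdel].
have w4 : cmod (iter n0 f w) <= 4.
  have := hdel w wdel; have := cmod_tri (iter n0 f w) (iter n0 f z) 0; rewrite !subr0.
  lra.
have [|c hc c5] := @chordal_bounded _ (h w) 4 (ltac:(lra)) w4.
  by apply: lt_le_trans (hKd K w (leqnn _) wd) _; apply: small; lra.
pose k := maxn K N.
have := hKd k w (leq_maxl _ _) wd; rewrite hc chordalC => hk.
have [||c' [<-] c6] := @chordal_bounded c (Some (iter (nv (phi k)).1 f w)) 5 (ltac:(lra)) _ _.
- by lra.
- by apply: lt_le_trans hk _; apply: small; lra.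
have := hN (nv (phi k)).1 (ltac:(have [h1 _ _] := hnv (phi k); apply: leq_trans (leq_maxr K N) _; exact: leq_trans (phik _) (ltnW h1))).
lra.
Qed.

Lemma fatou_comparable_near z : F z ->
  (forall e : R, 0 < e -> exists2 w, escaping w & cmod (w - z) < e) ->
  exists2 rho : R, 0 < rho & exists N, forall n w w', (N <= n)%N -> cmod (w - z) < rho ->
    cmod (w' - z) < rho ->
    1 <= cmod (iter n f w) /\ ln (cmod (iter n f w')) <= expR 4 * ln (cmod (iter n f w)).
Proof.
move=> Fz hz; have [rho rho0 [N hN]] := fatou_near_escaping Fz hz.
exists (rho / 16); first by rewrite divr_gt0.
exists N => n w w' Nn hw hw'; split; first by apply: hN => //; lra.
by apply: (@harnack _ (iter n f) z rho rho0) => // x hx; [exact: holo_iter|exact: hN].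
Qed.

Definition comparable z z' := exists2 K : R, 0 < K & exists N, forall n, (N <= n)%N ->
  [/\ 1 <= cmod (iter n f z), 1 <= cmod (iter n f z'),
      ln (cmod (iter n f z)) <= K * ln (cmod (iter n f z')) &
      ln (cmod (iter n f z')) <= K * ln (cmod (iter n f z))].

Lemma comparable_trans z z' z'' : comparable z z' -> comparable z' z'' -> comparable z z''.
Proof.
move=> [K K0 [N h]] [K' K'0 [N' h']]; exists (K * K'); first exact: mulr_gt0.
exists (maxn N N') => n; rewrite geq_max => /andP[/h[a1 a2 a3 a4] /h'[b1 b2 b3 b4]]; split => //.
  by apply: le_trans a3 _; rewrite -mulrA ler_pM2l.
by apply: le_trans b4 _; rewrite [K * K']mulrC -mulrA ler_pM2l.
Qed.

Lemma comparable_escaping z z' : comparable z z' -> escaping z -> escaping z'.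
Proof.
move=> [K K0 [N h]] ez B.
have [N' hN'] := ez (expR (K * ln (Num.max B 1))).
exists (maxn N N') => n; rewrite geq_max => /andP[/h[a1 a2 a3 a4] /hN' hn].
have B1 : 0 < Num.max B 1 by rewrite lt_max ltr01 orbT.
apply: le_trans (_ : Num.max B 1 <= _); first by rewrite le_max lexx.
have z0 : 0 < cmod (iter n f z) by lra.
have z'0 : 0 < cmod (iter n f z') by lra.
rewrite -ler_ln ?posrE // -(ler_pM2l K0); apply: le_trans a3.
by rewrite -[X in X <= _]expRK ler_ln ?posrE ?expR_gt0.
Qed.

(** Comparability with [z0] is open and closed in [U]. At a limit point [z] nothing is known about
    the orbit of [z], but nearby comparable points escape, and this is all that normality at [z]
    requires. *)
Lemma component_comparable U z0 : fatou_component f U -> U z0 -> escaping z0 ->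
  forall z, U z -> comparable z0 z.
Proof.
move=> hU Uz0 ez0.
have FU z : U z -> F z by case: hU => x _ -> h; exact: connected_component_sub h.
have cU : connected U by case: hU => x _ ->; exact: component_connected.
have c00 : comparable z0 z0.
  have [N hN] := ez0 1; exists 1 => //; exists N => n /hN h; split => //; by rewrite mul1r.
have near z w : U z -> comparable z0 w -> (forall e : R, 0 < e -> exists2 w, escaping w & cmod (w - z) < e) ->
    exists2 rho : R, 0 < rho & forall w w', cmod (w - z) < rho -> cmod (w' - z) < rho -> comparable w w'.
  move=> Uz cw hz; have [rho rho0 [N hN]] := fatou_comparable_near (FU z Uz) hz.
  exists rho => // x x' hx hx'; exists (expR 4); first exact: expR_gt0.
  exists N => n Nn; have [a1 a2] := hN n x x' Nn hx hx'; have [b1 b2] := hN n x' x Nn hx' hx.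
  by split.
suff sub : U `<=` [set z | U z /\ comparable z0 z] by move=> z /sub[].
apply: (connected_induct cU); last first.
- move=> z Uz hz; split => //.
  have [w0 [Uw0 cw0] _] := hz 1 ltr01.
  have [|rho rho0 hrho] := near z w0 Uz cw0.
    by move=> e /hz[w [Uw cw] hw]; exists w => //; exact: comparable_escaping cw ez0.
  have [w [Uw cw] hw] := hz rho rho0.
  by apply: comparable_trans cw _; apply: hrho => //; rewrite subrr cmod0.
- move=> z [Uz cz].
  have [|rho rho0 hrho] := near z z Uz cz.
    by move=> e e0; exists z; [exact: comparable_escaping cz ez0|rewrite subrr cmod0].
  exists rho => // w Uw hw; split => //; apply: comparable_trans cz _.
  by apply: hrho => //; rewrite subrr cmod0.
- by move=> z [].
- by exists z0.
Qed.
End Escape.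
End Dynamics.
End FatouComponents.

(** * Components that meet the fast escaping set: part (a), wandering, uniform escape *)

Section FastEscaping.
Context {R : realType}.
Local Notation C := R[i].
Variables (f : C -> C) (r0 : R) (L : int).
Hypotheses (hf : holo f) (ntf : ~ (exists p : {poly C}, forall z, f z = p.[z])).
Hypotheses (r00 : 0 < r0) (hM : forall r : R, r0 <= r -> r < max_modulus f r).
Local Notation M := (max_modulus f).

Lemma fast_escaping_index (i : nat) : exists n m : nat,
  [/\ (0 < n)%N, (i <= n)%N, (i <= m)%N & n%:Z + L = m%:Z].
Proof. by exists (i + absz L + 1)%N, (absz ((i + absz L + 1)%N%:Z + L)%R); split; lia. Qed.

Lemma fast_escaping_escaping z : fast_escaping f r0 L z -> escaping f z.
Proof.
move=> hz B; have [i hi] := iter_max_modulus_unbounded hf r00 hM B.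
exists (i + absz L + 1)%N => n hn.
have [m hm] : exists m : nat, n%:Z + L = m%:Z by exists (absz (n%:Z + L)%R); lia.
by apply: le_trans (hz n m (ltac:(lia)) hm); apply/ltW/hi; lia.
Qed.

(** Each lower bound concerns one iterate, which is continuous, so it passes to limits; both parts
    are thereby reduced to [U] itself. *)
Lemma fast_escaping_closed (L' : int) (U : set C) :
  U `<=` fast_escaping f r0 L' -> closure U `<=` fast_escaping f r0 L'.
Proof.
move=> hU z hz n m n0 nm; apply/ler_addgt0Pl => e e0.
have [d d0 hd] := holo_cont (holo_iter hf n) z e0.
have [w [Uw hw]] := hz [set w | cmod (w - z) < d] (proj2 (nbhs_cmodP _ _) (ex_intro2 _ _ d d0 (fun w h => h))).
have := hU w Uw n m n0 nm; have := hd w hw; have := cmodB_ge (iter n f w) (iter n f z).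
lra.
Qed.

Section Component.
Variables (U : set C) (z0 : C).
Hypotheses (hU : fatou_component f U) (Uz0 : U z0) (Az0 : fast_escaping f r0 L z0).

Let cmp z (Uz : U z) : comparable f z0 z :=
  component_comparable hf hU Uz0 (fast_escaping_escaping Az0) Uz.

Lemma component_escaping z : U z -> escaping f z.
Proof. by move=> /cmp h; exact: comparable_escaping h (fast_escaping_escaping Az0). Qed.

Lemma component_fast_escaping_pred : U `<=` fast_escaping f r0 (L - 1).
Proof.
move=> z Uz n m n0 nm; rewrite leNgt; apply/negP => hlt.
have [K K0 [N hN]] := cmp Uz.
pose Kn := (Num.truncn K).+1.
have KKn : K < Kn%:R by exact: truncnS_gt.
have [r1 r10 hr1] := max_modulus_growth hf ntf Kn.
have [i hi] := iter_max_modulus_unbounded hf r00 hM (Num.max r1 (expR 1)).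
pose k := (N + i)%N.
have hT := hi (k + m)%N (ltac:(rewrite /k; lia)).
set T := iter (k + m) M r0 in hT.
move: hT; rewrite gt_max => /andP[T1 T2].
have [a1 a2 a3 _] := hN (k + n)%N (ltac:(rewrite /k; lia)).
have b1 : cmod (iter (k + n) f z) <= T.
  by rewrite /T (iterD k m) (iterD k n); exact: (cmod_iter_le hf _ (ltW hlt)).
have b2 : M T <= cmod (iter (k + n) f z0).
  (* The index belonging to [L] is one more than that belonging to [L - 1]: this is the extra
     application of [M] that beats the power [Kn]. *)
  have nk : forall j : nat, (j + n)%N%:Z + L = (j + m).+1%:Z by clear -nm; lia.
  have := Az0 (n := (k + n)%N) (m := (k + m).+1) (ltn_addl k n0) (nk k).
  by rewrite iterS.
have T0 : 0 < T by exact: lt_trans T1.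
have lnT : 1 <= ln T by rewrite -(expRK 1) ler_ln ?posrE ?expR_gt0 // ltW.
have b3 : Kn%:R * ln T <= ln (cmod (iter (k + n) f z0)).
  rewrite mulr_natl -lnXn // ler_ln ?posrE ?exprn_gt0 //; last by lra.
  by apply: le_trans b2; apply: hr1; exact: ltW.
have b4 : K * ln (cmod (iter (k + n) f z)) <= K * ln T.
  by rewrite ler_pM2l // ler_ln ?posrE //; lra.
have : K * ln T < Kn%:R * ln T by rewrite ltr_pM2r //; lra.
lra.
Qed.

(* Otherwise [ln |f^j z0|] would grow at most geometrically. *)
Lemma component_wandering u v n m : U u -> U v -> (n < m)%N -> iter n f u = iter m f v -> False.
Proof.
move=> Uu Uv nm e.
have [K K0 [N hN]] := cmp Uu; have [K' K'0 [N' hN']] := cmp Uv.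
pose a j := ln (cmod (iter j f z0)); pose d := (m - n)%N; pose D := K' * K.
have D0 : 0 < D by exact: mulr_gt0.
have step j : (N + N' + n <= j)%N -> a (j + d)%N <= D * a j.
  move=> hj; have [_ _ _ h1] := hN j (ltac:(lia)).
  have [_ _ h2 _] := hN' (j + d)%N (ltac:(lia)).
  apply: le_trans h2 _; rewrite /D -mulrA ler_pM2l //.
  have -> : (j + d)%N = ((j - n) + m)%N by rewrite /d; lia.
  by rewrite iterD -e -iterD subnK //; lia.
clear e.
(* Along the indices [n1 + q * d] the logarithm is at least [Kn ^+ q] and at most [D ^+ q * a n1];
   with [Kn > 2 * D] this would force [2 ^+ q <= a n1] for all [q]. *)
pose Kn := (Num.truncn (2 * D)).+1.
have DKn : 2 * D < Kn%:R by exact: truncnS_gt.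
have [r1 r10 hr1] := max_modulus_growth hf ntf Kn.
have [i hi] := iter_max_modulus_unbounded hf r00 hM (Num.max r1 (expR 1)).
have [n1 [m1 [n10 in1 im1 nm1]]] := fast_escaping_index (maxn i (N + N' + n)).
have big j : Kn%:R ^+ j <= ln (iter (j + m1) M r0).
  elim: j => [|j IH].
    rewrite expr0 add0n -(expRK 1); have := hi m1 (ltac:(lia)); rewrite gt_max => /andP[_ h].
    by rewrite ler_ln ?posrE ?expR_gt0 ?(lt_trans _ h) ?expR_gt0 // ltW.
  have := hi (j + m1)%N (ltac:(lia)); rewrite gt_max => /andP[T1 T2].
  have T0 := lt_trans r10 T1.
  rewrite exprS addSn iterS; apply: le_trans (_ : Kn%:R * ln (iter (j + m1) M r0) <= _).
    by rewrite ler_wpM2l.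
  have hT := hr1 _ (ltW T1).
  rewrite mulr_natl -lnXn // ler_ln ?posrE ?exprn_gt0 //.
  by apply: lt_le_trans hT; rewrite exprn_gt0.
have up q : a (n1 + q * d)%N <= D ^+ q * a n1.
  elim: q => [|q IH]; first by rewrite mul0n addn0 expr0 mul1r.
  rewrite mulSn (_ : (n1 + (d + q * d) = n1 + q * d + d)%N); last by lia.
  have hq : (N + N' + n <= n1 + q * d)%N by clear -in1; lia.
  by apply: le_trans (step _ hq) _; rewrite exprS -mulrA ler_pM2l.
have low q : Kn%:R ^+ q <= a (n1 + q * d)%N.
  apply: le_trans (_ : Kn%:R ^+ (q * d)%N <= _).
    rewrite ler_weXn2l ?ler1n //; have : (0 < d)%N by rewrite /d subn_gt0.
    by move=> hd; rewrite leq_pmulr.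
  apply: le_trans (big _) _.
  have h := Az0 (n := (n1 + q * d)%N) (m := (q * d + m1)%N) (ltac:(lia)) (ltac:(lia)).
  have p0 : 0 < iter (q * d + m1) M r0 by apply: lt_le_trans r00 _; exact: iter_max_modulus_ge.
  by rewrite ler_ln ?posrE // (lt_le_trans p0).
have all q : 2 ^+ q <= a n1.
  rewrite -(ler_pM2r (exprn_gt0 q D0)) -exprMn.
  apply: le_trans (_ : Kn%:R ^+ q <= _); first by apply: lerXn2r; rewrite ?nnegrE; lra.
  by apply: le_trans (low q) _; rewrite mulrC; exact: up.
have := all (Num.truncn (a n1)).+1; apply/negP; rewrite -ltNge.
apply: lt_trans (truncnS_gt _) _; rewrite -natrX ltr_nat; exact: ltn_expl.
Qed.

(** Harnack's constant on a disc does not depend on the iterate, so escape of the centre carries the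
    whole disc to infinity uniformly. *)
Lemma component_escaping_uniform p : U p -> exists2 rho : R, 0 < rho &
  (forall w, cmod (w - p) < rho -> U w) /\
  forall B : R, exists N, forall n w, (N <= n)%N -> cmod (w - p) < rho -> B <= cmod (iter n f w).
Proof.
move=> Up.
have [r1 r10 hr1] := component_open hU Up.
have Fp : fatou_set f p by move: Up; case: hU => x _ -> h; exact: connected_component_sub h.
have ep := component_escaping Up.
have [|r2 r20 [N hN]] := fatou_comparable_near hf Fp.
  by move=> e e0; exists p; rewrite ?subrr ?cmod0.
exists (Num.min r1 r2); first by rewrite lt_min r10.
split=> [w|B]; first by rewrite lt_min => /andP[/hr1].
pose B' := Num.max B 1.
have B1 : 0 < B' by rewrite lt_max ltr01 orbT.
have [N' hN'] := ep (expR (expR 4 * ln B')).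
exists (maxn N N') => n w; rewrite geq_max lt_min => /andP[Nn N'n] /andP[_ hw].
have [a1 a2] := hN n w p Nn hw (ltac:(by rewrite subrr cmod0)).
have [a3 _] := hN n p p Nn (ltac:(by rewrite subrr cmod0)) (ltac:(by rewrite subrr cmod0)).
apply: le_trans (_ : B' <= _); first by rewrite le_max lexx.
rewrite -ler_ln ?posrE //; last by lra.
rewrite -(ler_pM2l (expR_gt0 4)); apply: le_trans a2.
by rewrite -[X in X <= _]expRK ler_ln ?posrE ?expR_gt0 ?hN' //; lra.
Qed.

(** A sequence of iterates may repeat its members: either some index recurs forever and gives a
    constant subsequence, or the indices tend to infinity and so do the values. *)
Lemma normal_of_uniform_escape (V : set C) : (forall B : R, exists N, forall n w, (N <= n)%N -> V w ->
    B <= cmod (iter n f w)) -> normal_family V [set iter n f | n in [set n | (0 < n)%N]].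
Proof.
move=> hV g hg.
have hn k : exists n, g k = iter n f by have [n _ h] := hg k; exists n.
have {hn} [n hn] := choice hn.
have sqge (x : R) : 0 <= x -> x <= Num.sqrt (1 + x ^+ 2).
  move=> x0; rewrite -[X in X <= _]ger0_norm // -sqrtr_sqr ler_wsqrtr // lerDr ler01 //.
have [[n0 hn0]|hinf] := pselect (exists n0, forall k, exists k', (k < k')%N /\ n k' = n0).
  have [nxt hnxt] := choice hn0.
  pose phi k := iter k nxt (nxt 0%N).
  have phin k : n (phi k) = n0 by case: k => [|k]; exact: (hnxt _).2.
  exists phi.
    apply: homo_ltn => [|k]; first exact: ltn_trans.
    by exact: (hnxt _).1.
  exists (fun z => Some (iter n0 f z)) => z Vz; exists setT; first exact: filterT.
  move=> e e0; exists 0%N => k _ w _ _; rewrite hn phin /=.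
  by rewrite subrr cmod0 mulr0 mul0r.
have large (B : nat) : exists k0, forall k, (k0 <= k)%N -> (B <= n k)%N.
  elim: B => [|B [k0 hk0]]; first by exists 0%N.
  have [k1 hk1] : exists k1, forall k, (k1 < k)%N -> n k <> B.
    apply: contrapT => hc; apply: hinf; exists B => k; apply: contrapT => hk.
    by apply: hc; exists k => k' kk' e; apply: hk; exists k'.
  exists (maxn k0 k1.+1) => k; rewrite geq_max => /andP[/hk0 h1 /hk1 h2].
  by rewrite ltn_neqAle h1 andbT; apply/eqP => e; apply: h2.
exists id => //; exists (fun=> None) => z Vz; exists setT; first exact: filterT.
move=> e e0; have [N hN] := hV (3 / e); have [k0 hk0] := large N.
exists k0 => k hk w Vw _; rewrite hn /=.
have := hN (n k) w (hk0 k hk) Vw => h.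
have c0 : 0 < cmod (iter (n k) f w) by apply: lt_le_trans h; rewrite divr_gt0.
have s := sqge _ (ltW c0).
rewrite ltr_pdivrMr; last by exact: lt_le_trans s.
move: h; rewrite ler_pdivrMr // => h.
apply: lt_le_trans (_ : e * cmod (iter (n k) f w) <= _); first by rewrite mulrC; lra.
by rewrite ler_pM2l.
Qed.

End Component.
End FastEscaping.

(** * Part (b): bounded ratios on a simply connected component *)

Section SimplyConnectedComponent.
Context {R : realType}.
Local Notation C := R[i].
Variables (f : C -> C) (r0 : R) (L : int).
Hypotheses (hf : holo f) (ntf : ~ (exists p : {poly C}, forall z, f z = p.[z])).
Hypotheses (r00 : 0 < r0) (hM : forall r : R, r0 <= r -> r < max_modulus f r).
Local Notation M := (max_modulus f).
Variables (U : set C) (z0 : C).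
Hypotheses (hU : fatou_component f U) (Uz0 : U z0) (Az0 : fast_escaping f r0 L z0).
Hypothesis scU : simply_connected U.

Let wandering u v n m := component_wandering hf ntf r00 hM hU Uz0 Az0 (u := u) (v := v) (n := n) (m := m).

(* If [f^n(U)] covered an annulus about 0, then [U] would be bounded and the
   part of [U] mapped into a thinner annulus compact. There [log f^n] has a single-valued
   branch [h], and [exp (exp (- i pi (h - c)))] contradicts the maximum principle. *)
Lemma annulus_absurd (n : nat) (c : R) (p : C) (rho : R) : (0 < n)%N ->
  (forall w, cmod (w - p) < rho -> U w) ->
  (forall B : R, exists N, forall n w, (N <= n)%N -> cmod (w - p) < rho -> B <= cmod (iter n f w)) ->
  0 < rho -> cmod p < expR (c - 1) -> (forall u, U u -> iter n f u != 0) ->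
  (forall w, expR (c - 1) <= cmod w <= expR (c + 1) -> exists2 x, cmod (x - p) < rho & iter n f x = w) ->
  False.
Proof.
move=> n0 hpU unif rho0 hp hn0 hann.
have Up : U p by apply: hpU; rewrite subrr cmod0.
(* Being connected and containing [p], the set [U] can leave the disc only through the annulus. A
   point of [U] there would be the image under [f^n] of a point near [p], which [wandering] forbids
   for the indices 0 and [n]. *)
have Ubnd : U `<=` [set z | U z /\ cmod z < expR (c - 1)].
  have cU : connected U by case: hU => x _ ->; exact: component_connected.
  apply: (connected_induct cU).
  - by exists p.
  - by move=> z [].
  - move=> z [Uz hz]; exists (expR (c - 1) - cmod z); first by rewrite subr_gt0.
    by move=> w Uw hw; split => //; have := cmodB_ge w z; lra.
  - move=> z Uz hz; split => //; rewrite ltNge; apply/negP => hzc.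
    have hz2 : cmod z <= expR (c + 1).
      have [w [Uw wc] hw] := hz (expR (c + 1) - expR (c - 1)) (ltac:(by rewrite subr_gt0 ltr_expR; lra)).
      by have := cmodB_ge z w; rewrite cmodBC; lra.
    have [x hx hxz] := hann z (ltac:(by rewrite hzc hz2)).
    by apply: (@wandering z x 0%N n) => //; exact: hpU.
pose g := iter n f.
have hg : holo g by exact: holo_iter.
have [h hh] := simply_connected_log (fun z _ => holo_cont hg z) hn0 scU (fun z Uz => component_open hU Uz).
have hcder z : U z -> exists D, cder h z D.
  move=> Uz; have [d hd] := hg z; have [r r1 hr] := component_open hU Uz.
  by exists (d / g z); apply: (@log_cder _ h g z d r r1 (hh z Uz).2) => // w /hr/hh[].
have hRe z : U z -> cmod (g z) = expR (complex.Re (h z)).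
  by move=> Uz; rewrite -cmod_cexp; have [-> _] := hh z Uz.
pose K : set C := [set z | U z /\ c - 1 / 2 <= complex.Re (h z) <= c + 1 / 2].
have KP z : U z -> K z <-> expR (c - 1 / 2) <= cmod (g z) <= expR (c + 1 / 2).
  move=> Uz; rewrite hRe // !ler_expR; split=> [[]|] //.
have lt1 : expR (c - 1) < expR (c - 1 / 2) by rewrite ltr_expR; lra.
have lt2 : expR (c + 1 / 2) < expR (c + 1) by rewrite ltr_expR; lra.
(* The danger is a limit point on the boundary of [U]. Thanks to the margin between the two annuli,
   a whole neighbourhood is mapped by [f^n] into values taken near [p], where escape is uniform; so
   it lies in the Fatou set and the limit point in [U]. *)
have cK : cclosed K.
  move=> z hz.
  have zb : expR (c - 1 / 2) <= cmod (g z) <= expR (c + 1 / 2).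
    apply/andP; split; apply/ler_addgt0Pl => e e0;
      have [d d0 hd] := holo_cont hg z e0; have [w Kw hw] := hz d d0;
      have /andP[k1 k2] := proj1 (KP w Kw.1) Kw; have := hd w hw.
      by have := cmodB_ge (g w) (g z); lra.
    by rewrite cmodBC; have := cmodB_ge (g z) (g w); lra.
  suff Uz : U z by apply/(KP z Uz).
  have [d d0 hd] := holo_cont hg z (ltac:(by rewrite lt_min !subr_gt0 lt1) :
    0 < Num.min (expR (c - 1 / 2) - expR (c - 1)) (expR (c + 1) - expR (c + 1 / 2))).
  have lift w : cmod (w - z) < d -> exists2 x, cmod (x - p) < rho & iter n f x = g w.
    move=> /hd; rewrite lt_min => /andP[k1 k2]; case/andP: zb => z1 z2; apply: hann.
    apply/andP; split; first by have := cmodB_ge (g z) (g w); rewrite cmodBC; lra.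
    by have := cmodB_ge (g w) (g z); lra.
  have Fz w : cmod (w - z) < d -> fatou_set f w.
    move=> hw; exists [set v | cmod (v - z) < d].
      split => //; rewrite openE => v /= hv; apply/nbhs_cmodP; exists (d - cmod (v - z)).
        by rewrite subr_gt0.
      by move=> x hx /=; have := cmod_tri x v z; lra.
    apply: normal_of_uniform_escape => B; have [N hN] := unif B.
    exists (maxn N n) => m v; rewrite geq_max => /andP[Nm nm] hv.
    have [x hx e] := lift v hv.
    have -> : iter m f v = iter m f x by rewrite -(subnK nm) !iterD e.
    exact: hN.
  have [w Kw hw] := hz d d0.
  exact: (component_ball hU Kw.1 hw Fz).
(* With [- i pi] the inner exponential is purely imaginary where [Re h = c - 1 / 2] or [c + 1 / 2],
   so [H] has modulus 1 on the boundary of [K]. Where [Re h = c] it is real and positive, and [H]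
   has modulus above 1. *)
pose kap : C := 0 +i* - pi.
pose H z := cexp (cexp (kap * (h z - c%:C))).
have HE z : cmod (H z) = expR (expR (pi * complex.Im (h z)) * cos (pi * (complex.Re (h z) - c))).
  rewrite /H /kap cmod_cexp; case: (h z) => x y.
  have -> : (0 +i* - pi) * (x +i* y - c%:C) = (pi * y) +i* - (pi * (x - c)).
    by apply/eqP; rewrite eq_complex /=; apply/andP; split; apply/eqP; ring.
  by rewrite cexpE /= cosN.
have dH z : K z -> exists D, cder H z D.
  move=> [Uz _]; have [D hD] := hcder z Uz.
  have h1 := gderMl kap (gderB hD (gder_const c%:C z)).
  have h2 := gder_comp h1 (cder_cexp _).
  by exists (cexp (cexp (kap * (h z - c%:C))) * (cexp (kap * (h z - c%:C)) * (kap * (D - 0)))); exact: gder_comp h2 (cder_cexp _).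
have bK z : K z -> cmod z <= expR (c - 1) by move=> [Uz _]; have [_ /ltW] := Ubnd z Uz.
have edge z : K z -> (forall e : R, 0 < e -> exists2 w, ~ K w & cmod (w - z) < e) -> cmod (H z) <= 1.
  move=> Kz hz; have [Uz /andP[z1 z2]] := Kz.
  have ends : complex.Re (h z) = c - 1 / 2 \/ complex.Re (h z) = c + 1 / 2.
    have [e1|ne1] := eqVneq (complex.Re (h z)) (c - 1 / 2); first by left.
    have [e2|ne2] := eqVneq (complex.Re (h z)) (c + 1 / 2); first by right.
    have lt1' : c - 1 / 2 < complex.Re (h z) by rewrite lt_def ne1.
    have lt2' : complex.Re (h z) < c + 1 / 2 by rewrite lt_def eq_sym ne2.
    have [r r1 hr] := component_open hU Uz.
    have [d d0 hd] := (hh z Uz).2 _ (ltac:(by rewrite lt_min !subr_gt0 lt1') :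
      0 < Num.min (complex.Re (h z) - (c - 1 / 2)) (c + 1 / 2 - complex.Re (h z))).
    have [w nKw] := hz (Num.min r d) (ltac:(by rewrite lt_min r1)).
    rewrite lt_min => /andP[/hr Uw /hd]; rewrite lt_min => /andP[k1 k2]; case: nKw; split => //.
    have := cmod_Re (h w - h z); rewrite raddfB /= ler_norml => /andP[m1 m2].
    by apply/andP; split; lra.
  have -> : cmod (H z) = 1; last by [].
  rewrite HE; case: ends => ->.
    by rewrite (_ : c - 1 / 2 - c = - (1 / 2)) ?mulrN ?cosN ?mul1r ?cos_pihalf ?mulr0 ?expR0 //; ring.
  by rewrite (_ : c + 1 / 2 - c = 1 / 2) ?mul1r ?cos_pihalf ?mulr0 ?expR0 //; ring.
have Hle := max_principle cK bK dH edge.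
have [x hx e] := hann (cexp c%:C) (ltac:(by rewrite cmod_cexp !ler_expR /=; apply/andP; split; lra)).
have Ux := hpU x hx.
have Rec : complex.Re (h x) = c.
  by have := hRe x Ux; rewrite /g e cmod_cexp => /expR_inj <-.
have Kx : K x by split => //; rewrite Rec; apply/andP; split; lra.
have := Hle x Kx; rewrite HE Rec subrr mulr0 cos0 mulr1; apply/negP.
by rewrite -ltNge -expR0 ltr_expR expR_gt0.
Qed.

(** By [wandering], at most one iterate of [U] contains 0. *)
Lemma iter_nonzero : exists N, forall n u, (N <= n)%N -> U u -> iter n f u != 0.
Proof.
have [[n0 [u0 [Uu0 e0]]]|hno] := pselect (exists n u, U u /\ iter n f u = 0); last first.
  by exists 0%N => n u _ Uu; apply/eqP => e; apply: hno; exists n, u.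
exists n0.+1 => n u hn Uu; apply/eqP => e.
by apply: (@wandering u0 u n0 n) => //; rewrite e0 e.
Qed.

Lemma pi_lt4 : pi < 4 :> R.
Proof. by have /andP[_ h] := @pihalf_02 R; lra. Qed.

Lemma ratio_near p : U p -> exists2 rho : R, 0 < rho & exists K : R, exists N, 0 < K /\
  forall n w w', (N <= n)%N -> cmod (w - p) < rho -> cmod (w' - p) < rho ->
    cmod (iter n f w) <= K * cmod (iter n f w').
Proof.
move=> Up; have [rho rho0 [hpU unif]] := component_escaping_uniform hf r00 hM hU Uz0 Az0 Up.
(* [N1] will place [p] inside the annulus covered by [f^n]: the inner radius is the modulus of a
   value taken near [p], hence at least [cmod p + 1]. [N2] makes logarithms of [f^n] available. *)
have [N1 hN1] := unif (cmod p + 1); have [N2 hN2] := iter_nonzero.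
pose r := rho / 16; have r1 : 0 < r by rewrite /r; lra.
(* The derivative of [log f^n] will be at most [384 / (rho / 16)] over a distance of at most
   [2 * (rho / 16)]: hence 768. The successor keeps [n] positive, as [annulus_absurd] demands. *)
exists (rho / 16) => //; exists (expR 768), (N1 + N2).+1; split; first exact: expR_gt0.
move=> n w w' hn hw hw'.
have hiter := holo_iter hf n.
have [|l hl] := @log_on_disc _ (iter n f) p rho rho0 (fun x _ => hiter x).
  by move=> x /hpU; apply: hN2; lia.
have dl x : exists D, cmod (x - p) < rho / 4 -> cder l x D.
  have [hx|hx] := ltP (cmod (x - p)) (rho / 4); last by exists 0.
  by have [_ [D hD]] := hl x hx; exists D.
have [l' hl'] := choice dl.
have bound x : cmod (x - p) < rho / 16 -> rho / 16 * cmod (l' x) <= 384.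
  move=> hx; rewrite leNgt; apply/negP => hbig.
  have [||c hc] := @bloch _ l l' x (rho / 16) (rho / 8) r1 _ _ hbig; first by lra.
    by move=> y hy; apply: hl'; have := cmod_tri y x p; lra.
  have hann v : expR (complex.Re c - 1) <= cmod v <= expR (complex.Re c + 1) ->
      exists2 x, cmod (x - p) < rho & iter n f x = v.
    move=> /andP[v1 v2].
    have cv : 0 < cmod v by apply: lt_le_trans v1; exact: expR_gt0.
    (* Arguments are measured from [Im c]: with [z] a logarithm of [v / cexp im] whose imaginary
       part is at most [pi] in size, [z + im] is a logarithm of [v] at distance at most [1 + pi]
       from [c], inside the Bloch disc of radius 6. *)
    pose im : C := 'i * (complex.Im c)%:C.
    have Reim : complex.Re im = 0 by rewrite /im /=; ring.
    have v0 : v / cexp im != 0 by rewrite mulf_neq0 ?invr_eq0 ?cexp_neq0 // -cmod_gt0.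
    have [z [ez Rez Imz]] := cexp_polar v0.
    have cvi : cmod (v / cexp im) = cmod v by rewrite cmodM cmodV cmod_cexp Reim expR0 invr1 mulr1.
    have [|y hy ly] := hc (z + im).
      have -> : z + im - c = (ln (cmod v) - complex.Re c) +i* complex.Im z.
        rewrite -cvi -Rez /im; case: (z) (c) => a b [c1 c2].
        by apply/eqP; rewrite eq_complex /=; apply/andP; split; apply/eqP; ring.
      apply: le_lt_trans (cmod_ReIm _) _; rewrite /=.
      have p4 := pi_lt4.
      have n1 : `|ln (cmod v) - complex.Re c| <= 1.
        rewrite ler_norml; apply/andP; split.
          by have := v1; rewrite -[cmod v](lnK (_ : cmod v \is Num.pos)) ?posrE // ler_expR lnK ?posrE //; lra.
        by have := v2; rewrite -[cmod v](lnK (_ : cmod v \is Num.pos)) ?posrE // ler_expR lnK ?posrE //; lra.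
      lra.
    have yr : cmod (y - p) < rho / 4 by have := cmod_tri y x p; lra.
    exists y; first by lra.
    by have [<- _] := hl y yr; rewrite ly cexpD ez divfK // cexp_neq0.
  apply: (@annulus_absurd n (complex.Re c) p rho) => //; first by clear -hn; lia.
    have [|y hy e] := hann (cexp (complex.Re c - 1)%:C).
      by rewrite cmod_cexp !ler_expR /=; apply/andP; split; lra.
    have n1 : (N1 <= n)%N by clear -hn; lia.
    by have := hN1 n y n1 hy; rewrite e cmod_cexp /=; lra.
  by move=> u; apply: hN2; clear -hn; lia.
have lw : cmod (l w - l w') <= 768.
  have := @cder_lipschitz _ l l' w' w (384 / (rho / 16)).
  have seg t : 0 <= t <= 1 -> cmod (w' + t%:C * (w - w') - p) < rho / 16.
    by move=> t01; exact: ball_segment.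
  move=> k; apply: le_trans (k _ _) _ => [t t01|t t01|].
  - by apply: hl'; have := seg t t01; lra.
  - by rewrite ler_pdivlMr // mulrC; apply: bound; exact: seg.
  have : cmod (w - w') <= 2 * (rho / 16) by have := cmod_tri w p w'; rewrite (cmodBC p); lra.
  move=> hww; apply: le_trans (_ : 384 / (rho / 16) * (2 * (rho / 16)) <= _).
    by apply: ler_wpM2l hww; apply: divr_ge0; [exact: ler0n|exact: ltW].
  rewrite mulrCA divfK; last by rewrite gt_eqF.
  lra.
have [e1 _] := hl w (ltac:(lra)); have [e2 _] := hl w' (ltac:(lra)).
rewrite -e1 -e2 !cmod_cexp -expRD ler_expR.
have := le_trans (ler_norm _) (le_trans (cmod_Re _) lw); rewrite raddfB /=; lra.
Qed.

Lemma ratio_bounded z : U z -> exists K : R, exists N, 0 < K /\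
  forall n, (N <= n)%N -> cmod (iter n f z0) <= K * cmod (iter n f z).
Proof.
pose W := [set z | U z /\ exists K : R, exists N, 0 < K /\
  forall n, (N <= n)%N -> cmod (iter n f z0) <= K * cmod (iter n f z)].
have cU : connected U by case: hU => x _ ->; exact: component_connected.
have ext y y' p rho K N : 0 < K -> (forall n w w', (N <= n)%N -> cmod (w - p) < rho -> cmod (w' - p) < rho ->
    cmod (iter n f w) <= K * cmod (iter n f w')) -> cmod (y - p) < rho -> cmod (y' - p) < rho ->
    W y -> U y' -> W y'.
  move=> K0 h hy hy' [Uy [K' [N' [K'0 h']]]] Uy'; split => //; exists (K' * K), (maxn N N').
  split=> [|n]; first exact: mulr_gt0.
  rewrite geq_max => /andP[Nn N'n]; apply: le_trans (h' n N'n) _.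
  by rewrite -mulrA ler_pM2l //; exact: h.
suff sub : U `<=` W by move=> /sub[].
apply: (connected_induct cU).
- by exists z0; split => //; exists 1, 0%N; split => // n _; rewrite mul1r.
- by move=> y [].
- move=> y Wy; have [rho rho0 [K [N [K0 h]]]] := ratio_near Wy.1.
  by exists rho => // w Uw hw; apply: (ext y w y rho K N K0 h) => //; rewrite subrr cmod0.
- move=> y Uy hy; have [rho rho0 [K [N [K0 h]]]] := ratio_near Uy.
  have [w Ww hw] := hy rho rho0.
  by apply: (ext w y y rho K N K0 h) => //; rewrite subrr cmod0.
Qed.

Lemma simply_connected_fast_escaping : U `<=` fast_escaping f r0 L.
Proof.
move=> z Uz n m n0 nm; rewrite leNgt; apply/negP => hlt.
pose v k := cmod (iter (k + n) f z); pose S k := iter (k + m) M r0.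
have S0 k : 0 < S k by apply: lt_le_trans r00 _; exact: iter_max_modulus_ge.
have v0 k : 0 <= v k by exact: cmod_ge0.
(* The inequality has to stay strict: the ratio [a] below is taken at the later index [k0] and must
   exceed 1. *)
have vS k : v k < S k.
  elim: k => [//|k IH]; apply: le_lt_trans (max_modulus_strict hf ntf (v0 k) IH).
  by rewrite /v addSn iterS; exact: cmod_le_max_modulus.
have Sz0 k : S k <= cmod (iter (k + n) f z0).
  by apply: Az0; [rewrite ltn_addl|clear -nm; lia].
have [K [N [K0 hK]]] := ratio_bounded Uz.
have [s0 s00 hs] := max_modulus_ratio hf ntf.
have [N' hN'] := component_escaping hf r00 hM hU Uz0 Az0 Uz s0.
pose k0 := (N + N')%N.
have vs k : (k0 <= k)%N -> s0 <= v k by move=> hk; apply: hN'; rewrite /k0 in hk; lia.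
have vp k : (k0 <= k)%N -> 0 < v k by move=> /vs; exact: lt_le_trans.
have step k : (k0 <= k)%N -> v k.+1 * S k ^+ 2 <= S k.+1 * v k ^+ 2.
  move=> hk; apply: le_trans (hs _ _ (vs k hk) (ltW (vS k))).
  by rewrite ler_wpM2r ?sqr_ge0 // /v addSn iterS; exact: cmod_le_max_modulus.
pose a := S k0 / v k0.
have a1 : 1 < a by rewrite /a ltr_pdivlMr ?vp // mul1r.
have a0 : 0 < a by lra.
have aE : a * v k0 = S k0 by rewrite /a divfK // gt_eqF // vp.
clearbody a.
(* The ratio [S / v] at least squares at each step, and [j.+2 <= 2 * j.+1], so powers of [a] with
   linearly growing exponent are a safe lower bound. *)
have grow j : a ^+ j.+1 * v (k0 + j)%N <= S (k0 + j)%N.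
  elim: j => [|j IH]; first by rewrite addn0 expr1 aE.
  have hj : (k0 <= k0 + j)%N by exact: leq_addr.
  have vj := vp _ hj; have h := step _ hj; rewrite addnS.
  have v2 : 0 < v (k0 + j)%N ^+ 2 by rewrite exprn_gt0.
  rewrite -(ler_pM2r v2); apply: le_trans h.
  apply: le_trans (_ : v (k0 + j).+1 * (a ^+ j.+1 * v (k0 + j)%N) ^+ 2 <= _); last first.
    rewrite ler_wpM2l // lerXn2r ?nnegrE //; last exact: ltW.
    by rewrite mulr_ge0 // exprn_ge0 // ltW.
  rewrite [(a ^+ j.+1 * _) ^+ 2]exprMn [X in _ <= X]mulrCA -[X in X <= _]mulrA; apply: ler_wpM2r.
    by apply: mulr_ge0; [exact: v0|exact: sqr_ge0].
  by rewrite -exprM ler_weXn2l ?(ltW a1) //; clear; lia.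
have bnd j : a ^+ j.+1 <= K.
  have hj : (k0 <= k0 + j)%N by exact: leq_addr.
  rewrite -(ler_pM2r (vp _ hj)); apply: le_trans (grow j) _; apply: le_trans (Sz0 _) _.
  by apply: hK; rewrite /k0; lia.
pose j := Num.truncn (K / (a - 1)).
have := bnd j; apply/negP; rewrite -ltNge.
have a10 : 0 < a - 1 by lra.
have bern q : 1 + q%:R * (a - 1) <= a ^+ q.
  elim: q => [|q IH]; first by rewrite mul0r addr0 expr0.
  rewrite exprS -natr1; apply: le_trans (_ : a * (1 + q%:R * (a - 1)) <= _); last by rewrite ler_pM2l.
  have : 0 <= q%:R * (a - 1) * (a - 1) by rewrite !mulr_ge0 // ltW.
  lra.
apply: lt_le_trans (bern j.+1).
have : K / (a - 1) < j.+1%:R by exact: truncnS_gt.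
by rewrite ltr_pdivrMr //; lra.
Qed.
End SimplyConnectedComponent.

Theorem theorem1p2 (R : realType) (f : R[i] -> R[i]) (r0 : R) (L : int)
    (U : set R[i])
    (hf : transcendental_entire f)
    (hr0 : 0 < r0)
    (hM : forall r : R, r0 <= r -> r < max_modulus f r)
    (hU : fatou_component f U)
    (hUA : U `&` fast_escaping f r0 L !=set0) :
  closure U `<=` fast_escaping f r0 (L - 1) /\
  (simply_connected U -> closure U `<=` fast_escaping f r0 L).
Proof.
have [ef ntf] := hf; have holof : holo f by move=> z; exact/derivable_cder/ef.
have [z0 [Uz0 Az0]] := hUA.
split=> [|scU]; apply: fast_escaping_closed => //.
  exact: (component_fast_escaping_pred holof ntf hr0 hM hU Uz0 Az0).
exact: (simply_connected_fast_escaping holof ntf hr0 hM hU Uz0 Az0 scU).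
Qed.
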